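(* Suppose that a domain $\Omega\subset E_k$ is convex with respect to the set of directions $M_u$ and $f_u(E_k)=\mathbb{C}$ for all $u=1,\ldots,m$. Then every monogenic function $\Phi:\Omega\to\mathbb{A}_n^m$ can be continued to a function monogenic in the domain $\Pi:=\{\zeta\in E_k: f_u(\zeta)\in D_u \text{ for all } u=1,\ldots,m\}$.
   Context: Fix integers $1\le m\le n$. $\mathbb{A}_n^m$ is an $n$-dimensional commutative associative algebra with unit over $\mathbb{C}$ having a basis $\{I_r\}_{r=1}^n$ with the multiplication rules: (1) for $r,s\in\{1,\ldots,m\}$: $I_rI_s=0$ if $r\ne s$ and $I_rI_r=I_r$; (2) for $r,s\in\{m+1,\ldots,n\}$: $I_rI_s=\sum_{p=\max\{r,s\}+1}^n\Upsilon^s_{r,p}I_p$ with $\Upsilon^s_{r,p}\in\mathbb{C}$; (3) for each $s\in\{m+1,\ldots,n\}$ there is a unique $u_s\in\{1,\ldots,m\}$ such that for all $r\in\{1,\ldots,m\}$: $I_rI_s=I_s$ if $r=u_s$ and $I_rI_s=0$ otherwise. For $u=1,\ldots,m$, $f_u:\mathbb{A}_n^m\to\mathbb{C}$ is the linear functional $f_u(\sum_r\lambda_rI_r)=\lambda_u$. Let $2\le k\le 2n$ and let $e_1=1=\sum_{r=1}^mI_r$, $e_j=\sum_{r=1}^n a_{jr}I_r$ ($j=2,\ldots,k$) be linearly independent over $\mathbb{R}$; $E_k$ is their real linear span. $M_u:=\{\zeta\in E_k: f_u(\zeta)=0\}$. A domain $\Omega\subset E_k$ is convex with respect to the set of directions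 $M_u$ if for all $\zeta_1,\zeta_2\in\Omega$ with $\zeta_2-\zeta_1\in M_u$ the segment joining them lies in $\Omega$. $D_u:=f_u(\Omega)$. A continuous function $\Phi:\Omega\to\mathbb{A}_n^m$ is monogenic in $\Omega$ if for every $\zeta\in\Omega$ there is $\Phi'(\zeta)\in\mathbb{A}_n^m$ with $\lim_{\varepsilon\to0^+}(\Phi(\zeta+\varepsilon h)-\Phi(\zeta))\varepsilon^{-1}=h\Phi'(\zeta)$ for all $h\in E_k$.
   Formalization: The formal statement does not assert that Π is a domain: under the given hypotheses Π is open but need not be connected (it can fail for n=m=2, k=3). The continuation of Φ to a monogenic function on the set Π is stated in full. *)

(* Defs.v *)
From Stdlib Require Import Reals Lra Lia.
Open Scope R_scope.

Definition Cpx : Type := (R * R)%type.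
Definition C0 : Cpx := (0, 0).
Definition C1 : Cpx := (1, 0).
Definition Cadd (z w : Cpx) : Cpx := (fst z + fst w, snd z + snd w).
Definition Copp (z : Cpx) : Cpx := (- fst z, - snd z).
Definition Cmul (z w : Cpx) : Cpx :=
  (fst z * fst w - snd z * snd w, fst z * snd w + snd z * fst w).
Definition RCmul (t : R) (z : Cpx) : Cpx := (t * fst z, t * snd z).
(* a norm on Cpx (equivalent to the modulus) *)
Definition Cnorm (z : Cpx) : R := Rabs (fst z) + Rabs (snd z).

Fixpoint Csum_from (lo len : nat) (f : nat -> Cpx) : Cpx :=
  match len with
  | O => C0
  | S l => Cadd (f lo) (Csum_from (S lo) l f)
  end.
Definition Csum (N : nat) (f : nat -> Cpx) : Cpx := Csum_from 1 N f.

Fixpoint Rsum_from (lo len : nat) (f : nat -> R) : R :=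
  match len with
  | O => 0
  | S l => f lo + Rsum_from (S lo) l f
  end.
Definition Rsum (N : nat) (f : nat -> R) : R := Rsum_from 1 N f.

(** * The algebra A_n^m
    An element [sum_{r=1}^n lambda_r I_r] is represented by its coordinate
    function [r |-> lambda_r]; only the coordinates r = 1..n are meaningful
    (all notions below only look at those coordinates). *)
Definition vec : Type := nat -> Cpx.

Definition vadd (a b : vec) : vec := fun r => Cadd (a r) (b r).
Definition vsub (a b : vec) : vec := fun r => Cadd (a r) (Copp (b r)).
Definition vscal (t : R) (a : vec) : vec := fun r => RCmul t (a r).

Definition veq (n : nat) (a b : vec) : Prop :=
  forall r, (1 <= r <= n)%nat -> a r = b r.

Fixpoint Rsum_norm (lo len : nat) (a : vec) : R :=
  match len with
  | O => 0
  | S l => Cnorm (a lo) + Rsum_norm (S lo) l a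
  end.
Definition vnorm (n : nat) (a : vec) : R := Rsum_norm 1 n a.

Definition basisI (r : nat) : vec :=
  fun p => if Nat.eqb p r then C1 else C0.

(** Structure constants: [struct_const m u Ups r s p] is the coefficient of
    I_p in the product I_r I_s, following rules (1)-(3) (and commutativity for
    the case r > m >= s).  [Ups s r p] stands for Upsilon^s_{r,p}. *)
Definition struct_const (m : nat) (u : nat -> nat) (Ups : nat -> nat -> nat -> Cpx)
  (r s p : nat) : Cpx :=
  if Nat.leb r m then
    if Nat.leb s m then
      (if Nat.eqb r s && Nat.eqb p r then C1 else C0)%bool
    else
      (if Nat.eqb r (u s) && Nat.eqb p s then C1 else C0)%bool
  else
    if Nat.leb s m then
      (if Nat.eqb s (u r) && Nat.eqb p r then C1 else C0)%bool
    else
      (if Nat.ltb (Nat.max r s) p then Ups s r p else C0).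

Definition vmul (n m : nat) (u : nat -> nat) (Ups : nat -> nat -> nat -> Cpx)
  (a b : vec) : vec :=
  fun p => Csum n (fun r => Csum n (fun s =>
             Cmul (Cmul (a r) (b s)) (struct_const m u Ups r s p))).

Definition is_algebra_Anm (n m : nat) (u : nat -> nat)
  (Ups : nat -> nat -> nat -> Cpx) : Prop :=
  (1 <= m <= n)%nat /\
  (forall s, (m < s <= n)%nat -> (1 <= u s <= m)%nat) /\
  (forall a b, veq n (vmul n m u Ups a b) (vmul n m u Ups b a)) /\
  (forall a b c, veq n (vmul n m u Ups (vmul n m u Ups a b) c)
                       (vmul n m u Ups a (vmul n m u Ups b c))).

Definition f_ (u : nat) (a : vec) : Cpx := a u.

(** * The space E_k
    [e a j] is e_j: e_1 = 1 = sum_{r=1}^m I_r, e_j = sum_r a_{jr} I_r. *)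
Definition unitA (m : nat) : vec := fun r => if Nat.leb r m then C1 else C0.
Definition e_ (m : nat) (a : nat -> nat -> Cpx) (j : nat) : vec :=
  if Nat.eqb j 1 then unitA m else a j.

Definition lincomb (m k : nat) (a : nat -> nat -> Cpx) (x : nat -> R) : vec :=
  fun r => Csum k (fun j => RCmul (x j) (e_ m a j r)).

Definition lin_indep (n m k : nat) (a : nat -> nat -> Cpx) : Prop :=
  forall x : nat -> R, veq n (lincomb m k a x) (fun _ => C0) ->
    forall j, (1 <= j <= k)%nat -> x j = 0.

Definition inE (n m k : nat) (a : nat -> nat -> Cpx) (z : vec) : Prop :=
  exists x : nat -> R, veq n z (lincomb m k a x).

Definition inM (n m k : nat) (a : nat -> nat -> Cpx) (u : nat) (z : vec) : Prop :=
  inE n m k a z /\ f_ u z = C0.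

Definition is_open_in_E (n m k : nat) (a : nat -> nat -> Cpx) (Om : vec -> Prop) : Prop :=
  (forall z, Om z -> inE n m k a z) /\
  (forall z, Om z -> exists d, d > 0 /\
     forall w, inE n m k a w -> vnorm n (vsub w z) < d -> Om w).

(** connectedness: every relatively clopen subset (locally constant predicate)
    containing a point of Om contains all of Om *)
Definition is_connected (n : nat) (Om : vec -> Prop) : Prop :=
  forall P : vec -> Prop,
    (forall z, Om z -> exists d, d > 0 /\
       forall w, Om w -> vnorm n (vsub w z) < d -> (P w <-> P z)) ->
    (exists z0, Om z0 /\ P z0) ->
    forall z, Om z -> P z.

Definition is_domain (n m k : nat) (a : nat -> nat -> Cpx) (Om : vec -> Prop) : Prop :=
  is_open_in_E n m k a Om /\ is_connected n Om.

Definition convex_wrt_M (n m k : nat) (a : nat -> nat -> Cpx) (u : nat)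
  (Om : vec -> Prop) : Prop :=
  forall z1 z2, Om z1 -> Om z2 -> inM n m k a u (vsub z2 z1) ->
    forall t, 0 <= t <= 1 -> Om (vadd z1 (vscal t (vsub z2 z1))).

Definition D_ (u : nat) (Om : vec -> Prop) (z : Cpx) : Prop :=
  exists w, Om w /\ f_ u w = z.

Definition Pi_ (n m k : nat) (a : nat -> nat -> Cpx) (Om : vec -> Prop) (z : vec) : Prop :=
  inE n m k a z /\ forall u, (1 <= u <= m)%nat -> D_ u Om (f_ u z).

Definition continuous_on (n : nat) (Om : vec -> Prop) (Phi : vec -> vec) : Prop :=
  forall z, Om z -> forall eta, eta > 0 -> exists d, d > 0 /\
    forall w, Om w -> vnorm n (vsub w z) < d -> vnorm n (vsub (Phi w) (Phi z)) < eta.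

Definition monogenic (n m : nat) (u : nat -> nat) (Ups : nat -> nat -> nat -> Cpx)
  (k : nat) (a : nat -> nat -> Cpx) (Om : vec -> Prop) (Phi : vec -> vec) : Prop :=
  continuous_on n Om Phi /\
  forall z, Om z -> exists Phi' : vec,
    forall h, inE n m k a h ->
      forall eta, eta > 0 -> exists d, d > 0 /\
        forall eps, 0 < eps < d ->
          vnorm n (vsub (vscal (/ eps) (vsub (Phi (vadd z (vscal eps h))) (Phi z)))
                        (vmul n m u Ups h Phi')) < eta.

(* Main.v *)
(** The coordinates of [Phi] are peeled off one after the other.  If the coordinates below [p]
    vanish on [Om], then the [p]-th coordinate of [h * Phi'(z)] is [h_q Phi'(z)_p], where [q] is
    the index with [I_q I_p = I_p].  Convexity in the directions [M_q] makes the [p]-th coordinate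
    of [Phi] a function [G] of [z_q] alone, and [G] is complex differentiable along every ray.
    Such a continuous [G] is holomorphic (a theorem of Looman-Menchoff type), so
    [sum_k G^(k)(z_q)/k! (z - z_q)^k I_p], a finite sum because [(z - z_q) I_q] is nilpotent, is
    monogenic wherever [z_q] lies in [D_q].  Subtracting it kills the [p]-th coordinate.

    For the analytic step, let [E] be the set of points near which [G] is not holomorphic.  By
    Baire's theorem the difference quotients of [G] along the axes are uniformly bounded on a
    portion of [E]; the maximum principle in the four quadrants at a point [x] of [E], applied to
    [(G(z) - G(x)) / (z - x)], extends the bound to all directions, and Cauchy's estimate extends
    it to all points nearby.  So [G] is Lipschitz there, and a Lipschitz function with complex
    linear directional derivatives is complex differentiable: hence [E] is empty. *)

From Stdlib Require Import Reals Lra Lia Classical ClassicalEpsilon FunctionalExtensionality.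
From Coquelicot Require Import Coquelicot.
Require Import Defs.
Open Scope R_scope.

(** * Complex derivatives *)

(** Monogenicity is a one-sided derivative along each ray, with no uniformity in the direction. So
    [G] is not known to be complex differentiable at any single point, and Cauchy's theorem cannot
    be applied to it directly. The peeling works because the multiplication is triangular: [I_r]
    with [r > m] strictly raises the index, so [I_q] alone contributes to the leading coordinate of
    [h * Phi'(z)]. The coordinates of [Phi'(z)] below [p] vanish because [h = 1] lies in [E_k].
    Surjectivity of the functional at [q] gives a real-linear section from the plane to [E_k], which
    makes [D_q] open and supplies rays in every complex direction. Quadrants enter because the axis
    bound at [x] controls the two edges through [x]. On the outer edges continuity is enough, and
    two singular points are joined by two axis-parallel steps, one from each. Cauchy's estimate is
    then taken on a square whose size is comparable with the distance to [E], so that the bound does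
    not degenerate near [E]. The value of the winding integral is never computed: its modulus is at
    least 4, and that suffices. *)

Lemma Cmod_minus_sym (z w : C) : Cmod (z - w) = Cmod (w - z).
Proof. rewrite <- Cmod_opp. f_equal. ring. Qed.

Lemma Cmod_self (z : C) : Cmod (z - z) = 0.
Proof. replace (z - z)%C with (RtoC 0) by ring. apply Cmod_0. Qed.

Lemma Cmod_le_abs (z : C) : Cmod z <= Rabs (fst z) + Rabs (snd z).
Proof.
  destruct z as [x y]; simpl.
  replace (x, y) with (RtoC x + Ci * RtoC y)%C
    by (unfold RtoC, Ci, Cplus, Cmult; simpl; f_equal; ring).
  eapply Rle_trans; [apply Cmod_triangle|].
  rewrite Cmod_mult, Cmod_Ci, !Cmod_R. lra.
Qed.

Lemma abs_fst_le_Cmod (z : C) : Rabs (fst z) <= Cmod z.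
Proof. eapply Rle_trans; [|apply Rmax_Cmod]. apply Rmax_l. Qed.

Lemma abs_snd_le_Cmod (z : C) : Rabs (snd z) <= Cmod z.
Proof. eapply Rle_trans; [|apply Rmax_Cmod]. apply Rmax_r. Qed.

Lemma Cmod_le_plus (z w v : C) : Cmod (z - v) <= Cmod (z - w) + Cmod (w - v).
Proof.
  replace (z - v)%C with ((z - w) + (w - v))%C by ring. apply Cmod_triangle.
Qed.

Lemma Cmod_le_split (z w : C) : Cmod z <= Cmod (z - w) + Cmod w.
Proof.
  replace z with ((z - w) + w)%C at 1 by ring. apply Cmod_triangle.
Qed.

Definition ccont (f : C -> C) (z : C) : Prop :=
  forall eps, 0 < eps -> exists d, 0 < d /\
    forall w, Cmod (w - z) < d -> Cmod (f w - f z) < eps.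

(** Multiplied out, so that [w = z] needs no exclusion and remainders of sums, products and
    compositions can simply be added. *)
Definition cdiff (f : C -> C) (z d : C) : Prop :=
  forall eps, 0 < eps -> exists del, 0 < del /\
    forall w, Cmod (w - z) < del ->
      Cmod (f w - f z - d * (w - z)) <= eps * Cmod (w - z).

Definition cdiffable (f : C -> C) (z : C) : Prop := exists d, cdiff f z d.

Lemma cdiff_bound (f : C -> C) (z d : C) : cdiff f z d ->
  exists del, 0 < del /\ forall w, Cmod (w - z) < del ->
    Cmod (f w - f z) <= (Cmod d + 1) * Cmod (w - z).
Proof.
  intros H. destruct (H 1 Rlt_0_1) as (del & Hd & Hw).
  exists del; split; [easy|]. intros w Hw1. specialize (Hw w Hw1).
  pose proof (Cmod_le_split (f w - f z) (d * (w - z))) as H1.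
  rewrite Cmod_mult in H1. lra.
Qed.

Lemma Cmult_continuous (p q : C) (eps : R) : 0 < eps -> exists d, 0 < d /\
  forall p' q', Cmod (p' - p) < d -> Cmod (q' - q) < d -> Cmod (p' * q' - p * q) < eps.
Proof.
  intros He. pose proof (Cmod_ge_0 q) as Pq. pose proof (Cmod_ge_0 p) as Pp.
  set (d := Rmin 1 (eps / (Cmod q + Cmod p + 2))).
  assert (Hd : 0 < d) by (apply Rmin_glb_lt; [lra|apply Rdiv_lt_0_compat; lra]).
  exists d. split; [easy|]. intros p' q' Hp Hq.
  replace (p' * q' - p * q)%C with ((p' - p) * (q' - q) + ((p' - p) * q + p * (q' - q)))%C by ring.
  eapply Rle_lt_trans; [apply Cmod_triangle|].
  eapply Rle_lt_trans; [apply Rplus_le_compat_l, Cmod_triangle|]. rewrite !Cmod_mult.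
  assert (E1 : d <= 1) by apply Rmin_l.
  assert (E2 : d * (Cmod q + Cmod p + 2) <= eps).
  { apply Rle_trans with (eps / (Cmod q + Cmod p + 2) * (Cmod q + Cmod p + 2)).
    - apply Rmult_le_compat_r; [lra|apply Rmin_r].
    - right. field. lra. }
  pose proof (Cmod_ge_0 (p' - p)). pose proof (Cmod_ge_0 (q' - q)).
  assert (Cmod (p' - p) * Cmod (q' - q) <= d * 1) by (apply Rmult_le_compat; lra).
  assert (Cmod (p' - p) * Cmod q <= d * Cmod q) by (apply Rmult_le_compat_r; lra).
  assert (Cmod p * Cmod (q' - q) <= Cmod p * d) by (apply Rmult_le_compat_l; lra).
  lra.
Qed.

Lemma ccont_mult (f g : C -> C) (z : C) :
  ccont f z -> ccont g z -> ccont (fun w => f w * g w)%C z.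
Proof.
  intros Hf Hg eps He. destruct (Cmult_continuous (f z) (g z) eps He) as (e & Hpos & Hm).
  destruct (Hf e Hpos) as (d1 & H1 & A1). destruct (Hg e Hpos) as (d2 & H2 & A2).
  exists (Rmin d1 d2). split; [apply Rmin_glb_lt; easy|]. intros w Hw. apply Hm.
  - apply A1, Rlt_le_trans with (1 := Hw), Rmin_l.
  - apply A2, Rlt_le_trans with (1 := Hw), Rmin_r.
Qed.

Lemma cdiffable_ccont (f : C -> C) (z : C) : cdiffable f z -> ccont f z.
Proof.
  intros [d H] eps He. destruct (cdiff_bound f z d H) as (del & Hd & Hw).
  pose proof (Cmod_ge_0 d) as Hp.
  assert (H0 : 0 < eps / (Cmod d + 1)) by (apply Rdiv_lt_0_compat; lra).
  exists (Rmin del (eps / (Cmod d + 1))). split; [apply Rmin_glb_lt; easy|].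
  intros w H1.
  assert (H2 := Rlt_le_trans _ _ _ H1 (Rmin_l _ _)).
  assert (H3 := Rlt_le_trans _ _ _ H1 (Rmin_r _ _)).
  eapply Rle_lt_trans; [apply Hw; easy|].
  apply Rmult_lt_compat_l with (r := Cmod d + 1) in H3; [|lra].
  replace ((Cmod d + 1) * (eps / (Cmod d + 1))) with eps in H3 by (field; lra). easy.
Qed.

Lemma cdiff_local (f g : C -> C) (z d : C) (r : R) : 0 < r ->
  (forall w, Cmod (w - z) < r -> f w = g w) -> cdiff f z d -> cdiff g z d.
Proof.
  intros Hr E H eps He. destruct (H eps He) as (del & Hd & Hw).
  exists (Rmin del r). split; [apply Rmin_glb_lt; easy|].
  intros w H1. rewrite <- !E.
  - apply Hw. apply Rlt_le_trans with (1 := H1), Rmin_l.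
  - replace (z - z)%C with (RtoC 0) by ring. rewrite Cmod_0. easy.
  - apply Rlt_le_trans with (1 := H1), Rmin_r.
Qed.

Lemma cdiff_const (c z : C) : cdiff (fun _ => c) z 0.
Proof.
  intros eps He. exists 1. split; [lra|]. intros w _.
  replace (c - c - 0 * (w - z))%C with (RtoC 0) by ring.
  rewrite Cmod_0. apply Rmult_le_pos; [lra|apply Cmod_ge_0].
Qed.

Lemma cdiff_id (z : C) : cdiff (fun w => w) z 1.
Proof.
  intros eps He. exists 1. split; [lra|]. intros w _.
  replace (w - z - 1 * (w - z))%C with (RtoC 0) by ring.
  rewrite Cmod_0. apply Rmult_le_pos; [lra|apply Cmod_ge_0].
Qed.

Lemma cdiff_plus (f g : C -> C) (z a b : C) :
  cdiff f z a -> cdiff g z b -> cdiff (fun w => f w + g w)%C z (a + b).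
Proof.
  intros Hf Hg eps He.
  destruct (Hf (eps / 2)) as (d1 & H1 & Hf1); [lra|].
  destruct (Hg (eps / 2)) as (d2 & H2 & Hg1); [lra|].
  exists (Rmin d1 d2). split; [apply Rmin_glb_lt; easy|]. intros w Hw.
  specialize (Hf1 w (Rlt_le_trans _ _ _ Hw (Rmin_l _ _))).
  specialize (Hg1 w (Rlt_le_trans _ _ _ Hw (Rmin_r _ _))).
  replace (f w + g w - (f z + g z) - (a + b) * (w - z))%C
    with ((f w - f z - a * (w - z)) + (g w - g z - b * (w - z)))%C by ring.
  eapply Rle_trans; [apply Cmod_triangle|]. lra.
Qed.

Lemma cdiff_mult (f g : C -> C) (z a b : C) :
  cdiff f z a -> cdiff g z b ->
  cdiff (fun w => f w * g w)%C z (a * g z + f z * b).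
Proof.
  intros Hf Hg eps He.
  destruct (cdiff_bound g z b Hg) as (d3 & H3 & Hb).
  pose proof (Cmod_ge_0 (f z)) as P1. pose proof (Cmod_ge_0 (g z)) as P2.
  pose proof (Cmod_ge_0 a) as P3. pose proof (Cmod_ge_0 b) as P4.
  (* [K] dominates the factor that accompanies each of the three remainders below, so each remainder
     is at most a third of the bound. *)
  set (K := Cmod (g z) + Cmod (f z) + Cmod a * (Cmod b + 1) + Cmod b + 1).
  assert (0 <= Cmod a * (Cmod b + 1)) by (apply Rmult_le_pos; lra).
  assert (HK : 0 < K) by (unfold K; lra).
  assert (He' : 0 < eps / (3 * K)) by (apply Rdiv_lt_0_compat; lra).
  destruct (Hf _ He') as (d1 & H1 & Hf1).
  destruct (Hg _ He') as (d2 & H2 & Hg1).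
  (* Radius 1 gives [Cmod (g w) <= K]; radius [eps / (3 * K)] absorbs the quadratic term
     [a * (w - z) * (g w - g z)]. *)
  exists (Rmin (Rmin d1 d2) (Rmin d3 (Rmin 1 (eps / (3 * K))))).
  split; [repeat apply Rmin_glb_lt; lra|]. intros w Hw.
  assert (Hw1 : Cmod (w - z) < d1)
    by (apply Rlt_le_trans with (1 := Hw); eapply Rle_trans; [apply Rmin_l|apply Rmin_l]).
  assert (Hw2 : Cmod (w - z) < d2)
    by (apply Rlt_le_trans with (1 := Hw); eapply Rle_trans; [apply Rmin_l|apply Rmin_r]).
  assert (Hw' := Rlt_le_trans _ _ _ Hw (Rmin_r _ _)).
  assert (Hw3 := Rlt_le_trans _ _ _ Hw' (Rmin_l _ _)).
  assert (Hw'' := Rlt_le_trans _ _ _ Hw' (Rmin_r _ _)).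
  assert (Hw4 := Rlt_le_trans _ _ _ Hw'' (Rmin_l _ _)).
  assert (Hw5 := Rlt_le_trans _ _ _ Hw'' (Rmin_r _ _)).
  specialize (Hf1 w Hw1). specialize (Hg1 w Hw2). specialize (Hb w Hw3).
  replace (f w * g w - f z * g z - (a * g z + f z * b) * (w - z))%C
    with ((f w - f z - a * (w - z)) * g w + f z * (g w - g z - b * (w - z))
          + a * (w - z) * (g w - g z))%C by ring.
  set (t := Cmod (w - z)) in *.
  assert (Ht : 0 <= t) by apply Cmod_ge_0.
  eapply Rle_trans; [apply Cmod_triangle|].
  eapply Rle_trans; [apply Rplus_le_compat_r, Cmod_triangle|].
  rewrite !Cmod_mult. fold t.
  assert (Hg2 : Cmod (g w) <= K).
  { pose proof (Cmod_le_split (g w) (g z)).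
    assert ((Cmod b + 1) * t <= (Cmod b + 1) * 1) by (apply Rmult_le_compat_l; lra).
    unfold K; lra. }
  assert (Q : forall x, 0 <= x <= K -> eps / (3 * K) * t * x <= eps / 3 * t).
  { intros x Hx. replace (eps / 3 * t) with (eps / (3 * K) * t * K) by (field; lra).
    apply Rmult_le_compat_l; [|lra]. apply Rmult_le_pos; lra. }
  assert (A1 : Cmod (f w - f z - a * (w - z)) * Cmod (g w) <= eps / 3 * t).
  { eapply Rle_trans; [|apply (Q (Cmod (g w))); split; [apply Cmod_ge_0|easy]].
    apply Rmult_le_compat_r; [apply Cmod_ge_0|easy]. }
  assert (A2 : Cmod (f z) * Cmod (g w - g z - b * (w - z)) <= eps / 3 * t).
  { eapply Rle_trans; [|apply (Q (Cmod (f z))); unfold K; lra].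
    rewrite Rmult_comm. apply Rmult_le_compat_r; lra. }
  assert (A3 : Cmod a * t * Cmod (g w - g z) <= eps / 3 * t).
  { eapply Rle_trans; [|apply (Q (Cmod a * (Cmod b + 1))); unfold K; lra].
    replace (eps / (3 * K) * t * (Cmod a * (Cmod b + 1)))
      with (Cmod a * t * ((Cmod b + 1) * (eps / (3 * K)))) by ring.
    apply Rmult_le_compat_l; [apply Rmult_le_pos; lra|].
    eapply Rle_trans; [apply Hb|]. apply Rmult_le_compat_l; lra. }
  lra.
Qed.

Lemma cdiff_inv (z : C) : z <> 0 -> cdiff (fun w => / w)%C z (- / (z * z)).
Proof.
  intros Hz eps He.
  assert (P := proj1 (Cmod_gt_0 z) Hz). set (m := Cmod z) in *.
  (* The first radius keeps [Cmod w] above [m / 2]; the second then controls the exact remainder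
     [(w - z)^2 / (z^2 w)]. *)
  exists (Rmin (m / 2) (eps * (m * m * m) / 2)).
  assert (0 < m * m * m) by (repeat apply Rmult_lt_0_compat; easy).
  assert (0 < eps * (m * m * m)) by (apply Rmult_lt_0_compat; easy).
  split; [apply Rmin_glb_lt; lra|]. intros w Hw.
  assert (Hw1 := Rlt_le_trans _ _ _ Hw (Rmin_l _ _)).
  assert (Hw2 := Rlt_le_trans _ _ _ Hw (Rmin_r _ _)).
  assert (Hwm : m / 2 < Cmod w).
  { pose proof (Cmod_le_split z w) as H2. rewrite Cmod_minus_sym in H2. unfold m in *; lra. }
  assert (Hw0 : w <> 0) by (apply Cmod_gt_0; lra).
  replace (/ w - / z - - / (z * z) * (w - z))%C
    with ((w - z) * (w - z) / (z * z * w))%C by (field; auto).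
  rewrite Cmod_div by (repeat apply Cmult_neq_0; auto).
  rewrite !Cmod_mult. fold m. set (t := Cmod (w - z)) in *.
  assert (Ht : 0 <= t) by apply Cmod_ge_0.
  replace (t * t / (m * m * Cmod w)) with (t / (m * m * Cmod w) * t) by (field; lra).
  apply Rmult_le_compat_r; [easy|].
  apply Rmult_le_reg_r with (m * m * Cmod w); [repeat apply Rmult_lt_0_compat; lra|].
  unfold Rdiv. rewrite Rmult_assoc, Rinv_l, Rmult_1_r
    by (apply Rgt_not_eq; repeat apply Rmult_lt_0_compat; lra).
  apply Rle_trans with (eps * (m * m * (m / 2))); [lra|].
  apply Rmult_le_compat_l; [lra|]. apply Rmult_le_compat_l; [|lra].
  apply Rmult_le_pos; lra.
Qed.

Lemma cdiff_comp (f g : C -> C) (z a b : C) :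
  cdiff f z a -> cdiff g (f z) b -> cdiff (fun w => g (f w)) z (b * a).
Proof.
  intros Hf Hg eps He.
  destruct (cdiff_bound f z a Hf) as (d3 & H3 & Hb).
  pose proof (Cmod_ge_0 a) as P3. pose proof (Cmod_ge_0 b) as P4.
  set (K := Cmod a + Cmod b + 1).
  assert (HK : 0 < K) by (unfold K; lra).
  assert (He' : 0 < eps / (2 * K)) by (apply Rdiv_lt_0_compat; lra).
  destruct (Hf _ He') as (d1 & H1 & Hf1).
  destruct (Hg _ He') as (d2 & H2 & Hg1).
  destruct (cdiffable_ccont f z (ex_intro _ a Hf) d2 H2) as (d4 & H4 & Hc).
  exists (Rmin (Rmin d1 d4) d3). split; [repeat apply Rmin_glb_lt; lra|]. intros w Hw.
  assert (Hw' := Rlt_le_trans _ _ _ Hw (Rmin_l _ _)).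
  specialize (Hb w (Rlt_le_trans _ _ _ Hw (Rmin_r _ _))).
  specialize (Hf1 w (Rlt_le_trans _ _ _ Hw' (Rmin_l _ _))).
  specialize (Hg1 (f w) (Hc w (Rlt_le_trans _ _ _ Hw' (Rmin_r _ _)))).
  replace (g (f w) - g (f z) - b * a * (w - z))%C
    with ((g (f w) - g (f z) - b * (f w - f z)) + b * (f w - f z - a * (w - z)))%C by ring.
  eapply Rle_trans; [apply Cmod_triangle|]. rewrite Cmod_mult.
  set (t := Cmod (w - z)) in *.
  assert (Ht : 0 <= t) by apply Cmod_ge_0.
  assert (A1 : eps / (2 * K) * Cmod (f w - f z) <= eps / 2 * t).
  { replace (eps / 2 * t) with (eps / (2 * K) * (K * t)) by (field; lra).
    apply Rmult_le_compat_l; [lra|]. eapply Rle_trans; [apply Hb|].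
    apply Rmult_le_compat_r; unfold K; lra. }
  assert (A2 : Cmod b * Cmod (f w - f z - a * (w - z)) <= eps / 2 * t).
  { replace (eps / 2 * t) with (K * (eps / (2 * K) * t)) by (field; lra).
    apply Rmult_le_compat; [lra|apply Cmod_ge_0|unfold K; lra|easy]. }
  lra.
Qed.

Lemma cdiff_eq (f : C -> C) (z a b : C) : cdiff f z a -> a = b -> cdiff f z b.
Proof. intros H <-. exact H. Qed.

Lemma cdiffable_const (c z : C) : cdiffable (fun _ => c) z.
Proof. exists 0%C. apply cdiff_const. Qed.

Lemma cdiffable_plus (f g : C -> C) (z : C) :
  cdiffable f z -> cdiffable g z -> cdiffable (fun w => f w + g w)%C z.
Proof. intros [a Ha] [b Hb]. eexists. apply cdiff_plus; eassumption. Qed.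

Lemma cdiffable_mult (f g : C -> C) (z : C) :
  cdiffable f z -> cdiffable g z -> cdiffable (fun w => f w * g w)%C z.
Proof. intros [a Ha] [b Hb]. eexists. apply cdiff_mult; eassumption. Qed.

Lemma cdiffable_inv (f : C -> C) (z : C) : cdiffable f z -> f z <> 0 -> cdiffable (fun w => / f w)%C z.
Proof.
  intros [a Ha] H. eexists. apply (cdiff_comp f (fun w => / w)%C); [eassumption|].
  apply cdiff_inv, H.
Qed.

Lemma cdiff_minus_const (c z : C) : cdiff (fun w => w - c)%C z 1.
Proof.
  eapply cdiff_eq; [apply cdiff_plus; [apply cdiff_id|apply cdiff_const]|ring].
Qed.

Lemma cdiffable_minus_const (c z : C) : cdiffable (fun w => w - c)%C z.
Proof. exists 1%C. apply cdiff_minus_const. Qed.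

(** The supremum of the [s] at which the bound with slope [L + eps] holds satisfies it too, and
    could be moved to the right if it were less than [1]. *)
Lemma right_slope_bound (phi : R -> C) (L : R) :
  0 <= L ->
  (forall t, 0 <= t <= 1 -> forall eps, 0 < eps -> exists d, 0 < d /\
     forall s, 0 <= s <= 1 -> Rabs (s - t) < d -> Cmod (phi s - phi t) < eps) ->
  (forall t, 0 <= t < 1 -> forall eps, 0 < eps -> exists d, 0 < d /\
     forall h, 0 < h < d -> t + h <= 1 -> Cmod (phi (t + h) - phi t) <= (L + eps) * h) ->
  Cmod (phi 1 - phi 0) <= L.
Proof.
  intros HL Hc Hd. apply le_epsilon. intros eps He.
  set (E := fun s => 0 <= s <= 1 /\ Cmod (phi s - phi 0) <= (L + eps) * s).
  destruct (completeness E) as [s [Hub Hlub]].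
  { exists 1. intros s Hs. apply Hs. }
  { exists 0. split; [lra|]. replace (phi 0 - phi 0)%C with (RtoC 0) by ring.
    rewrite Cmod_0. lra. }
  assert (Hs0 : 0 <= s).
  { apply Hub. split; [lra|]. replace (phi 0 - phi 0)%C with (RtoC 0) by ring.
    rewrite Cmod_0. lra. }
  assert (Hs1 : s <= 1) by (apply Hlub; intros x Hx; apply Hx).
  assert (HE : E s).
  { split; [lra|]. apply le_epsilon. intros e He0.
    destruct (Hc s (conj Hs0 Hs1) e He0) as (d & Hd0 & Hd1).
    assert (exists x, E x /\ s - d < x) as (x & Hx & Hxs).
    { apply NNPP. intros Hn. assert (s <= s - d); [|lra]. apply Hlub. intros x Hx.
      apply Rnot_lt_le. intros Hlt. apply Hn. exists x. auto. }
    assert (Hxs' := Hub x Hx). destruct Hx as [Hx Hxb].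
    specialize (Hd1 x Hx). rewrite Rabs_left1 in Hd1 by lra. specialize (Hd1 ltac:(lra)).
    pose proof (Cmod_le_plus (phi s) (phi x) (phi 0)) as H1. rewrite Cmod_minus_sym in Hd1.
    assert ((L + eps) * x <= (L + eps) * s) by (apply Rmult_le_compat_l; lra). lra. }
  destruct (Req_dec s 1) as [->|Hne]; [destruct HE; lra|].
  destruct (Hd s ltac:(lra) eps He) as (d & Hd0 & Hd1).
  set (h := Rmin (d / 2) (1 - s)).
  assert (Hh0 : 0 < h) by (apply Rmin_glb_lt; lra).
  assert (Hh1 : h <= d / 2) by apply Rmin_l.
  assert (Hh2 : h <= 1 - s) by apply Rmin_r.
  specialize (Hd1 h ltac:(lra) ltac:(lra)).
  assert (s + h <= s); [|lra].
  apply Hub. split; [lra|]. destruct HE as [_ HE].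
  pose proof (Cmod_le_plus (phi (s + h)) (phi s) (phi 0)). lra.
Qed.

(** * Integrals over boundaries of rectangles *)

Record box := Box { xl : R; xr : R; yl : R; yr : R }.

Definition wf (B : box) : Prop := xl B <= xr B /\ yl B <= yr B.
Definition inbox (B : box) (z : C) : Prop :=
  xl B <= fst z <= xr B /\ yl B <= snd z <= yr B.
Definition edge (B : box) (z : C) : Prop :=
  inbox B z /\ (fst z = xl B \/ fst z = xr B \/ snd z = yl B \/ snd z = yr B).
Definition subbox (B' B : box) : Prop :=
  xl B <= xl B' /\ xr B' <= xr B /\ yl B <= yl B' /\ yr B' <= yr B.
(** Half the perimeter. It bounds the diameter, is halved by quartering, and twice it is the length
    of the contour. *)
Definition bsize (B : box) : R := (xr B - xl B) + (yr B - yl B).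
Definition sq (z : C) (r : R) : box := Box (fst z - r) (fst z + r) (snd z - r) (snd z + r).

Lemma inbox_dist (B : box) (z w : C) : inbox B z -> inbox B w -> Cmod (w - z) <= bsize B.
Proof.
  intros [H1 H2] [H3 H4]. eapply Rle_trans; [apply Cmod_le_abs|]. unfold bsize. simpl.
  apply Rplus_le_compat; apply Rabs_le; lra.
Qed.

Lemma inbox_sub (B' B : box) (z : C) : subbox B' B -> inbox B' z -> inbox B z.
Proof. unfold subbox, inbox. lra. Qed.

Lemma inbox_sq_dist (c z : C) (r : R) : inbox (sq c r) z -> Cmod (z - c) <= 2 * r.
Proof.
  intros [H1 H2]. simpl in *. eapply Rle_trans; [apply Cmod_le_abs|]. simpl.
  assert (Rabs (fst z + - fst c) <= r) by (apply Rabs_le; lra).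
  assert (Rabs (snd z + - snd c) <= r) by (apply Rabs_le; lra). lra.
Qed.

Lemma dist_inbox_sq (c z : C) (r : R) : Cmod (z - c) <= r -> inbox (sq c r) z.
Proof.
  intros H. pose proof (abs_fst_le_Cmod (z - c)) as H1.
  pose proof (abs_snd_le_Cmod (z - c)) as H2. simpl in H1, H2.
  apply Rle_trans with (2 := H), Rabs_le_between in H1.
  apply Rle_trans with (2 := H), Rabs_le_between in H2.
  unfold inbox, sq; simpl. lra.
Qed.

(** Dependent choice and completeness, packaged once. The level index lets the required property
    grow stronger with depth, as the Baire argument demands. *)
Lemma nested_boxes (P : nat -> box -> Prop) (B0 : box) :
  wf B0 -> P O B0 ->
  (forall k B, P k B -> wf B -> subbox B B0 ->
     exists B', P (S k) B' /\ wf B' /\ subbox B' B /\ bsize B' <= bsize B / 2) ->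
  exists z, forall k, exists B,
    P k B /\ inbox B z /\ wf B /\ subbox B B0 /\ bsize B <= bsize B0 / 2 ^ k.
Proof.
  intros W0 P0 step.
  set (next := fun k B => epsilon (inhabits B0) (fun B' =>
    P (S k) B' /\ wf B' /\ subbox B' B /\ bsize B' <= bsize B / 2)).
  set (s := fix s k := match k with O => B0 | S k => next k (s k) end).
  assert (Hs : forall k, P k (s k) /\ wf (s k) /\ subbox (s k) B0 /\
                         bsize (s k) <= bsize B0 / 2 ^ k).
  { induction k as [|k (Pk & Wk & Sk & Zk)].
    - simpl. repeat split; try easy; try apply W0; unfold subbox; try lra.
    - assert (A : P (S k) (s (S k)) /\ wf (s (S k)) /\ subbox (s (S k)) (s k) /\
                  bsize (s (S k)) <= bsize (s k) / 2)
        by exact (epsilon_spec (inhabits B0) _ (step k (s k) Pk Wk Sk)).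
      destruct A as (A1 & A2 & A3 & A4).
      repeat split; try easy; try apply A2; unfold subbox in *; try lra.
      replace (bsize B0 / 2 ^ S k) with (bsize B0 / 2 ^ k / 2)
        by (simpl; field; apply pow_nonzero; lra). lra. }
  assert (Hsub : forall k j, subbox (s (j + k)%nat) (s k)).
  { intros k. induction j as [|j IH]; [unfold subbox; simpl; lra|].
    destruct (Hs (j + k)%nat) as (Pk & Wk & Sk & _).
    pose proof (epsilon_spec (inhabits B0) _ (step _ _ Pk Wk Sk)) as (_ & _ & A3 & _).
    change (S j + k)%nat with (S (j + k)).
    change (subbox (s (S (j + k))) (s (j + k)%nat)) in A3.
    unfold subbox in *. lra. }
  assert (Hlr : forall i j, xl (s i) <= xr (s j) /\ yl (s i) <= yr (s j)).
  { intros i j. pose proof (Hsub i j) as H1. pose proof (Hsub j i) as H2.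
    rewrite Nat.add_comm in H2. destruct (Hs (j + i)%nat) as (_ & W & _).
    unfold subbox, wf in *. lra. }
  (* The common point has the suprema of the left and of the lower sides as coordinates; by [Hlr]
     every right or upper side is an upper bound. *)
  destruct (completeness (fun x => exists k, x = xl (s k))) as [x [Hx1 Hx2]].
  { exists (xr (s O)). intros x [k ->]. apply Hlr. }
  { exists (xl (s O)), O. easy. }
  destruct (completeness (fun y => exists k, y = yl (s k))) as [y [Hy1 Hy2]].
  { exists (yr (s O)). intros y [k ->]. apply Hlr. }
  { exists (yl (s O)), O. easy. }
  exists (x, y). intros k. exists (s k). destruct (Hs k) as (A1 & A2 & A3 & A4).
  repeat split; try easy; simpl.
  - apply Hx1. now exists k.
  - apply Hx2. intros t [i ->]. apply Hlr.
  - apply Hy1. now exists k.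
  - apply Hy2. intros t [i ->]. apply Hlr.
  - apply A2.
  - apply A2.
  - apply A3.
  - apply A3.
  - apply A3.
  - apply A3.
Qed.

Lemma pow2_small (K d : R) : 0 < d -> exists k, K / 2 ^ k < d.
Proof.
  intros Hd.
  destruct (pow_lt_1_zero (/ 2) ltac:(rewrite Rabs_right; lra) (d / (Rabs K + 1))) as [N HN].
  { apply Rdiv_lt_0_compat; [easy|]. pose proof (Rabs_pos K). lra. }
  exists N. specialize (HN N (le_n N)). pose proof (Rabs_pos K) as HK.
  rewrite Rabs_right in HN by (apply Rle_ge, pow_le; lra).
  rewrite pow_inv in HN.
  assert (0 < / 2 ^ N) by (apply Rinv_0_lt_compat, pow_lt; lra).
  apply Rmult_lt_compat_l with (r := Rabs K + 1) in HN; [|lra].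
  replace ((Rabs K + 1) * (d / (Rabs K + 1))) with d in HN by (field; lra).
  apply Rle_lt_trans with (2 := HN). unfold Rdiv. apply Rmult_le_compat_r; [lra|].
  pose proof (Rle_abs K). lra.
Qed.

(** * Contour integrals over rectangles *)

Definition cint (f : R -> C) (a b : R) : C := RInt (V := C_R_CompleteNormedModule) f a b.

Lemma continuous_ccont_line (f : C -> C) (g : R -> C) (t : R) :
  (forall s, Cmod (g s - g t) = Rabs (s - t)) -> ccont f (g t) ->
  continuous (U := C_R_NormedModule) (fun s => f (g s)) t.
Proof.
  intros Hg Hf. apply filterlim_locally. intros eps.
  destruct (Hf eps (cond_pos eps)) as (d & Hd & H).
  exists (mkposreal d Hd). intros s Hs. specialize (H (g s)). rewrite Hg in H. specialize (H Hs).
  split.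
  - eapply Rle_lt_trans; [|exact H]. apply (abs_fst_le_Cmod (f (g s) - f (g t))).
  - eapply Rle_lt_trans; [|exact H]. apply (abs_snd_le_Cmod (f (g s) - f (g t))).
Qed.

Lemma hline_isometry (y t s : R) : Cmod ((s, y) - (t, y)) = Rabs (s - t).
Proof.
  replace ((s, y) - (t, y))%C with (RtoC (s - t)); [apply Cmod_R|].
  unfold RtoC, Cminus, Cplus, Copp; simpl. f_equal; ring.
Qed.

Lemma vline_isometry (x t s : R) : Cmod ((x, s) - (x, t)) = Rabs (s - t).
Proof.
  replace ((x, s) - (x, t))%C with (Ci * RtoC (s - t))%C.
  - rewrite Cmod_mult, Cmod_Ci, Cmod_R. ring.
  - unfold RtoC, Ci, Cmult, Cminus, Cplus, Copp; simpl. f_equal; ring.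
Qed.

Lemma ccont_scal (c : C) (f : C -> C) (z : C) : ccont f z -> ccont (fun w => c * f w)%C z.
Proof. apply ccont_mult, cdiffable_ccont, cdiffable_const. Qed.

Lemma ccont_plus (f g : C -> C) (z : C) :
  ccont f z -> ccont g z -> ccont (fun w => f w + g w)%C z.
Proof.
  intros Hf Hg eps He.
  destruct (Hf (eps / 2)) as (d1 & H1 & Hf1); [lra|].
  destruct (Hg (eps / 2)) as (d2 & H2 & Hg1); [lra|].
  exists (Rmin d1 d2). split; [apply Rmin_glb_lt; easy|]. intros w Hw.
  specialize (Hf1 w (Rlt_le_trans _ _ _ Hw (Rmin_l _ _))).
  specialize (Hg1 w (Rlt_le_trans _ _ _ Hw (Rmin_r _ _))).
  replace (f w + g w - (f z + g z))%C with ((f w - f z) + (g w - g z))%C by ring.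
  eapply Rle_lt_trans; [apply Cmod_triangle|]. lra.
Qed.

(** The integral lives in a module over the reals, so a complex factor has to be pulled out through
    real and imaginary parts. *)
Lemma is_RInt_cscal (c : C) (f : R -> C) (a b : R) (l : C) :
  is_RInt (V := C_R_NormedModule) f a b l ->
  is_RInt (V := C_R_NormedModule) (fun t => c * f t)%C a b (c * l)%C.
Proof.
  intros H.
  assert (H1 := is_RInt_fct_extend_fst (U := R_NormedModule) (V := R_NormedModule) _ _ _ _ H).
  assert (H2 := is_RInt_fct_extend_snd (U := R_NormedModule) (V := R_NormedModule) _ _ _ _ H).
  apply (is_RInt_fct_extend_pair (U := R_NormedModule) (V := R_NormedModule)).
  - exact (is_RInt_minus _ _ _ _ _ _ (is_RInt_scal _ _ _ (fst c) _ H1)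
                                      (is_RInt_scal _ _ _ (snd c) _ H2)).
  - exact (is_RInt_plus _ _ _ _ _ _ (is_RInt_scal _ _ _ (fst c) _ H2)
                                     (is_RInt_scal _ _ _ (snd c) _ H1)).
Qed.

Definition hint (f : C -> C) (y a b : R) : C := cint (fun x => f (x, y)) a b.
(** The factor [Ci] is [dz / dy] on a vertical edge. *)
Definition vint (f : C -> C) (x a b : R) : C := cint (fun y => Ci * f (x, y))%C a b.

(** Counterclockwise: the top and left edges are traversed backwards, hence the minus signs. *)
Definition boundary_int (f : C -> C) (B : box) : C :=
  (hint f (yl B) (xl B) (xr B) + vint f (xr B) (yl B) (yr B)
   - hint f (yr B) (xl B) (xr B) - vint f (xl B) (yl B) (yr B))%C.

Definition hseg_cont (f : C -> C) (y a b : R) := forall x, a <= x <= b -> ccont f (x, y).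
Definition vseg_cont (f : C -> C) (x a b : R) := forall y, a <= y <= b -> ccont f (x, y).

Lemma hint_correct (f : C -> C) (y a b : R) : a <= b -> hseg_cont f y a b ->
  is_RInt (V := C_R_NormedModule) (fun x => f (x, y)) a b (hint f y a b).
Proof.
  intros Hab H. apply (RInt_correct (V := C_R_CompleteNormedModule)).
  apply (ex_RInt_continuous (V := C_R_CompleteNormedModule)).
  rewrite Rmin_left, Rmax_right by easy. intros z Hz.
  apply (continuous_ccont_line f (fun x => (x, y))); [intros; apply hline_isometry|].
  apply H, Hz.
Qed.

Lemma vint_correct (f : C -> C) (x a b : R) : a <= b -> vseg_cont f x a b ->
  is_RInt (V := C_R_NormedModule) (fun y => Ci * f (x, y))%C a b (vint f x a b).
Proof.
  intros Hab H. apply (RInt_correct (V := C_R_CompleteNormedModule)).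
  apply (ex_RInt_continuous (V := C_R_CompleteNormedModule)).
  rewrite Rmin_left, Rmax_right by easy. intros z Hz.
  apply (continuous_ccont_line (fun w => Ci * f w)%C (fun y => (x, y)));
    [intros; apply vline_isometry|].
  apply ccont_scal, H, Hz.
Qed.

Lemma hint_Chasles (f : C -> C) (y a b c : R) : a <= c <= b -> hseg_cont f y a b ->
  (hint f y a b = hint f y a c + hint f y c b)%C.
Proof.
  intros Hc H. symmetry. apply (RInt_Chasles (V := C_R_CompleteNormedModule)).
  - eexists. apply hint_correct; [lra|]. intros x Hx; apply H; lra.
  - eexists. apply hint_correct; [lra|]. intros x Hx; apply H; lra.
Qed.

Lemma vint_Chasles (f : C -> C) (x a b c : R) : a <= c <= b -> vseg_cont f x a b ->
  (vint f x a b = vint f x a c + vint f x c b)%C.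
Proof.
  intros Hc H. symmetry. apply (RInt_Chasles (V := C_R_CompleteNormedModule)).
  - eexists. apply vint_correct; [lra|]. intros y Hy; apply H; lra.
  - eexists. apply vint_correct; [lra|]. intros y Hy; apply H; lra.
Qed.

Definition edge_cont (f : C -> C) (B : box) := forall z, edge B z -> ccont f z.

Lemma edge_cont_segs (f : C -> C) (B : box) : wf B -> edge_cont f B ->
  hseg_cont f (yl B) (xl B) (xr B) /\ hseg_cont f (yr B) (xl B) (xr B) /\
  vseg_cont f (xl B) (yl B) (yr B) /\ vseg_cont f (xr B) (yl B) (yr B).
Proof.
  intros [W1 W2] H. repeat split; intros t Ht; apply H; unfold edge, inbox; simpl; intros; lra.
Qed.

(** The two integrals along the cut are the same term with opposite signs and cancel; only the
    horizontal edges have to be split. *)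
Lemma boundary_int_vcut (f : C -> C) (B : box) (c : R) : wf B -> xl B <= c <= xr B ->
  edge_cont f B ->
  (boundary_int f B = boundary_int f (Box (xl B) c (yl B) (yr B)) + boundary_int f (Box c (xr B) (yl B) (yr B)))%C.
Proof.
  intros W Hc H. destruct (edge_cont_segs f B W H) as (H1 & H2 & _).
  unfold boundary_int; simpl. rewrite (hint_Chasles f (yl B) _ _ c), (hint_Chasles f (yr B) _ _ c) by easy.
  ring.
Qed.

Lemma boundary_int_hcut (f : C -> C) (B : box) (c : R) : wf B -> yl B <= c <= yr B ->
  edge_cont f B ->
  (boundary_int f B = boundary_int f (Box (xl B) (xr B) (yl B) c) + boundary_int f (Box (xl B) (xr B) c (yr B)))%C.
Proof.
  intros W Hc H. destruct (edge_cont_segs f B W H) as (_ & _ & H1 & H2).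
  unfold boundary_int; simpl. rewrite (vint_Chasles f (xl B) _ _ c), (vint_Chasles f (xr B) _ _ c) by easy.
  ring.
Qed.

Lemma cint_unique (f : R -> C) (a b : R) (l : C) :
  is_RInt (V := C_R_NormedModule) f a b l -> cint f a b = l.
Proof. apply (is_RInt_unique (V := C_R_CompleteNormedModule)). Qed.

Lemma boundary_int_scal (c : C) (f : C -> C) (B : box) : wf B -> edge_cont f B ->
  (boundary_int (fun z => c * f z) B = c * boundary_int f B)%C.
Proof.
  intros W H. destruct (edge_cont_segs f B W H) as (H1 & H2 & H3 & H4). destruct W.
  assert (Hh : forall y, hseg_cont f y (xl B) (xr B) ->
    (hint (fun z => c * f z) y (xl B) (xr B) = c * hint f y (xl B) (xr B))%C).
  { intros y Hy. apply cint_unique, is_RInt_cscal, hint_correct; easy. }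
  assert (Hv : forall x, vseg_cont f x (yl B) (yr B) ->
    (vint (fun z => c * f z) x (yl B) (yr B) = c * vint f x (yl B) (yr B))%C).
  { intros y Hy. apply cint_unique.
    eapply is_RInt_ext; [|apply is_RInt_cscal, vint_correct; easy].
    intros; simpl; ring. }
  unfold boundary_int. rewrite !Hh, !Hv by easy. ring.
Qed.

Lemma boundary_int_plus (f g : C -> C) (B : box) : wf B -> edge_cont f B -> edge_cont g B ->
  (boundary_int (fun z => f z + g z) B = boundary_int f B + boundary_int g B)%C.
Proof.
  intros W Hf Hg. destruct (edge_cont_segs f B W Hf) as (H1 & H2 & H3 & H4).
  destruct (edge_cont_segs g B W Hg) as (K1 & K2 & K3 & K4). destruct W.
  assert (Hh : forall y, hseg_cont f y (xl B) (xr B) -> hseg_cont g y (xl B) (xr B) ->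
    (hint (fun z => f z + g z) y (xl B) (xr B)
     = hint f y (xl B) (xr B) + hint g y (xl B) (xr B))%C).
  { intros y Hy Ky. apply cint_unique.
    apply (is_RInt_plus (V := C_R_NormedModule)); apply hint_correct; easy. }
  assert (Hv : forall x, vseg_cont f x (yl B) (yr B) -> vseg_cont g x (yl B) (yr B) ->
    (vint (fun z => f z + g z) x (yl B) (yr B)
     = vint f x (yl B) (yr B) + vint g x (yl B) (yr B))%C).
  { intros x Hx Kx. apply cint_unique.
    eapply is_RInt_ext; [|apply (is_RInt_plus (V := C_R_NormedModule)); apply vint_correct; easy].
    intros; simpl. change (@plus _ ?a ?b) with (Cplus a b). ring. }
  unfold boundary_int. rewrite !Hh, !Hv by easy. ring.
Qed.

Lemma boundary_int_ext (f g : C -> C) (B : box) : wf B -> (forall z, edge B z -> f z = g z) ->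
  boundary_int f B = boundary_int g B.
Proof.
  intros [W1 W2] H.
  assert (Hh : forall y, (forall x, xl B <= x <= xr B -> edge B (x, y)) ->
    hint f y (xl B) (xr B) = hint g y (xl B) (xr B)).
  { intros y Hy. apply (RInt_ext (V := C_R_CompleteNormedModule)).
    rewrite Rmin_left, Rmax_right by easy. intros x Hx. apply H, Hy; lra. }
  assert (Hv : forall x, (forall y, yl B <= y <= yr B -> edge B (x, y)) ->
    vint f x (yl B) (yr B) = vint g x (yl B) (yr B)).
  { intros x Hx. apply (RInt_ext (V := C_R_CompleteNormedModule)).
    rewrite Rmin_left, Rmax_right by easy. intros y Hy. f_equal. apply H, Hx; lra. }
  unfold boundary_int. rewrite !Hh, !Hv by (unfold edge, inbox; simpl; intros; lra). easy.
Qed.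

Lemma boundary_int_bound (f : C -> C) (B : box) (M : R) : wf B -> edge_cont f B ->
  (forall z, edge B z -> Cmod (f z) <= M) -> Cmod (boundary_int f B) <= 2 * bsize B * M.
Proof.
  intros W H HM. destruct (edge_cont_segs f B W H) as (H1 & H2 & H3 & H4).
  destruct W as [W1 W2].
  assert (Hh : forall y, (forall x, xl B <= x <= xr B -> edge B (x, y)) ->
    hseg_cont f y (xl B) (xr B) ->
    Cmod (hint f y (xl B) (xr B)) <= (xr B - xl B) * M).
  { intros y Hy Hc.
    rewrite Cmod_norm. apply (norm_RInt_le_const (V := C_R_NormedModule) (fun x => f (x, y)) _ _
             (hint f y (xl B) (xr B))); [easy| |apply hint_correct; easy].
    intros x Hx. rewrite <- Cmod_norm. apply HM. apply Hy, Hx. }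
  assert (Hv : forall x, (forall y, yl B <= y <= yr B -> edge B (x, y)) ->
    vseg_cont f x (yl B) (yr B) ->
    Cmod (vint f x (yl B) (yr B)) <= (yr B - yl B) * M).
  { intros x Hx Hc.
    rewrite Cmod_norm. apply (norm_RInt_le_const (V := C_R_NormedModule) (fun y => Ci * f (x, y))%C _ _
             (vint f x (yl B) (yr B))); [easy| |apply vint_correct; easy].
    intros y Hy. rewrite <- Cmod_norm, Cmod_mult, Cmod_Ci, Rmult_1_l. apply HM. apply Hx, Hy. }
  unfold boundary_int, Cminus.
  eapply Rle_trans; [apply Cmod_triangle|].
  eapply Rle_trans; [apply Rplus_le_compat_r, Cmod_triangle|].
  eapply Rle_trans; [apply Rplus_le_compat_r, Rplus_le_compat_r, Cmod_triangle|].
  rewrite !Cmod_opp.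
  assert (A1 : Cmod (hint f (yl B) (xl B) (xr B)) <= (xr B - xl B) * M)
    by (apply Hh; [unfold edge, inbox; simpl; intros; lra|easy]).
  assert (A2 : Cmod (hint f (yr B) (xl B) (xr B)) <= (xr B - xl B) * M)
    by (apply Hh; [unfold edge, inbox; simpl; intros; lra|easy]).
  assert (A3 : Cmod (vint f (xl B) (yl B) (yr B)) <= (yr B - yl B) * M)
    by (apply Hv; [unfold edge, inbox; simpl; intros; lra|easy]).
  assert (A4 : Cmod (vint f (xr B) (yl B) (yr B)) <= (yr B - yl B) * M)
    by (apply Hv; [unfold edge, inbox; simpl; intros; lra|easy]).
  unfold bsize. lra.
Qed.

Lemma is_derive_cdiff_line (F : C -> C) (g : R -> C) (c d : C) (t : R) :
  Cmod c = 1 -> (forall s, g s - g t = c * RtoC (s - t))%C -> cdiff F (g t) d ->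
  is_derive (V := C_R_NormedModule) (fun s => F (g s)) t (c * d)%C.
Proof.
  intros Hc Hg H. split; [apply (is_linear_scal_l (V := C_R_NormedModule))|].
  intros x Hx. apply (is_filter_lim_locally_unique (V := R_NormedModule)) in Hx. subst x.
  intros eps. destruct (H eps (cond_pos eps)) as (del & Hd & Hw).
  exists (mkposreal del Hd). intros s Hs. specialize (Hw (g s)). rewrite Hg in Hw.
  rewrite Cmod_mult, Hc, Cmod_R, Rmult_1_l in Hw. specialize (Hw Hs).
  match goal with |- norm ?u <= _ =>
    replace u with (F (g s) - F (g t) - d * (c * RtoC (s - t)))%C end.
  - rewrite Cmod_norm in Hw. 
    replace (norm (minus s t)) with (Rabs (s - t)) by reflexivity. exact Hw.
  - unfold minus, plus, opp, scal; simpl.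
    unfold RtoC, Cminus, Cplus, Copp, Cmult; simpl.
    unfold prod_plus, prod_opp, prod_scal, plus, opp, scal; simpl.
    unfold mult; simpl. f_equal; ring.
Qed.

(** The fundamental theorem turns each edge into a difference of corner values of [F], and these
    cancel around the contour. *)
Lemma boundary_int_primitive (F f : C -> C) (B : box) : wf B -> edge_cont f B ->
  (forall z, edge B z -> cdiff F z (f z)) -> boundary_int f B = 0.
Proof.
  intros W H HF. destruct (edge_cont_segs f B W H) as (H1 & H2 & H3 & H4).
  destruct W as [W1 W2].
  assert (Hh : forall y, (forall x, xl B <= x <= xr B -> edge B (x, y)) ->
    hseg_cont f y (xl B) (xr B) ->
    (hint f y (xl B) (xr B) = F (xr B, y) - F (xl B, y))%C).
  { intros y Hy Hc. apply cint_unique.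
    apply (is_RInt_derive (V := C_R_CompleteNormedModule) (fun x => F (x, y)));
      rewrite Rmin_left, Rmax_right by easy; intros x Hx.
    - replace (f (x, y)) with (1 * f (x, y))%C by ring.
      apply (is_derive_cdiff_line F (fun x => (x, y))); [apply Cmod_1| |apply HF, Hy, Hx].
      intros s. unfold RtoC, Cminus, Cplus, Copp, Cmult; simpl. f_equal; ring.
    - apply (continuous_ccont_line f (fun x => (x, y))); [intros; apply hline_isometry|].
      apply Hc, Hx. }
  assert (Hv : forall x, (forall y, yl B <= y <= yr B -> edge B (x, y)) ->
    vseg_cont f x (yl B) (yr B) ->
    (vint f x (yl B) (yr B) = F (x, yr B) - F (x, yl B))%C).
  { intros x Hx Hc. apply cint_unique.
    apply (is_RInt_derive (V := C_R_CompleteNormedModule) (fun y => F (x, y)));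
      rewrite Rmin_left, Rmax_right by easy; intros y Hy.
    - apply (is_derive_cdiff_line F (fun y => (x, y))); [apply Cmod_Ci| |apply HF, Hx, Hy].
      intros s. unfold RtoC, Ci, Cminus, Cplus, Copp, Cmult; simpl. f_equal; ring.
    - apply (continuous_ccont_line (fun w => Ci * f w)%C (fun y => (x, y)));
        [intros; apply vline_isometry|]. apply ccont_scal, Hc, Hy. }
  unfold boundary_int. rewrite !Hh, !Hv by (try easy; unfold edge, inbox; simpl; intros; lra).
  ring.
Qed.

(** * Goursat's theorem and Cauchy's formula *)

Definition quarter (i j : bool) (B : box) : box :=
  Box (if i then (xl B + xr B) / 2 else xl B) (if i then xr B else (xl B + xr B) / 2)
      (if j then (yl B + yr B) / 2 else yl B) (if j then yr B else (yl B + yr B) / 2).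

Lemma quarter_spec (i j : bool) (B : box) : wf B ->
  wf (quarter i j B) /\ subbox (quarter i j B) B /\ bsize (quarter i j B) = bsize B / 2.
Proof.
  intros [H1 H2]. unfold wf, subbox, bsize, quarter; destruct i, j; simpl; repeat split; lra.
Qed.

Lemma quarter_cover (B : box) (z : C) : inbox B z -> exists i j, inbox (quarter i j B) z.
Proof.
  intros [H1 H2]. unfold inbox, quarter.
  exists (if Rle_dec (fst z) ((xl B + xr B) / 2) then false else true),
    (if Rle_dec (snd z) ((yl B + yr B) / 2) then false else true).
  destruct (Rle_dec (fst z) _), (Rle_dec (snd z) _); simpl; lra.
Qed.

(** Bisection in place of compactness: a property inherited by some quarter survives in arbitrarily
    small boxes around one point. It serves [box_max], [goursat] and [lip_gateaux_cdiff]. *)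
Lemma nested_quarters (P : box -> Prop) (B0 : box) : wf B0 -> P B0 ->
  (forall B, wf B -> subbox B B0 -> (forall i j, ~ P (quarter i j B)) -> ~ P B) ->
  exists z, inbox B0 z /\ forall d, 0 < d ->
    exists B, P B /\ wf B /\ subbox B B0 /\ inbox B z /\ bsize B < d.
Proof.
  intros W0 P0 step.
  destruct (nested_boxes (fun _ => P) B0 W0 P0) as [z Hz].
  - intros _ B PB W S.
    assert (exists i j, P (quarter i j B)) as (i & j & Pij).
    { apply NNPP. intros Hn. apply (step B W S); [|easy]. intros i j Pij. apply Hn. eauto. }
    exists (quarter i j B). destruct (quarter_spec i j B W) as (A1 & A2 & A3).
    refine (conj Pij (conj A1 (conj A2 _))). lra.
  - exists z. split.
    + destruct (Hz O) as (B & _ & H1 & _ & H2 & _). now apply inbox_sub with B.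
    + intros d Hd. destruct (pow2_small (bsize B0) d Hd) as [k Hk].
      destruct (Hz k) as (B & A1 & A2 & A3 & A4 & A5). exists B. refine (conj A1 (conj A3 (conj A4 (conj A2 _)))). lra.
Qed.

Definition rcont (phi : C -> R) (z : C) : Prop :=
  forall eps, 0 < eps -> exists d, 0 < d /\
    forall w, Cmod (w - z) < d -> Rabs (phi w - phi z) < eps.

Lemma box_max (phi : C -> R) (B : box) : wf B -> (forall z, inbox B z -> rcont phi z) ->
  exists z, inbox B z /\ forall w, inbox B w -> phi w <= phi z.
Proof.
  intros W Hc.
  (* [P B'] says without suprema that [phi] is as large on [B'] as on the whole box. If each quarter
     fell short of some value, the largest of the four values would be missed altogether. *)
  set (P := fun B' => forall q, inbox B q -> exists p, inbox B' p /\ phi q <= phi p).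
  destruct (nested_quarters P B W) as (z & Hz & Hn).
  - intros q Hq. exists q. split; [easy|lra].
  - intros B' W' S' Hq PB'.
    assert (Hf : forall i j, exists q, inbox B q /\
              forall p, inbox (quarter i j B') p -> phi p < phi q).
    { intros i j. apply NNPP. intros Hn. apply (Hq i j). intros q Iq.
      apply NNPP. intros Hn'. apply Hn. exists q. split; [easy|]. intros p Ip.
      apply Rnot_le_lt. intros Hle. apply Hn'. now exists p. }
    destruct (Hf false false) as (q1 & I1 & F1), (Hf false true) as (q2 & I2 & F2),
      (Hf true false) as (q3 & I3 & F3), (Hf true true) as (q4 & I4 & F4).
    assert (exists q, inbox B q /\ phi q1 <= phi q /\ phi q2 <= phi q /\ phi q3 <= phi q
                      /\ phi q4 <= phi q) as (q & Iq & L1 & L2 & L3 & L4).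
    { assert (M : forall a b, inbox B a -> inbox B b -> exists q, inbox B q /\
        phi a <= phi q /\ phi b <= phi q).
      { intros a b Ia Ib. destruct (Rle_dec (phi a) (phi b)); [exists b|exists a];
          repeat split; try apply Ia; try apply Ib; lra. }
      destruct (M q1 q2 I1 I2) as (a & Ia & ? & ?). destruct (M q3 q4 I3 I4) as (b & Ib & ? & ?).
      destruct (M a b Ia Ib) as (q & Iq & ? & ?). exists q. split; [exact Iq|lra]. }
    destruct (PB' q Iq) as (p & Ip & Hp).
    destruct (quarter_cover B' p Ip) as (i & j & Hij).
    destruct i, j; [specialize (F4 p Hij)|specialize (F3 p Hij)|
                     specialize (F2 p Hij)|specialize (F1 p Hij)]; lra.
  - exists z. split; [easy|]. intros w Hw. apply le_epsilon. intros eps He.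
    destruct (Hc z Hz eps He) as (d & Hd & H1).
    destruct (Hn d Hd) as (B' & PB' & _ & _ & Iz & Hs).
    destruct (PB' w Hw) as (p & Ip & Hp).
    specialize (H1 p). pose proof (inbox_dist B' z p Iz Ip) as H2.
    specialize (H1 ltac:(lra)). apply Rabs_def2 in H1. lra.
Qed.

Lemma rcont_Cmod (f : C -> C) (z : C) : ccont f z -> rcont (fun w => Cmod (f w)) z.
Proof.
  intros H eps He. destruct (H eps He) as (d & Hd & H1). exists d. split; [easy|].
  intros w Hw. specialize (H1 w Hw). apply Rabs_def1.
  - pose proof (Cmod_le_split (f w) (f z)). lra.
  - pose proof (Cmod_le_split (f z) (f w)) as H2. rewrite Cmod_minus_sym in H2. lra.
Qed.

Lemma box_bounded (f : C -> C) (B : box) : wf B -> (forall z, inbox B z -> ccont f z) ->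
  exists M, 0 <= M /\ forall z, inbox B z -> Cmod (f z) <= M.
Proof.
  intros W H. destruct (box_max (fun w => Cmod (f w)) B W) as (z & _ & Hz).
  - intros z Hz. apply rcont_Cmod, H, Hz.
  - exists (Cmod (f z)). split; [apply Cmod_ge_0|exact Hz].
Qed.

Lemma boundary_int_quarters (f : C -> C) (B : box) : wf B -> (forall z, inbox B z -> ccont f z) ->
  (boundary_int f B = boundary_int f (quarter false false B) + boundary_int f (quarter false true B)
           + boundary_int f (quarter true false B) + boundary_int f (quarter true true B))%C.
Proof.
  intros [W1 W2] H. rewrite (boundary_int_vcut f B ((xl B + xr B) / 2));
    [|split; easy|lra|intros z [Hz _]; apply H, Hz].
  rewrite (boundary_int_hcut f (Box _ ((xl B + xr B) / 2) _ _) ((yl B + yr B) / 2));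
    [|split; simpl; lra|simpl; lra|].
  - rewrite (boundary_int_hcut f (Box ((xl B + xr B) / 2) _ _ _) ((yl B + yr B) / 2));
      [|split; simpl; lra|simpl; lra|].
    + unfold quarter; simpl. ring.
    + intros z [Hz _]. apply H. unfold inbox in *; simpl in *; lra.
  - intros z [Hz _]. apply H. unfold inbox in *; simpl in *; lra.
Qed.

Lemma goursat (f : C -> C) (B : box) : wf B -> (forall z, inbox B z -> cdiffable f z) -> boundary_int f B = 0.
Proof.
  intros W H. apply NNPP. intros HJ. apply Cmod_gt_0 in HJ.
  set (K := Cmod (boundary_int f B)) in *.
  assert (Hq : 0 < bsize B * bsize B + 1) by (pose proof (Rle_0_sqr (bsize B)); unfold Rsqr in *; lra).
  (* The [+ 1] makes [eps] times the squared size strictly less than [K], so that the bisection can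
     start, and covers boxes of size 0. *)
  set (eps := K / (bsize B * bsize B + 1)).
  assert (He : 0 < eps) by (apply Rdiv_lt_0_compat; lra).
  assert (HK : K = eps * (bsize B * bsize B) + eps) by (unfold eps; field; lra).
  (* The threshold scales with the squared size: if it fails on all four quarters, the four bounds
     add up to its failure on the box. *)
  destruct (nested_quarters (fun B' => eps * (bsize B' * bsize B') < Cmod (boundary_int f B')) B W)
    as (z & Hz & Hn).
  - fold K. lra.
  - intros B' W' S' Hn. apply Rle_not_lt.
    rewrite boundary_int_quarters; [|easy|intros z Hz; apply cdiffable_ccont, H; now apply inbox_sub with B'].
    assert (Hb : forall i j, Cmod (boundary_int f (quarter i j B')) <= eps * (bsize B' * bsize B') / 4).
    { intros i j. specialize (Hn i j). apply Rnot_lt_le in Hn.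
      destruct (quarter_spec i j B' W') as (_ & _ & E). rewrite E in Hn. lra. }
    pose proof (Hb false false). pose proof (Hb false true).
    pose proof (Hb true false). pose proof (Hb true true).
    eapply Rle_trans; [apply Cmod_triangle|].
    eapply Rle_trans; [apply Rplus_le_compat_r, Cmod_triangle|].
    eapply Rle_trans; [apply Rplus_le_compat_r, Rplus_le_compat_r, Cmod_triangle|]. lra.
  - destruct (H z Hz) as [d Hd]. destruct (Hd (eps / 2)) as (del & Hdel & Hw); [lra|].
    destruct (Hn del Hdel) as (B' & PB' & W' & S' & Iz & Hs).
    apply (Rlt_not_le _ _ PB').
    (* The affine part has a quadratic primitive and integrates to 0. The remainder is at most
       [eps / 2 * bsize B'] on a contour of length [2 * bsize B'], which contradicts [PB']. *)
    set (lin := fun w => (f z + d * (w - z))%C).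
    assert (Hlin : forall w, cdiffable lin w).
    { intros w. apply cdiffable_plus; [apply cdiffable_const|].
      apply cdiffable_mult; [apply cdiffable_const|apply cdiffable_minus_const]. }
    assert (Hm : forall w, edge B' w -> cdiffable (fun w => - (1) * lin w)%C w).
    { intros w _. apply cdiffable_mult; [apply cdiffable_const|apply Hlin]. }
    assert (Hf : forall w, edge B' w -> cdiffable f w).
    { intros w [Hw' _]. apply H. now apply inbox_sub with B'. }
    set (r := fun w => (f w + - (1) * lin w)%C).
    assert (Hr : edge_cont r B').
    { intros w Hw'. apply cdiffable_ccont, cdiffable_plus; [now apply Hf|now apply Hm]. }
    rewrite (boundary_int_ext f (fun w => lin w + r w)%C) by (try easy; intros; unfold r; ring).
    rewrite boundary_int_plus; [|easy|intros w _; apply cdiffable_ccont, Hlin|easy].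
    rewrite (boundary_int_primitive (fun w => f z * w + d / 2 * ((w - z) * (w - z)))%C lin); [|easy| |].
    + rewrite Cplus_0_l. eapply Rle_trans; [apply (boundary_int_bound r B' (eps / 2 * bsize B') W' Hr)|].
      * intros w [Iw _]. pose proof (inbox_dist B' z w Iz Iw) as Hdist.
        unfold r, lin. replace (f w + - (1) * (f z + d * (w - z)))%C
          with (f w - f z - d * (w - z))%C by ring.
        eapply Rle_trans; [apply Hw; lra|]. apply Rmult_le_compat_l; lra.
      * lra.
    + intros w _. apply cdiffable_ccont, Hlin.
    + intros w _. eapply cdiff_eq.
      * apply cdiff_plus.
        -- apply cdiff_mult; [apply cdiff_const|apply cdiff_id].
        -- apply cdiff_mult; [apply cdiff_const|].
           apply cdiff_mult; apply cdiff_minus_const.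
      * unfold lin. field. 
Qed.

Lemma edge_sq_dist (c z : C) (r : R) : edge (sq c r) z -> r <= Cmod (z - c).
Proof.
  intros [_ H]. simpl in H.
  pose proof (abs_fst_le_Cmod (z - c)) as H1. pose proof (abs_snd_le_Cmod (z - c)) as H2.
  simpl in H1, H2. pose proof (Rle_abs (fst z + - fst c)) as H5.
  pose proof (Rle_abs (snd z + - snd c)) as H6.
  pose proof (Rle_abs (- (fst z + - fst c))) as H3. pose proof (Rle_abs (- (snd z + - snd c))) as H4.
  rewrite Rabs_Ropp in H3, H4. lra.
Qed.

(** Two vertical cuts, then two horizontal cuts of the middle column, leave four rectangles that
    avoid [z]; Goursat's theorem removes them. *)
Lemma boundary_int_shrink (p : C -> C) (c z : C) (r eta : R) :
  0 < eta -> Cmod (z - c) + eta <= r ->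
  (forall w, inbox (sq c r) w -> w <> z -> cdiffable p w) ->
  boundary_int p (sq c r) = boundary_int p (sq z eta).
Proof.
  intros He Hr H.
  pose proof (abs_fst_le_Cmod (z - c)) as H1. pose proof (abs_snd_le_Cmod (z - c)) as H2.
  simpl in H1, H2. apply Rle_trans with (r3 := r - eta) in H1; [|lra].
  apply Rle_trans with (r3 := r - eta) in H2; [|lra].
  apply Rabs_le_between in H1, H2.
  assert (Hw : forall w, inbox (sq c r) w -> fst w <> fst z \/ snd w <> snd z -> cdiffable p w).
  { intros w Iw Hn. apply H; [easy|]. intros ->. lra. }
  unfold sq at 1.
  rewrite (boundary_int_vcut p _ (fst z - eta)); simpl; [|split; simpl; lra|lra|].
  2:{ intros w [Iw Ew]. apply cdiffable_ccont, Hw; unfold inbox, sq in *; simpl in *; lra. }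
  rewrite (boundary_int_vcut p (Box (fst z - eta) _ _ _) (fst z + eta)); simpl; [|split; simpl; lra|lra|].
  2:{ intros w [Iw Ew]. apply cdiffable_ccont, Hw; unfold inbox, sq in *; simpl in *; lra. }
  rewrite (boundary_int_hcut p (Box (fst z - eta) (fst z + eta) _ _) (snd z - eta)); simpl;
    [|split; simpl; lra|lra|].
  2:{ intros w [Iw Ew]. apply cdiffable_ccont, Hw; unfold inbox, sq in *; simpl in *; lra. }
  rewrite (boundary_int_hcut p (Box (fst z - eta) (fst z + eta) (snd z - eta) _) (snd z + eta)); simpl;
    [|split; simpl; lra|lra|].
  2:{ intros w [Iw Ew]. apply cdiffable_ccont, Hw; unfold inbox, sq in *; simpl in *; lra. }
  rewrite (goursat p (Box (fst c - r) _ _ _));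
    [|split; simpl; lra|intros w Iw; apply Hw; unfold inbox, sq in *; simpl in *; lra].
  rewrite (goursat p (Box (fst z + eta) _ _ _));
    [|split; simpl; lra|intros w Iw; apply Hw; unfold inbox, sq in *; simpl in *; lra].
  rewrite (goursat p (Box _ _ (snd c - r) _));
    [|split; simpl; lra|intros w Iw; apply Hw; unfold inbox, sq in *; simpl in *; lra].
  rewrite (goursat p (Box _ _ (snd z + eta) _));
    [|split; simpl; lra|intros w Iw; apply Hw; unfold inbox, sq in *; simpl in *; lra].
  unfold sq. ring.
Qed.

Lemma wf_sq (c : C) (r : R) : 0 <= r -> wf (sq c r).
Proof. intros. split; simpl; lra. Qed.

Lemma bsize_sq (c : C) (r : R) : bsize (sq c r) = 4 * r.
Proof. unfold bsize; simpl; ring. Qed.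

Lemma neq_minus (w z : C) : w <> z -> (w - z)%C <> 0.
Proof. intros H E. apply H. replace w with ((w - z) + z)%C by ring. rewrite E. ring. Qed.

Lemma edge_sq_neq (c z w : C) (r : R) : Cmod (z - c) < r -> edge (sq c r) w -> (w - z)%C <> 0.
Proof.
  intros H E. apply neq_minus. intros ->. apply edge_sq_dist in E. lra.
Qed.

(** The quotient [(f w - f z) / (w - z)] is bounded near [z], so its integral over shrinking squares
    tends to 0. The winding integral stays as a factor: later it matters only that it is bounded
    away from 0 and independent of [z]. *)
Lemma cauchy_formula (f : C -> C) (c z : C) (r : R) :
  (forall w, inbox (sq c r) w -> cdiffable f w) -> Cmod (z - c) < r ->
  (boundary_int (fun w => f w * / (w - z)) (sq c r) = f z * boundary_int (fun w => / (w - z)) (sq c r))%C.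
Proof.
  intros H Hz. pose proof (Cmod_ge_0 (z - c)) as Hp.
  assert (W : wf (sq c r)) by (apply wf_sq; lra).
  assert (Iz : inbox (sq c r) z) by (apply dist_inbox_sq; lra).
  assert (Hk : forall w, w <> z -> cdiffable (fun w => / (w - z))%C w).
  { intros w Hw. apply cdiffable_inv; [apply cdiffable_minus_const|]. now apply neq_minus. }
  set (p := fun w => ((f w - f z) * / (w - z))%C).
  assert (Hp' : forall w, inbox (sq c r) w -> w <> z -> cdiffable p w).
  { intros w Iw Hw. apply cdiffable_mult; [|now apply Hk].
    apply cdiffable_plus; [now apply H|apply cdiffable_const]. }
  assert (Hedge : forall w, edge (sq c r) w -> w <> z).
  { intros w Ew ->. apply edge_sq_dist in Ew. lra. }
  assert (E : boundary_int p (sq c r) = 0).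
  { apply Cmod_eq_0. apply Rle_antisym; [|apply Cmod_ge_0].
    apply le_epsilon. intros eps He. rewrite Rplus_0_l.
    destruct (H z Iz) as [d Hd]. destruct (cdiff_bound f z d Hd) as (del & Hdel & Hb).
    pose proof (Cmod_ge_0 d) as Hd0.
    (* In turn: the small square fits into the large one, its points are within [del] of [z], and
       contour length [8 * eta] times [Cmod d + 1] is at most [eps]. *)
    set (eta := Rmin (Rmin (r - Cmod (z - c)) (del / 4)) (eps / (8 * (Cmod d + 1)))).
    assert (H0 : 0 < eta).
    { repeat apply Rmin_glb_lt; try lra. apply Rdiv_lt_0_compat; lra. }
    assert (H1 : eta <= r - Cmod (z - c)) by (eapply Rle_trans; [apply Rmin_l|apply Rmin_l]).
    assert (H2 : eta <= del / 4) by (eapply Rle_trans; [apply Rmin_l|apply Rmin_r]).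
    assert (H3 : eta <= eps / (8 * (Cmod d + 1))) by apply Rmin_r.
    assert (Sub : forall w, inbox (sq z eta) w -> inbox (sq c r) w).
    { intros w [I1 I2]. pose proof (abs_fst_le_Cmod (z - c)) as Q1.
      pose proof (abs_snd_le_Cmod (z - c)) as Q2. simpl in *.
      apply Rle_trans with (r3 := r - eta) in Q1; [|lra].
      apply Rle_trans with (r3 := r - eta) in Q2; [|lra].
      apply Rabs_le_between in Q1, Q2. unfold inbox; simpl. lra. }
    assert (Hnz : forall w, edge (sq z eta) w -> w <> z).
    { intros w Ew ->. apply edge_sq_dist in Ew.
      replace (z - z)%C with (RtoC 0) in Ew by ring. rewrite Cmod_0 in Ew. lra. }
    rewrite (boundary_int_shrink p c z r eta H0) by (try easy; lra).
    eapply Rle_trans; [apply (boundary_int_bound p _ (Cmod d + 1)); [apply wf_sq; lra| |]|].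
    - intros w Ew. apply cdiffable_ccont, Hp'; [apply Sub, Ew|now apply Hnz].
    - intros w Ew. assert (Hw := neq_minus _ _ (Hnz w Ew)).
      unfold p. rewrite Cmod_mult, Cmod_inv by easy.
      assert (Hw0 := proj1 (Cmod_gt_0 _) Hw).
      apply Rmult_le_reg_r with (Cmod (w - z)); [easy|].
      rewrite Rmult_assoc, Rinv_l, Rmult_1_r by lra. apply Hb.
      destruct Ew as [Iw _]. pose proof (inbox_sq_dist _ _ _ Iw). lra.
    - rewrite bsize_sq.
      apply Rmult_le_compat_l with (r := 8 * (Cmod d + 1)) in H3; [|lra].
      replace (8 * (Cmod d + 1) * (eps / (8 * (Cmod d + 1)))) with eps in H3 by (field; lra). lra. }
  rewrite (boundary_int_ext _ (fun w => p w + f z * / (w - z))%C) by (try easy; intros w Hw; unfold p; ring).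
  assert (C1 : edge_cont (fun w => / (w - z))%C (sq c r)).
  { intros w Ew. apply cdiffable_ccont, Hk. now apply Hedge. }
  rewrite boundary_int_plus; [|easy| |].
  - rewrite E, boundary_int_scal by easy. ring.
  - intros w Ew. apply cdiffable_ccont, Hp'; [apply Ew|now apply Hedge].
  - intros w Ew. apply ccont_scal. now apply C1.
Qed.

(** * Regularity and the maximum principle *)

(** A pointwise Lipschitz bound instead of a bound on a derivative: it makes sense also at singular
    points, where no derivative is available yet. *)
Definition slope_le (f : C -> C) (z : C) (L : R) : Prop :=
  forall eps, 0 < eps -> exists d, 0 < d /\
    forall w, Cmod (w - z) < d -> Cmod (f w - f z) <= (L + eps) * Cmod (w - z).

Lemma cdiff_slope (f : C -> C) (z d : C) (L : R) : cdiff f z d -> Cmod d <= L -> slope_le f z L.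
Proof.
  intros H HL eps He. destruct (H eps He) as (del & Hdel & Hw). exists del. split; [easy|].
  intros w H1. specialize (Hw w H1).
  pose proof (Cmod_le_split (f w - f z) (d * (w - z))) as H2. rewrite Cmod_mult in H2.
  pose proof (Rmult_le_compat_r _ _ _ (Cmod_ge_0 (w - z)) HL). lra.
Qed.

(** Mean value inequality: along the segment the bound becomes a right slope bound for a function of
    one real variable. *)
Lemma slope_le_segment (f : C -> C) (z1 z2 : C) (L : R) : 0 <= L ->
  (forall t, 0 <= t <= 1 -> slope_le f (z1 + t * (z2 - z1))%C L) ->
  Cmod (f z2 - f z1) <= L * Cmod (z2 - z1).
Proof.
  intros HL H. set (m := Cmod (z2 - z1)). assert (Hm : 0 <= m) by apply Cmod_ge_0.
  set (g := fun t : R => (z1 + t * (z2 - z1))%C) in *.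
  assert (Hg : forall s t, Cmod (g s - g t) = Rabs (s - t) * m).
  { intros s t. unfold g, m. rewrite <- Cmod_R, <- Cmod_mult. f_equal.
    rewrite RtoC_minus. ring. }
  replace z2 with (g 1) at 1 by (unfold g; ring).
  replace z1 with (g 0) by (unfold g; ring).
  apply (right_slope_bound (fun t => f (g t))); [apply Rmult_le_pos; easy| |].
  - intros t Ht eps He. destruct (H t Ht 1 Rlt_0_1) as (d & Hd & Hw).
    assert (0 < Rmin d (eps / (L + 1))).
    { apply Rmin_glb_lt; [easy|]. apply Rdiv_lt_0_compat; lra. }
    (* [m + 1] rather than [m], since the end points may coincide. *)
    exists (Rmin d (eps / (L + 1)) / (m + 1)). split; [apply Rdiv_lt_0_compat; lra|].
    intros s Hs Hst.
    assert (Hd' : Cmod (g s - g t) < Rmin d (eps / (L + 1))).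
    { rewrite Hg. apply Rmult_lt_compat_r with (r := m + 1) in Hst; [|lra].
      unfold Rdiv in Hst. rewrite Rmult_assoc, Rinv_l, Rmult_1_r in Hst by lra.
      pose proof (Rabs_pos (s - t)). lra. }
    eapply Rle_lt_trans; [apply Hw, Rlt_le_trans with (1 := Hd'), Rmin_l|].
    assert (H2 := Rlt_le_trans _ _ _ Hd' (Rmin_r _ _)).
    apply Rmult_lt_compat_l with (r := L + 1) in H2; [|lra].
    replace ((L + 1) * (eps / (L + 1))) with eps in H2 by (field; lra). exact H2.
  - intros t Ht eps He.
    assert (He' : 0 < eps / (m + 1)) by (apply Rdiv_lt_0_compat; lra).
    destruct (H t ltac:(lra) _ He') as (d & Hd & Hw).
    exists (d / (m + 1)). split; [apply Rdiv_lt_0_compat; lra|]. intros h Hh _.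
    assert (E : Cmod (g (t + h) - g t) = h * m).
    { rewrite Hg. f_equal. replace (t + h - t) with h by ring. apply Rabs_right; lra. }
    eapply Rle_trans; [apply Hw; change (Cmod (g (t + h) - g t) < d)|
      change (Cmod (g (t + h)%R - (z1 + t * (z2 - z1)))%C)
        with (Cmod (g (t + h) - g t))]; rewrite E.
    + destruct Hh as [Hh1 Hh]. apply Rmult_lt_compat_r with (r := m + 1) in Hh; [|lra].
      unfold Rdiv in Hh. rewrite Rmult_assoc, Rinv_l, Rmult_1_r in Hh by lra. lra.
    + assert (eps / (m + 1) * m <= eps).
      { apply Rmult_le_reg_r with (m + 1); [lra|].
        replace (eps / (m + 1) * m * (m + 1)) with (eps * m) by (field; lra).
        apply Rmult_le_compat_l; lra. }
      replace ((L + eps / (m + 1)) * (h * m))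
        with (L * m * h + (eps / (m + 1) * m) * h) by ring.
      replace ((L * m + eps) * h) with (L * m * h + eps * h) by ring.
      apply Rplus_le_compat_l. apply Rmult_le_compat_r; lra.
Qed.

Lemma segment_disc (c z1 z2 : C) (r t : R) : 0 <= t <= 1 -> Cmod (z1 - c) < r -> Cmod (z2 - c) < r ->
  Cmod (z1 + t * (z2 - z1) - c) < r.
Proof.
  intros Ht H1 H2.
  replace (z1 + t * (z2 - z1) - c)%C with (RtoC (1 - t) * (z1 - c) + RtoC t * (z2 - c))%C
    by (rewrite RtoC_minus; ring).
  eapply Rle_lt_trans; [apply Cmod_triangle|].
  rewrite !Cmod_mult, !Cmod_R, !Rabs_right by lra.
  destruct (Req_dec t 0) as [->|Ht0]; [lra|].
  assert (t * Cmod (z2 - c) < t * r) by (apply Rmult_lt_compat_l; lra).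
  assert ((1 - t) * Cmod (z1 - c) <= (1 - t) * r) by (apply Rmult_le_compat_l; lra). lra.
Qed.

Lemma cdiff_quadratic (f : C -> C) (z d : C) (K r : R) : 0 < r -> 0 <= K ->
  (forall w, Cmod (w - z) < r ->
    Cmod (f w - f z - d * (w - z)) <= K * (Cmod (w - z) * Cmod (w - z))) ->
  cdiff f z d.
Proof.
  intros Hr HK H eps He. exists (Rmin r (eps / (K + 1))).
  split; [apply Rmin_glb_lt; [easy|apply Rdiv_lt_0_compat; lra]|]. intros w Hw.
  assert (H1 := Rlt_le_trans _ _ _ Hw (Rmin_l _ _)).
  assert (H2 := Rlt_le_trans _ _ _ Hw (Rmin_r _ _)).
  eapply Rle_trans; [apply H, H1|]. rewrite <- Rmult_assoc.
  pose proof (Cmod_ge_0 (w - z)) as Hp.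
  apply Rmult_le_compat_r; [easy|].
  apply Rmult_lt_compat_l with (r := K + 1) in H2; [|lra].
  replace ((K + 1) * (eps / (K + 1))) with eps in H2 by (field; lra). lra.
Qed.

Lemma cdiffable_cauchy_kernel (z w : C) : (w - z)%C <> 0 -> cdiffable (fun w => / (w - z))%C w.
Proof. intros H. apply cdiffable_inv; [apply cdiffable_minus_const|easy]. Qed.

(** Half the room left inside the square. It bounds the kernels [/ (w - z')] on the contour
    uniformly for [z'] near [z]. *)
Lemma edge_sq_away (c z : C) (r : R) : Cmod (z - c) < r ->
  exists rho, 0 < rho /\ rho < r /\ forall z', Cmod (z' - z) < rho ->
    Cmod (z' - c) < r /\ forall w, edge (sq c r) w -> rho <= Cmod (w - z').
Proof.
  intros H. pose proof (Cmod_ge_0 (z - c)) as Hp. exists ((r - Cmod (z - c)) / 2).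
  split; [lra|]. split; [lra|].
  intros z' Hz'. pose proof (Cmod_le_plus z' z c). split; [lra|].
  intros w Ew. apply edge_sq_dist in Ew. pose proof (Cmod_le_plus w z' c). lra.
Qed.

(** * Differentiation of Cauchy's integral under the integral sign *)

Section CauchyTransform.

Variables (g : C -> C) (c : C) (r : R).
Hypothesis g_hol : forall w, inbox (sq c r) w -> cdiffable g w.

(** Up to the winding factor, [T1], [T2] and [2 * T3] are the function and its first two
    derivatives. Two suffice: the derivative is again differentiable, and this can be iterated. *)
Let T1 z := boundary_int (fun w => g w * / (w - z))%C (sq c r).
Let T2 z := boundary_int (fun w => g w * (/ (w - z) * / (w - z)))%C (sq c r).
Let T3 z := boundary_int (fun w => g w * (/ (w - z) * / (w - z) * / (w - z)))%C (sq c r).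

Lemma boundary_int_kernel_bound (k : C -> C) (M K : R) : 0 < r ->
  (forall w, inbox (sq c r) w -> Cmod (g w) <= M) ->
  (forall w, edge (sq c r) w -> cdiffable k w /\ Cmod (k w) <= K) ->
  Cmod (boundary_int (fun w => g w * k w)%C (sq c r)) <= 8 * r * (M * K).
Proof.
  intros Hr HM HK.
  replace (8 * r) with (2 * bsize (sq c r)) by (rewrite bsize_sq; ring).
  apply boundary_int_bound; [apply wf_sq; lra| |].
  - intros w Ew. apply cdiffable_ccont, cdiffable_mult; [apply g_hol, Ew|apply HK, Ew].
  - intros w Ew. rewrite Cmod_mult. apply Rmult_le_compat; try apply Cmod_ge_0.
    + apply HM, Ew.
    + apply HK, Ew.
Qed.

Ltac kernel_hol := repeat apply cdiffable_mult; try apply cdiffable_const; try apply g_hol;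
  try apply cdiffable_cauchy_kernel; auto.

Lemma cauchy_transform_bound (M : R) : 0 < r ->
  (forall w, inbox (sq c r) w -> Cmod (g w) <= M) -> Cmod (T2 c) <= 8 * M / r.
Proof.
  intros Hr HM. replace (8 * M / r) with (8 * r * (M * (/ r * / r))) by (field; lra).
  apply (boundary_int_kernel_bound (fun w => / (w - c) * / (w - c))%C); [easy|easy|].
  intros w Ew.
  assert (Hn : (w - c)%C <> 0).
  { apply edge_sq_neq with c r; [|easy]. replace (c - c)%C with (RtoC 0) by ring.
    rewrite Cmod_0. easy. }
  split; [kernel_hol|]. apply edge_sq_dist in Ew.
  assert (/ Cmod (w - c) <= / r) by (apply Rinv_le_contravar; lra).
  assert (0 < / Cmod (w - c)) by (apply Rinv_0_lt_compat; lra).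
  rewrite Cmod_mult, Cmod_inv by easy. apply Rmult_le_compat; lra.
Qed.

Lemma cauchy_transform_diff (z : C) : Cmod (z - c) < r -> cdiff T1 z (T2 z).
Proof.
  intros Hz. destruct (edge_sq_away c z r Hz) as (rho & Hrho & Hrr & Haway).
  assert (W : wf (sq c r)) by (apply wf_sq; lra).
  destruct (box_bounded g (sq c r) W) as (M & HM0 & HM).
  { intros w Iw. now apply cdiffable_ccont, g_hol. }
  assert (Hi : 0 < / rho) by (apply Rinv_0_lt_compat; easy).
  apply (cdiff_quadratic _ _ _ (8 * r * (M * (/ rho * / rho * / rho))) rho); [easy| |].
  { repeat apply Rmult_le_pos; lra. }
  intros z' Hz'.
  assert (Hzz : Cmod (z - z) < rho).
  { replace (z - z)%C with (RtoC 0) by ring. now rewrite Cmod_0. }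
  destruct (Haway z Hzz) as [_ A]. destruct (Haway z' Hz') as [Hz'r A'].
  assert (N : forall w, edge (sq c r) w -> (w - z)%C <> 0)
    by (intros; now apply edge_sq_neq with c r).
  assert (N' : forall w, edge (sq c r) w -> (w - z')%C <> 0)
    by (intros; now apply edge_sq_neq with c r).
  assert (I : forall w, edge (sq c r) w -> inbox (sq c r) w) by (intros w Hw; apply Hw).
  (* The exact second-order remainder of the kernel: [1/(w-z') = 1/(w-z) + (z'-z)/(w-z)^2 + (z'-z)^2
     k(w)]. *)
  set (k := fun w => (/ (w - z) * / (w - z) * / (w - z'))%C).
  assert (E : (T1 z' = T1 z + ((z' - z) * T2 z
               + (z' - z) * (z' - z) * boundary_int (fun w => g w * k w) (sq c r)))%C).
  { unfold T1, T2.
    rewrite (boundary_int_ext _ (fun w => g w * / (w - z) + ((z' - z) * (g w * (/ (w - z) * / (w - z)))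
               + (z' - z) * (z' - z) * (g w * k w)))%C).
    - rewrite !boundary_int_plus, !boundary_int_scal; try easy; intros w Ew; unfold k;
        try apply ccont_plus; apply cdiffable_ccont; kernel_hol.
    - easy.
    - intros w Ew. unfold k. field. split; auto. }
  rewrite E.
  replace (T1 z + ((z' - z) * T2 z + (z' - z) * (z' - z) * boundary_int (fun w => g w * k w) (sq c r))
           - T1 z - T2 z * (z' - z))%C
    with ((z' - z) * (z' - z) * boundary_int (fun w => g w * k w) (sq c r))%C by ring.
  rewrite !Cmod_mult, Rmult_comm.
  apply Rmult_le_compat_r; [apply Rmult_le_pos; apply Cmod_ge_0|].
  apply boundary_int_kernel_bound; [lra|easy|].
  intros w Ew. split; [unfold k; kernel_hol|].
  specialize (A w Ew). specialize (A' w Ew).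
  assert (/ Cmod (w - z) <= / rho) by (apply Rinv_le_contravar; lra).
  assert (/ Cmod (w - z') <= / rho) by (apply Rinv_le_contravar; lra).
  assert (0 < / Cmod (w - z)) by (apply Rinv_0_lt_compat; lra).
  assert (0 < / Cmod (w - z')) by (apply Rinv_0_lt_compat; lra).
  unfold k. rewrite !Cmod_mult, !Cmod_inv by auto.
  repeat apply Rmult_le_compat; try apply Rmult_le_pos; lra.
Qed.

Lemma cauchy_transform_diff2 (z : C) : Cmod (z - c) < r -> cdiff T2 z (2 * T3 z).
Proof.
  intros Hz. destruct (edge_sq_away c z r Hz) as (rho & Hrho & Hrr & Haway).
  assert (W : wf (sq c r)) by (apply wf_sq; lra).
  destruct (box_bounded g (sq c r) W) as (M & HM0 & HM).
  { intros w Iw. now apply cdiffable_ccont, g_hol. }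
  assert (Hi : 0 < / rho) by (apply Rinv_0_lt_compat; easy).
  (* The 3 counts the products in the remainder kernel [k] below: one, plus twice another, each of
     four reciprocals at most [/ rho]. *)
  set (K := 3 * (/ rho * / rho * / rho * / rho)).
  assert (HK : 0 <= K) by (unfold K; repeat apply Rmult_le_pos; lra).
  apply (cdiff_quadratic _ _ _ (8 * r * (M * K)) rho); [easy| |].
  { repeat apply Rmult_le_pos; lra. }
  intros z' Hz'.
  assert (Hzz : Cmod (z - z) < rho).
  { replace (z - z)%C with (RtoC 0) by ring. now rewrite Cmod_0. }
  destruct (Haway z Hzz) as [_ A]. destruct (Haway z' Hz') as [Hz'r A'].
  assert (N : forall w, edge (sq c r) w -> (w - z)%C <> 0)
    by (intros; now apply edge_sq_neq with c r).
  assert (N' : forall w, edge (sq c r) w -> (w - z')%C <> 0)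
    by (intros; now apply edge_sq_neq with c r).
  assert (I : forall w, edge (sq c r) w -> inbox (sq c r) w) by (intros w Hw; apply Hw).
  (* Again an exact remainder: [1/(w-z')^2 = 1/(w-z)^2 + 2(z'-z)/(w-z)^3 + (z'-z)^2 k(w)]. *)
  set (k := fun w => (/ (w - z) * / (w - z) * / (w - z') * / (w - z')
                      + 2 * (/ (w - z) * / (w - z) * / (w - z) * / (w - z')))%C).
  assert (Hk : forall w, edge (sq c r) w -> cdiffable k w).
  { intros w Ew. unfold k. apply cdiffable_plus; kernel_hol. }
  assert (E : (T2 z' = T2 z + ((z' - z) * (2 * T3 z)
               + (z' - z) * (z' - z) * boundary_int (fun w => g w * k w) (sq c r)))%C).
  { unfold T2, T3.
    rewrite (boundary_int_ext _ (fun w => g w * (/ (w - z) * / (w - z))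
               + ((z' - z) * (2 * (g w * (/ (w - z) * / (w - z) * / (w - z))))
               + (z' - z) * (z' - z) * (g w * k w)))%C).
    - rewrite !boundary_int_plus, !boundary_int_scal; try easy; intros w Ew;
        try apply ccont_plus; apply cdiffable_ccont; kernel_hol.
    - easy.
    - intros w Ew. unfold k. field. split; auto. }
  rewrite E.
  replace (T2 z + ((z' - z) * (2 * T3 z) + (z' - z) * (z' - z) * boundary_int (fun w => g w * k w) (sq c r))
           - T2 z - 2 * T3 z * (z' - z))%C
    with ((z' - z) * (z' - z) * boundary_int (fun w => g w * k w) (sq c r))%C by ring.
  rewrite !Cmod_mult, Rmult_comm.
  apply Rmult_le_compat_r; [apply Rmult_le_pos; apply Cmod_ge_0|].
  apply boundary_int_kernel_bound; [lra|easy|].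
  intros w Ew. split; [now apply Hk|].
  specialize (A w Ew). specialize (A' w Ew).
  assert (/ Cmod (w - z) <= / rho) by (apply Rinv_le_contravar; lra).
  assert (/ Cmod (w - z') <= / rho) by (apply Rinv_le_contravar; lra).
  assert (0 < / Cmod (w - z)) by (apply Rinv_0_lt_compat; lra).
  assert (0 < / Cmod (w - z')) by (apply Rinv_0_lt_compat; lra).
  unfold k. eapply Rle_trans; [apply Cmod_triangle|].
  rewrite !Cmod_mult, !Cmod_inv, Cmod_R, Rabs_right by (auto; lra).
  assert (forall a b c d, 0 < a <= / rho -> 0 < b <= / rho -> 0 < c <= / rho -> 0 < d <= / rho ->
    a * b * c * d <= / rho * / rho * / rho * / rho) as HH.
  { intros a b c' d Ha Hb Hc Hd. repeat apply Rmult_le_compat; repeat apply Rmult_le_pos; lra. }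
  pose proof (HH (/ Cmod (w - z)) (/ Cmod (w - z)) (/ Cmod (w - z')) (/ Cmod (w - z'))).
  pose proof (HH (/ Cmod (w - z)) (/ Cmod (w - z)) (/ Cmod (w - z)) (/ Cmod (w - z'))).
  unfold K. lra.
Qed.

End CauchyTransform.

(** * The winding integral of a square, and Cauchy's estimate *)

Lemma snd_cint_ge (f : R -> C) (a b m : R) (l : C) : a <= b ->
  is_RInt (V := C_R_NormedModule) f a b l ->
  (forall x, a <= x <= b -> m <= snd (f x)) -> m * (b - a) <= snd l.
Proof.
  intros Hab H Hm.
  apply (is_RInt_fct_extend_snd (U := R_NormedModule) (V := R_NormedModule)) in H.
  rewrite Rmult_comm. eapply is_RInt_le; [exact Hab|apply (is_RInt_const (V := R_NormedModule))|exact H|].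
  intros x Hx. apply Hm. lra.
Qed.

Lemma snd_cint_le (f : R -> C) (a b m : R) (l : C) : a <= b ->
  is_RInt (V := C_R_NormedModule) f a b l ->
  (forall x, a <= x <= b -> snd (f x) <= m) -> snd l <= m * (b - a).
Proof.
  intros Hab H Hm.
  apply (is_RInt_fct_extend_snd (U := R_NormedModule) (V := R_NormedModule)) in H.
  rewrite (Rmult_comm m). eapply is_RInt_le; [exact Hab|exact H|apply (is_RInt_const (V := R_NormedModule))|].
  intros x Hx. apply Hm. lra.
Qed.

(** The imaginary part of the integrand along an edge is, up to orientation, [r / (X^2 + r^2)],
    hence at least [1 / (2r)] on a length [2r]. Each of the four edges contributes at least 1. *)
Lemma boundary_int_winding_ge (c : C) (r : R) : 0 < r ->
  4 <= Cmod (boundary_int (fun w => / (w - c))%C (sq c r)).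
Proof.
  intros Hr. set (k := fun w => (/ (w - c))%C).
  assert (W : wf (sq c r)) by (apply wf_sq; lra).
  assert (Hk : edge_cont k (sq c r)).
  { intros w Ew. apply cdiffable_ccont, cdiffable_cauchy_kernel, edge_sq_neq with c r; [|easy].
    replace (c - c)%C with (RtoC 0) by ring. now rewrite Cmod_0. }
  destruct (edge_cont_segs k (sq c r) W Hk) as (H1 & H2 & H3 & H4).
  destruct c as [a b]. unfold boundary_int. simpl in *.
  assert (Q : forall X, - r <= X <= r -> / (2 * r) <= r / (X * X + r * r)).
  { intros X HX. assert (X * X <= r * r) by nra. assert (0 < r * r) by nra.
    assert (0 <= X * X) by nra.
    apply Rmult_le_reg_r with (2 * r * (X * X + r * r)); [apply Rmult_lt_0_compat; lra|].
    replace (/ (2 * r) * (2 * r * (X * X + r * r))) with (X * X + r * r) by (field; lra).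
    replace (r / (X * X + r * r) * (2 * r * (X * X + r * r))) with (2 * (r * r)) by (field; lra).
    lra. }
  set (i1 := hint k (b - r) (a - r) (a + r)). set (i2 := vint k (a + r) (b - r) (b + r)).
  set (i3 := hint k (b + r) (a - r) (a + r)). set (i4 := vint k (a - r) (b - r) (b + r)).
  assert (A1 : / (2 * r) * (a + r - (a - r)) <= snd i1).
  { apply (snd_cint_ge (fun x => k (x, b - r))); [lra|apply hint_correct; [lra|easy]|].
    intros x Hx. unfold k, Cinv; simpl.
    replace (- (b - r + - b) / _) with (r / ((x - a) * (x - a) + r * r)); [apply Q; lra|].
    f_equal; [ring|f_equal; ring]. }
  assert (A2 : / (2 * r) * (b + r - (b - r)) <= snd i2).
  { apply (snd_cint_ge (fun y => Ci * k ((a + r)%R, y))%C); [lra|apply vint_correct; [lra|easy]|].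
    intros y Hy. unfold k, Cinv; simpl.
    replace (0 * _ + 1 * _) with (r / ((y - b) * (y - b) + r * r)); [apply Q; lra|].
    rewrite Rmult_0_l, Rplus_0_l, Rmult_1_l. unfold Rdiv. f_equal; [ring|f_equal; ring]. }
  assert (A3 : snd i3 <= - / (2 * r) * (a + r - (a - r))).
  { apply (snd_cint_le (fun x => k (x, b + r))); [lra|apply hint_correct; [lra|easy]|].
    intros x Hx. unfold k, Cinv; simpl.
    replace (- (b + r + - b) / _) with (- (r / ((x - a) * (x - a) + r * r))).
    - apply Ropp_le_contravar, Q; lra.
    - unfold Rdiv. rewrite Ropp_mult_distr_l. f_equal; [ring|f_equal; ring]. }
  assert (A4 : snd i4 <= - / (2 * r) * (b + r - (b - r))).
  { apply (snd_cint_le (fun y => Ci * k ((a - r)%R, y))%C); [lra|apply vint_correct; [lra|easy]|].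
    intros y Hy. unfold k, Cinv; simpl.
    replace (0 * _ + 1 * _) with (- (r / ((y - b) * (y - b) + r * r))).
    - apply Ropp_le_contravar, Q; lra.
    - rewrite Rmult_0_l, Rplus_0_l, Rmult_1_l. unfold Rdiv. rewrite Ropp_mult_distr_l.
      f_equal; [ring|f_equal; ring]. }
  change (4 <= Cmod (i1 + i2 - i3 - i4)%C).
  eapply Rle_trans; [|apply abs_snd_le_Cmod]. eapply Rle_trans; [|apply Rle_abs].
  change (4 <= snd i1 + snd i2 + - snd i3 + - snd i4).
  replace (/ (2 * r) * (a + r - (a - r))) with 1 in A1 by (field; lra).
  replace (/ (2 * r) * (b + r - (b - r))) with 1 in A2 by (field; lra).
  replace (- / (2 * r) * (a + r - (a - r))) with (-1) in A3 by (field; lra).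
  replace (- / (2 * r) * (b + r - (b - r))) with (-1) in A4 by (field; lra). lra.
Qed.

(** The derivative in [z] is the integral of [(w - z)^-2], which has the primitive [- (w - z)^-1] on
    the contour and so vanishes. The integral is treated as the Cauchy transform of the constant
    1. *)
Lemma boundary_int_winding_const (c z : C) (r : R) : Cmod (z - c) < r ->
  boundary_int (fun w => / (w - z))%C (sq c r) = boundary_int (fun w => / (w - c))%C (sq c r).
Proof.
  intros Hz. pose proof (Cmod_ge_0 (z - c)) as Hp.
  assert (W : wf (sq c r)) by (apply wf_sq; lra).
  set (T1 := fun z => boundary_int (fun w => 1 * / (w - z))%C (sq c r)).
  assert (E : forall z, boundary_int (fun w => / (w - z))%C (sq c r) = T1 z).
  { intros x. unfold T1. apply (boundary_int_ext (fun w => / (w - x))%C (fun w => 1 * / (w - x))%C); [easy|].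
    intros w _. ring. }
  rewrite !E.
  assert (H : forall x, Cmod (x - c) < r -> cdiff T1 x 0).
  { intros x Hx.
    replace (RtoC 0) with (boundary_int (fun w => 1 * (/ (w - x) * / (w - x)))%C (sq c r)).
    - apply (cauchy_transform_diff (fun _ => 1) c r); [intros; apply cdiffable_const|easy].
    - assert (N : forall w, edge (sq c r) w -> (w - x)%C <> 0)
        by (intros; now apply edge_sq_neq with c r).
      apply (boundary_int_primitive (fun w => - (1) * / (w - x))%C); [easy| |].
      + intros w Ew. apply cdiffable_ccont.
        repeat apply cdiffable_mult; try apply cdiffable_const; apply cdiffable_cauchy_kernel; auto.
      + intros w Ew. eapply cdiff_eq.
        * apply cdiff_mult; [apply cdiff_const|].
          apply (cdiff_comp (fun w => w - x)%C (fun w => / w)%C);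
            [apply cdiff_minus_const|apply cdiff_inv; auto].
        * cbv beta. field. auto. }
  assert (H0 : Cmod (T1 z - T1 c) <= 0).
  { replace 0 with (0 * Cmod (z - c)) by ring. apply slope_le_segment; [lra|].
    intros t Ht. apply cdiff_slope with (RtoC 0); [|rewrite Cmod_0; lra].
    apply H. apply segment_disc; [easy| |easy]. rewrite Cmod_self. lra. }
  pose proof (Cmod_ge_0 (T1 z - T1 c)) as H1.
  assert (H2 : (T1 z - T1 c)%C = 0) by (apply Cmod_eq_0; lra).
  replace (T1 z) with ((T1 z - T1 c) + T1 c)%C by ring. rewrite H2. ring.
Qed.

(** The 2 in the estimate is 8/4: contour length [8 * r] times the kernel bound [1 / r^2], divided
    by the lower bound 4 for the winding integral. *)
Lemma cauchy_square (f : C -> C) (c : C) (r : R) : 0 < r ->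
  (forall w, inbox (sq c r) w -> cdiffable f w) ->
  exists f1 f2 : C -> C,
    (forall z, Cmod (z - c) < r -> cdiff f z (f1 z) /\ cdiff f1 z (f2 z)) /\
    (forall M, (forall w, inbox (sq c r) w -> Cmod (f w) <= M) -> Cmod (f1 c) <= 2 * M / r).
Proof.
  intros Hr H. set (W := boundary_int (fun w => / (w - c))%C (sq c r)).
  assert (HW : 4 <= Cmod W) by now apply boundary_int_winding_ge.
  assert (HW0 : W <> 0) by (apply Cmod_gt_0; lra).
  set (T1 := fun z => boundary_int (fun w => f w * / (w - z))%C (sq c r)).
  set (T2 := fun z => boundary_int (fun w => f w * (/ (w - z) * / (w - z)))%C (sq c r)).
  set (T3 := fun z => boundary_int (fun w => f w * (/ (w - z) * / (w - z) * / (w - z)))%C (sq c r)).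
  exists (fun z => / W * T2 z)%C, (fun z => / W * (2 * T3 z))%C. split.
  - intros z Hz. split.
    + apply (cdiff_local (fun z => / W * T1 z)%C f z _ (r - Cmod (z - c))); [lra| |].
      * intros w Hw. assert (Hwc : Cmod (w - c) < r) by (pose proof (Cmod_le_plus w z c); lra).
        unfold T1. rewrite cauchy_formula, boundary_int_winding_const by easy. fold W. field. easy.
      * eapply cdiff_eq.
        -- apply cdiff_mult; [apply cdiff_const|].
           now apply (cauchy_transform_diff f c r).
        -- unfold T2. ring.
    + eapply cdiff_eq.
      * apply cdiff_mult; [apply cdiff_const|]. now apply (cauchy_transform_diff2 f c r).
      * unfold T3. ring.
  - intros M HM. rewrite Cmod_mult, Cmod_inv by easy.
    pose proof (cauchy_transform_bound f c r H M Hr HM) as HT. fold (T2 c) in HT.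
    assert (/ Cmod W <= / 4) by (apply Rinv_le_contravar; lra).
    assert (0 < / Cmod W) by (apply Rinv_0_lt_compat; lra).
    replace (2 * M / r) with (/ 4 * (8 * M / r)) by (field; lra).
    apply Rmult_le_compat; [lra|apply Cmod_ge_0|lra|easy].
Qed.

(** * Holomorphy in a neighbourhood of a point *)

Definition holomorphic_at (f : C -> C) (z : C) : Prop :=
  exists r, 0 < r /\ forall w, Cmod (w - z) < r -> cdiffable f w.

Lemma holomorphic_at_sq (f : C -> C) (z : C) : holomorphic_at f z ->
  exists r, 0 < r /\ forall w, inbox (sq z r) w -> cdiffable f w.
Proof.
  intros (r & Hr & H). exists (r / 3). split; [lra|]. intros w Hw. apply H.
  pose proof (inbox_sq_dist _ _ _ Hw). lra.
Qed.

(** This makes the set of singular points relatively closed, so that limits of singular points are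
    singular. *)
Lemma holomorphic_at_open (f : C -> C) (z : C) : holomorphic_at f z ->
  exists r, 0 < r /\ forall w, Cmod (w - z) < r -> holomorphic_at f w.
Proof.
  intros (r & Hr & H). exists r. split; [easy|]. intros w Hw.
  exists (r - Cmod (w - z)). split; [lra|]. intros x Hx. apply H.
  pose proof (Cmod_le_plus x w z). lra.
Qed.

Lemma holomorphic_at_hol (f : C -> C) (z : C) : holomorphic_at f z -> cdiffable f z.
Proof. intros (r & Hr & H). apply H. rewrite Cmod_self. easy. Qed.

Lemma holomorphic_at_mult (f g : C -> C) (z : C) :
  holomorphic_at f z -> holomorphic_at g z -> holomorphic_at (fun w => f w * g w)%C z.
Proof.
  intros (r & Hr & Hf) (s & Hs & Hg). exists (Rmin r s). split; [apply Rmin_glb_lt; easy|].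
  intros w Hw. apply cdiffable_mult.
  - apply Hf. apply Rlt_le_trans with (1 := Hw), Rmin_l.
  - apply Hg. apply Rlt_le_trans with (1 := Hw), Rmin_r.
Qed.

Lemma taylor2 (f : C -> C) (z : C) : holomorphic_at f z ->
  exists a b : C, forall eps, 0 < eps -> exists d, 0 < d /\
    forall w, Cmod (w - z) < d ->
      Cmod (f w - f z - a * (w - z) - b * ((w - z) * (w - z)))
        <= eps * (Cmod (w - z) * Cmod (w - z)).
Proof.
  intros H. destruct (holomorphic_at_sq f z H) as (r & Hr & Hw).
  destruct (cauchy_square f z r Hr Hw) as (f1 & f2 & Hd & _).
  exists (f1 z), (f2 z / 2)%C. intros eps He.
  destruct (Hd z) as [_ H2]; [now rewrite Cmod_self|].
  destruct (H2 eps He) as (d & Hd0 & Hd2).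
  exists (Rmin d r). split; [apply Rmin_glb_lt; easy|]. intros w Hwz.
  (* The derivative of [psi] is the first-order remainder of [f1], at most [eps * Cmod (x - z)]; the
     mean value inequality integrates this bound. *)
  set (psi := fun x => (f x + - f1 z * (x - z) + - (f2 z / 2) * ((x - z) * (x - z)))%C).
  replace (f w - f z - f1 z * (w - z) - f2 z / 2 * ((w - z) * (w - z)))%C
    with (psi w - psi z)%C by (unfold psi; ring).
  rewrite <- Rmult_assoc.
  assert (Hp := Cmod_ge_0 (w - z)).
  apply slope_le_segment; [apply Rmult_le_pos; lra|]. intros t Ht.
  set (x := (z + t * (w - z))%C).
  assert (Hx : Cmod (x - z) <= Cmod (w - z)).
  { replace (x - z)%C with (RtoC t * (w - z))%C by (unfold x; ring).
    rewrite Cmod_mult, Cmod_R, Rabs_right by lra.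
    pose proof (Rmult_le_compat_r _ _ _ Hp (proj2 Ht)). lra. }
  assert (Hx1 : Cmod (x - z) < d).
  { apply Rle_lt_trans with (1 := Hx), Rlt_le_trans with (1 := Hwz), Rmin_l. }
  assert (Hx2 : Cmod (x - z) < r).
  { apply Rle_lt_trans with (1 := Hx), Rlt_le_trans with (1 := Hwz), Rmin_r. }
  apply cdiff_slope with (f1 x - f1 z - f2 z * (x - z))%C.
  - eapply cdiff_eq.
    + apply cdiff_plus; [apply cdiff_plus|].
      * apply Hd, Hx2.
      * apply cdiff_mult; [apply cdiff_const|apply cdiff_minus_const].
      * apply cdiff_mult; [apply cdiff_const|]. apply cdiff_mult; apply cdiff_minus_const.
    + cbv beta. field.
  - eapply Rle_trans; [apply Hd2, Hx1|]. apply Rmult_le_compat_l; lra.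
Qed.

(** * The maximum principle by averaging over four points *)

Definition nsq (z : C) : R := fst z * fst z + snd z * snd z.

Lemma Cmod_sqr (z : C) : Cmod z * Cmod z = nsq z.
Proof.
  unfold Cmod, nsq. rewrite sqrt_sqrt; [ring|].
  pose proof (pow2_ge_0 (fst z)). pose proof (pow2_ge_0 (snd z)). lra.
Qed.

(** On the four points [t], [it], [-t], [-it] the functions [1, h, h^2] are orthogonal,
    so averaging [|g|^2] over them kills the mixed terms of the Taylor expansion. *)
Lemma four_points (a b c : C) (t : R) :
  nsq (a + b * (t, 0%R) + c * ((t, 0%R) * (t, 0%R)))%C + nsq (a + b * (0%R, t) + c * ((0%R, t) * (0%R, t)))%C +
  nsq (a + b * ((- t)%R, 0%R) + c * (((- t)%R, 0%R) * ((- t)%R, 0%R)))%C +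
  nsq (a + b * (0%R, (- t)%R) + c * ((0%R, (- t)%R) * (0%R, (- t)%R)))%C
  = 4 * nsq a + 4 * nsq b * (t * t) + 4 * nsq c * (t * t * (t * t)).
Proof. destruct a, b, c. unfold nsq, Cmult, Cplus; simpl. ring. Qed.

Lemma rcont_sqr (phi : C -> R) (z : C) : rcont phi z -> rcont (fun w => phi w * phi w) z.
Proof.
  intros H eps He. set (b := Rabs (phi z)). assert (Hb : 0 <= b) by apply Rabs_pos.
  set (e := Rmin 1 (eps / (1 + 2 * b + 1))).
  assert (He1 : 0 < e) by (apply Rmin_glb_lt; [lra|apply Rdiv_lt_0_compat; lra]).
  destruct (H e He1) as (d & Hd & Hw). exists d. split; [easy|]. intros w Hwz.
  specialize (Hw w Hwz).
  assert (H1 := Rlt_le_trans _ _ _ Hw (Rmin_l _ _)).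
  assert (H2 := Rlt_le_trans _ _ _ Hw (Rmin_r _ _)).
  replace (phi w * phi w - phi z * phi z) with ((phi w - phi z) * ((phi w - phi z) + 2 * phi z)) by ring.
  rewrite Rabs_mult.
  assert (H3 : Rabs (phi w - phi z + 2 * phi z) <= 1 + 2 * b).
  { eapply Rle_trans; [apply Rabs_triang|]. rewrite Rabs_mult, (Rabs_right 2) by lra. fold b. lra. }
  apply Rle_lt_trans with (Rabs (phi w - phi z) * (1 + 2 * b)).
  { apply Rmult_le_compat_l; [apply Rabs_pos|easy]. }
  apply Rmult_lt_compat_r with (r := 1 + 2 * b + 1) in H2; [|lra].
  replace (eps / (1 + 2 * b + 1) * (1 + 2 * b + 1)) with eps in H2 by (field; lra).
  pose proof (Rabs_pos (phi w - phi z)). lra.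
Qed.

Lemma rcont_plus_scal (phi psi : C -> R) (k : R) (z : C) : 0 < k ->
  rcont phi z -> rcont psi z -> rcont (fun w => phi w + k * psi w) z.
Proof.
  intros Hk H1 H2 eps He.
  destruct (H1 (eps / 2)) as (d1 & Hd1 & A1); [lra|].
  destruct (H2 (eps / (2 * k))) as (d2 & Hd2 & A2); [apply Rdiv_lt_0_compat; lra|].
  exists (Rmin d1 d2). split; [apply Rmin_glb_lt; easy|]. intros w Hw.
  specialize (A1 w (Rlt_le_trans _ _ _ Hw (Rmin_l _ _))).
  specialize (A2 w (Rlt_le_trans _ _ _ Hw (Rmin_r _ _))).
  replace (phi w + k * psi w - (phi z + k * psi z))
    with ((phi w - phi z) + k * (psi w - psi z)) by ring.
  eapply Rle_lt_trans; [apply Rabs_triang|].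
  rewrite Rabs_mult, (Rabs_right k) by lra.
  apply Rmult_lt_compat_l with (r := k) in A2; [|easy].
  replace (k * (eps / (2 * k))) with (eps / 2) in A2 by (field; lra). lra.
Qed.

Lemma nsq_perturb (u p : C) (e S : R) : Cmod (u - p) <= e -> Cmod p <= S ->
  nsq p - 2 * S * e <= nsq u.
Proof.
  intros H1 H2. rewrite <- !Cmod_sqr.
  pose proof (Cmod_ge_0 u) as P1. pose proof (Cmod_ge_0 p) as P2.
  pose proof (Cmod_ge_0 (u - p)) as P3.
  pose proof (Cmod_le_split p u) as H3. rewrite Cmod_minus_sym in H3.
  assert (Cmod p * Cmod (u - p) <= S * e) by (apply Rmult_le_compat; lra).
  destruct (Rle_dec (Cmod (u - p)) (Cmod p)); nra.
Qed.

(** The penalty [eps * nsq (w - z0)] makes the function strictly subharmonic: its average over four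
    points at distance [t] exceeds the central value by [eps * t^2], up to the Taylor error. So even
    a constant [g] yields no maximum, and the equality case never arises. *)
Lemma no_local_max (g : C -> C) (z z0 : C) (eps d : R) : 0 < eps -> 0 < d -> holomorphic_at g z ->
  ~ (forall w, Cmod (w - z) < d -> nsq (g w) + eps * nsq (w - z0)%C <= nsq (g z) + eps * nsq (z - z0)%C).
Proof.
  intros He Hd Hg Hmax. destruct (taylor2 g z Hg) as (a & b & T).
  set (S := Cmod (g z) + Cmod a + Cmod b).
  pose proof (Cmod_ge_0 (g z)) as P1. pose proof (Cmod_ge_0 a) as P2. pose proof (Cmod_ge_0 b) as P3.
  assert (HS : 0 <= S) by (unfold S; lra).
  (* [S] bounds the Taylor polynomial at distance at most 1. With this [eta] the total error
     [8 * S * eta * t^2] stays below the total gain [4 * eps * t^2]. *)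
  set (eta := eps / (4 * (S + 1))).
  assert (Heta : 0 < eta) by (apply Rdiv_lt_0_compat; lra).
  destruct (T eta Heta) as (d' & Hd' & HT).
  set (t := Rmin 1 (Rmin (d / 2) (d' / 2))).
  assert (Ht0 : 0 < t) by (repeat apply Rmin_glb_lt; lra).
  assert (Ht1 : t <= 1) by apply Rmin_l.
  assert (Ht2 : t <= d / 2) by (eapply Rle_trans; [apply Rmin_r|apply Rmin_l]).
  assert (Ht3 : t <= d' / 2) by (eapply Rle_trans; [apply Rmin_r|apply Rmin_r]).
  assert (Key : forall h : C, Cmod h = t ->
    nsq (g z + a * h + b * (h * h))%C - 2 * S * (eta * (t * t)) + eps * nsq (z + h - z0)%C
    <= nsq (g z) + eps * nsq (z - z0)%C).
  { intros h Hh.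
    assert (E : (z + h - z)%C = h) by ring.
    specialize (HT (z + h)%C). rewrite E, Hh in HT. specialize (HT ltac:(lra)).
    specialize (Hmax (z + h)%C). rewrite E, Hh in Hmax. specialize (Hmax ltac:(lra)).
    assert (nsq (g z + a * h + b * (h * h))%C - 2 * S * (eta * (t * t)) <= nsq (g (z + h)%C)); [|lra].
    apply nsq_perturb.
    - replace (g (z + h)%C - (g z + a * h + b * (h * h)))%C
        with (g (z + h)%C - g z - a * h - b * (h * h))%C by ring. exact HT.
    - eapply Rle_trans; [apply Cmod_triangle|].
      eapply Rle_trans; [apply Rplus_le_compat_r, Cmod_triangle|].
      rewrite !Cmod_mult, Hh. unfold S.
      assert (Cmod a * t <= Cmod a * 1) by (apply Rmult_le_compat_l; lra).
      assert (t * t <= 1) by nra.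
      assert (Cmod b * (t * t) <= Cmod b * 1) by (apply Rmult_le_compat_l; lra). lra. }
  assert (M1 : forall s : R, Rabs s = t -> Cmod (s, 0%R) = t).
  { intros s Hs. change (s, 0%R) with (RtoC s). now rewrite Cmod_R. }
  assert (M2 : forall s : R, Rabs s = t -> Cmod (0%R, s) = t).
  { intros s Hs. rewrite <- (Rmult_1_l t), <- Hs, <- Cmod_Ci, <- Cmod_R, <- Cmod_mult. f_equal.
    unfold Ci, RtoC, Cmult; simpl. f_equal; ring. }
  assert (E1 : Rabs t = t) by (apply Rabs_right; lra).
  assert (E2 : Rabs (- t) = t) by (rewrite Rabs_Ropp; easy).
  pose proof (Key (t, 0%R) (M1 t E1)) as K1. pose proof (Key (0%R, t) (M2 t E1)) as K2.
  pose proof (Key ((- t)%R, 0%R) (M1 (- t) E2)) as K3. pose proof (Key (0%R, (- t)%R) (M2 (- t) E2)) as K4.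
  pose proof (four_points (g z) a b t) as F1.
  assert (F2 : nsq (z + (t, 0%R) - z0)%C + nsq (z + (0%R, t) - z0)%C
    + nsq (z + ((- t)%R, 0%R) - z0)%C + nsq (z + (0%R, (- t)%R) - z0)%C
    = 4 * nsq (z - z0)%C + 4 * (t * t)).
  { destruct z, z0. unfold nsq, Cminus, Cplus, Copp; simpl. ring. }
  assert (N : forall x, 0 <= nsq x).
  { intros x. unfold nsq. pose proof (Rle_0_sqr (fst x)). pose proof (Rle_0_sqr (snd x)).
    unfold Rsqr in *. lra. }
  assert (Htt : 0 < t * t) by nra.
  assert (0 <= 4 * nsq a * (t * t)) by (pose proof (N a); apply Rmult_le_pos; lra).
  assert (0 <= 4 * nsq b * (t * t * (t * t))) by (pose proof (N b); repeat apply Rmult_le_pos; lra).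
  assert (F3 : eps * nsq (z + (t, 0%R) - z0)%C + eps * nsq (z + (0%R, t) - z0)%C
    + eps * nsq (z + ((- t)%R, 0%R) - z0)%C + eps * nsq (z + (0%R, (- t)%R) - z0)%C
    = 4 * (eps * nsq (z - z0)%C) + 4 * eps * (t * t)).
  { rewrite <- !Rmult_plus_distr_l, F2. ring. }
  assert (4 * eps * (t * t) <= 8 * S * eta * (t * t)) by lra.
  assert (4 * eps <= 8 * S * eta) by (apply Rmult_le_reg_r with (t * t); lra).
  assert (eta * (4 * (S + 1)) = eps) by (unfold eta; field; lra).
  nra.
Qed.

(** Stated by an alternative at each point, not by boundary values, so that singular points inside
    the box where the bound is already known count as boundary. *)
Lemma max_principle (g : C -> C) (B : box) (K : R) : wf B -> 0 <= K ->
  (forall z, inbox B z -> ccont g z) ->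
  (forall z, inbox B z -> Cmod (g z) <= K \/
     (xl B < fst z < xr B /\ yl B < snd z < yr B /\ holomorphic_at g z)) ->
  forall z, inbox B z -> Cmod (g z) <= K.
Proof.
  intros W HK Hc Hg z0 I0. apply Rnot_lt_le. intros Hlt.
  set (D := bsize B * bsize B + 1).
  assert (HD : 1 <= D) by (unfold D; pose proof (Rle_0_sqr (bsize B)); unfold Rsqr in *; lra).
  assert (Hgap : 0 < Cmod (g z0) * Cmod (g z0) - K * K) by nra.
  (* The penalty vanishes at [z0] and is at most half the gap elsewhere in the box, so the penalised
     maximum is not attained where [Cmod (g z) <= K]. *)
  set (eps := (Cmod (g z0) * Cmod (g z0) - K * K) / (2 * D)).
  assert (He : 0 < eps) by (apply Rdiv_lt_0_compat; lra).
  assert (HeD : eps * D * 2 = Cmod (g z0) * Cmod (g z0) - K * K) by (unfold eps; field; lra).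
  destruct (box_max (fun w => Cmod (g w) * Cmod (g w) + eps * (Cmod (w - z0) * Cmod (w - z0))) B W)
    as (z & Iz & Hz).
  { intros z Iz. apply (rcont_plus_scal (fun w => Cmod (g w) * Cmod (g w))
      (fun w => Cmod (w - z0) * Cmod (w - z0))); [easy| |].
    - apply (rcont_sqr (fun w => Cmod (g w))), rcont_Cmod, Hc, Iz.
    - apply (rcont_sqr (fun w => Cmod (w - z0))), (rcont_Cmod (fun w => w - z0)%C).
      apply cdiffable_ccont, cdiffable_minus_const. }
  destruct (Hg z Iz) as [Hle|(H1 & H2 & H3)].
  - specialize (Hz z0 I0). simpl in Hz. rewrite Cmod_self in Hz.
    assert (Cmod (z - z0) * Cmod (z - z0) <= D).
    { pose proof (inbox_dist B z0 z I0 Iz) as Hd. pose proof (Cmod_ge_0 (z - z0)).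
      unfold D. nra. }
    assert (Cmod (g z) * Cmod (g z) <= K * K) by (pose proof (Cmod_ge_0 (g z)); nra).
    assert (eps * (Cmod (z - z0) * Cmod (z - z0)) <= eps * D) by (apply Rmult_le_compat_l; lra).
    assert (0 < eps * D) by (apply Rmult_lt_0_compat; lra). lra.
  - set (d := Rmin (Rmin (fst z - xl B) (xr B - fst z)) (Rmin (snd z - yl B) (yr B - snd z))).
    assert (Hd : 0 < d) by (repeat apply Rmin_glb_lt; lra).
    apply (no_local_max g z z0 eps d He Hd H3).
    intros w Hw. specialize (Hz w). simpl in Hz. rewrite !Cmod_sqr in Hz. apply Hz.
    assert (d <= fst z - xl B) by (eapply Rle_trans; [apply Rmin_l|apply Rmin_l]).
    assert (d <= xr B - fst z) by (eapply Rle_trans; [apply Rmin_l|apply Rmin_r]).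
    assert (d <= snd z - yl B) by (eapply Rle_trans; [apply Rmin_r|apply Rmin_l]).
    assert (d <= yr B - snd z) by (eapply Rle_trans; [apply Rmin_r|apply Rmin_r]).
    pose proof (abs_fst_le_Cmod (w - z)) as Q1. pose proof (abs_snd_le_Cmod (w - z)) as Q2.
    simpl in Q1, Q2. apply Rle_lt_trans with (2 := Hw) in Q1.
    apply Rle_lt_trans with (2 := Hw) in Q2. apply Rabs_def2 in Q1, Q2.
    unfold inbox. lra.
Qed.

(** * Continuous functions with complex linear directional derivatives *)

Definition copen (D : C -> Prop) : Prop :=
  forall z, D z -> exists r, 0 < r /\ forall w, Cmod (w - z) < r -> D w.

(** One [d] serves all directions, but [del] depends on the direction and [t] is positive only: this
    is what monogenicity supplies. *)
Definition gateaux (f : C -> C) (z d : C) : Prop :=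
  forall (w : C) (eps : R), 0 < eps -> exists del, 0 < del /\ forall t : R, 0 < t < del ->
    Cmod (f (z + t * w)%C - f z - t * w * d) <= eps * t.

Lemma inbox_sq_trans (c z w : C) (r s t : R) :
  inbox (sq c r) z -> inbox (sq z s) w -> r + s <= t -> inbox (sq c t) w.
Proof. unfold inbox; simpl; lra. Qed.

Lemma inbox_sq_center (c : C) (r : R) : 0 <= r -> inbox (sq c r) c.
Proof. unfold inbox; simpl; lra. Qed.

(** The Lipschitz bound carries the estimate from one direction to nearby ones; bisecting a square
    of directions then makes [del] uniform. *)
Lemma lip_gateaux_cdiff (f : C -> C) (z d : C) (L r : R) : 0 < r -> 0 <= L ->
  (forall w1 w2, Cmod (w1 - z) < r -> Cmod (w2 - z) < r ->
     Cmod (f w1 - f w2) <= L * Cmod (w1 - w2)) ->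
  gateaux f z d -> cdiff f z d.
Proof.
  intros Hr HL Lip G eps He.
  set (U := fun (B : box) (del : R) => 0 < del /\ forall (w : C) (t : R), inbox B w -> 0 < t < del ->
    Cmod (f (z + t * w)%C - f z - t * w * d) <= eps * t).
  assert (exists del, U (sq 0 1) del) as (del & Hdel & HU).
  { apply NNPP. intros Hn.
    destruct (nested_quarters (fun B => ~ exists del, U B del) (sq 0 1)) as (w0 & _ & Hw0);
      [apply wf_sq; lra|easy| |].
    - intros B W _ Hq HB. apply HB.
      assert (Hq' : forall i j, exists del, U (quarter i j B) del).
      { intros i j. apply NNPP, (Hq i j). }
      destruct (Hq' false false) as (d1 & D1 & U1), (Hq' false true) as (d2 & D2 & U2),
        (Hq' true false) as (d3 & D3 & U3), (Hq' true true) as (d4 & D4 & U4).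
      exists (Rmin (Rmin d1 d2) (Rmin d3 d4)). split; [repeat apply Rmin_glb_lt; easy|].
      intros w t Iw [Ht1 Ht].
      assert (H1 := Rlt_le_trans _ _ _ Ht (Rmin_l _ _)).
      assert (H2 := Rlt_le_trans _ _ _ Ht (Rmin_r _ _)).
      destruct (quarter_cover B w Iw) as (i & j & Hij).
      destruct i, j; [apply U4|apply U3|apply U2|apply U1]; try easy; split; try easy.
      + apply Rlt_le_trans with (1 := H2), Rmin_r.
      + apply Rlt_le_trans with (1 := H2), Rmin_l.
      + apply Rlt_le_trans with (1 := H1), Rmin_r.
      + apply Rlt_le_trans with (1 := H1), Rmin_l.
    - destruct (G w0 (eps / 2)) as (del & Hdel & HG); [lra|].
      pose proof (Cmod_ge_0 d) as Pd. pose proof (Cmod_ge_0 w0) as Pw.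
      set (K := L + Cmod d + 1).
      assert (HK : 0 < K) by (unfold K; lra).
      (* Turning the direction by [eta] costs at most [(L + Cmod d) * eta * t], half of the allowed
         error; [eta <= 1] bounds the directions, which keeps the points within [r] of [z]. *)
      set (eta := Rmin 1 (eps / (2 * K))).
      assert (Heta : 0 < eta) by (apply Rmin_glb_lt; [lra|apply Rdiv_lt_0_compat; lra]).
      assert (Heta1 : eta <= 1) by apply Rmin_l.
      assert (Heta2 : K * eta <= eps / 2).
      { replace (eps / 2) with (K * (eps / (2 * K))) by (field; lra).
        apply Rmult_le_compat_l; [lra|apply Rmin_r]. }
      destruct (Hw0 eta Heta) as (B & HB & W & _ & I0 & Hs).
      apply HB. exists (Rmin del (r / (Cmod w0 + 1))).
      split; [apply Rmin_glb_lt; [easy|apply Rdiv_lt_0_compat; lra]|].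
      intros w t Iw [Ht0 Ht].
      assert (H1 := Rlt_le_trans _ _ _ Ht (Rmin_l _ _)).
      assert (H2 := Rlt_le_trans _ _ _ Ht (Rmin_r _ _)).
      assert (Hww : Cmod (w - w0) <= eta) by (pose proof (inbox_dist B w0 w I0 Iw); lra).
      assert (Hww1 : Cmod w <= Cmod w0 + 1) by (pose proof (Cmod_le_split w w0); lra).
      assert (Htr : t * (Cmod w0 + 1) < r).
      { apply Rmult_lt_compat_r with (r := Cmod w0 + 1) in H2; [|lra].
        unfold Rdiv in H2. rewrite Rmult_assoc, Rinv_l, Rmult_1_r in H2; lra. }
      assert (N : forall x, Cmod (z + t * x - z) = t * Cmod x).
      { intros x. replace (z + t * x - z)%C with (RtoC t * x)%C by ring.
        rewrite Cmod_mult, Cmod_R, Rabs_right; lra. }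
      assert (HL1 : Cmod (f (z + t * w)%C - f (z + t * w0)%C) <= L * (t * Cmod (w - w0))).
      { replace (t * Cmod (w - w0)) with (Cmod (z + t * w - (z + t * w0))).
        - apply Lip; rewrite N.
          + apply Rle_lt_trans with (2 := Htr), Rmult_le_compat_l; lra.
          + apply Rle_lt_trans with (2 := Htr), Rmult_le_compat_l; lra.
        - replace (z + t * w - (z + t * w0))%C with (RtoC t * (w - w0))%C by ring.
          rewrite Cmod_mult, Cmod_R, Rabs_right; lra. }
      specialize (HG t (conj Ht0 H1)).
      replace (f (z + t * w)%C - f z - t * w * d)%C
        with ((f (z + t * w)%C - f (z + t * w0)%C) + ((f (z + t * w0)%C - f z - t * w0 * d)
              + - (t * (w - w0) * d)))%C by ring.
      eapply Rle_trans; [apply Cmod_triangle|].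
      eapply Rle_trans; [apply Rplus_le_compat_l, Cmod_triangle|].
      rewrite Cmod_opp, !Cmod_mult, Cmod_R, Rabs_right by lra.
      set (x := Cmod (w - w0)) in *. assert (Hx : 0 <= x) by apply Cmod_ge_0.
      assert ((L + Cmod d) * x <= K * eta) by (unfold K; apply Rmult_le_compat; lra).
      assert (((L + Cmod d) * x) * t <= (eps / 2) * t) by (apply Rmult_le_compat_r; lra).
      lra. }
  exists del. split; [easy|]. intros w Hw.
  destruct (Req_dec (Cmod (w - z)) 0) as [E|E].
  - apply Cmod_eq_0 in E. rewrite E. replace w with ((w - z) + z)%C by ring.
    rewrite E, Cplus_0_l. replace (f z - f z - d * 0)%C with (RtoC 0) by ring.
    rewrite Cmod_0. lra.
  - set (t := Cmod (w - z)) in *. assert (0 <= t) by apply Cmod_ge_0.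
    assert (Ht : 0 < t) by lra.
    assert (Ht0 : RtoC t <> 0) by (intros Ht0; apply RtoC_inj in Ht0; lra).
    assert (Hin : inbox (sq 0 1) ((w - z) / t)%C).
    { apply dist_inbox_sq. replace ((w - z) / t - 0)%C with ((w - z) / t)%C by ring.
      rewrite Cmod_div, Cmod_R, Rabs_right by (easy || lra). fold t.
      right. field. lra. }
    specialize (HU _ t Hin (conj Ht Hw)).
    replace (z + t * ((w - z) / t))%C with w in HU by (field; easy).
    replace (t * ((w - z) / t) * d)%C with (d * (w - z))%C in HU by (field; easy). exact HU.
Qed.

(** All four signs are listed because the ray derivatives are one-sided. *)
Definition axis (w : C) : Prop := w = 1 \/ w = Ci \/ w = (- (1))%C \/ w = (- Ci)%C.

Lemma axis_Cmod (w : C) : axis w -> Cmod w = 1.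
Proof.
  intros [->|[->|[->| ->]]]; rewrite ?Cmod_opp; [apply Cmod_1|apply Cmod_Ci|apply Cmod_1|apply Cmod_Ci].
Qed.

Lemma ccont_dist (f : C -> C) (x y : C) (K : R) : ccont f x -> ccont f y -> K < Cmod (f x - f y) ->
  exists d, 0 < d /\ forall x' y', Cmod (x' - x) < d -> Cmod (y' - y) < d -> K < Cmod (f x' - f y').
Proof.
  intros Hx Hy HK. set (e := (Cmod (f x - f y) - K) / 2).
  destruct (Hx e) as (d1 & H1 & A1); [unfold e; lra|].
  destruct (Hy e) as (d2 & H2 & A2); [unfold e; lra|].
  exists (Rmin d1 d2). split; [apply Rmin_glb_lt; easy|]. intros x' y' Hx' Hy'.
  specialize (A1 x' (Rlt_le_trans _ _ _ Hx' (Rmin_l _ _))).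
  specialize (A2 y' (Rlt_le_trans _ _ _ Hy' (Rmin_r _ _))).
  pose proof (Cmod_le_plus (f x) (f x') (f y)). pose proof (Cmod_le_plus (f x') (f y') (f y)).
  rewrite Cmod_minus_sym in A1. unfold e in *. lra.
Qed.

(** Baire category: on a portion of the (relatively closed) set of singular points the
    difference quotients along the axes are uniformly bounded. *)
Lemma uniform_axis_bound (D : C -> Prop) (f : C -> C) (z : C) :
  copen D -> (forall w, D w -> ccont f w) -> (forall w, D w -> exists d, gateaux f w d) ->
  D z -> ~ holomorphic_at f z ->
  exists (c : C) (N rho : R), 0 < rho /\ 0 <= N /\ ~ holomorphic_at f c /\ (forall w, inbox (sq c (2 * rho)) w -> D w) /\
    forall (x w : C) (t : R), ~ holomorphic_at f x -> inbox (sq c rho) x -> axis w -> 0 < t < rho ->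
      Cmod (f (x + t * w)%C - f x) <= N * t.
Proof.
  intros HD Hc Hg Dz Ez. apply NNPP. intros Hno.
  destruct (HD z Dz) as (r & Hr & HrD).
  set (s0 := r / 3).
  assert (HsD : forall w, inbox (sq z s0) w -> D w).
  { intros w Iw. apply HrD. pose proof (inbox_sq_dist _ _ _ Iw). unfold s0 in *; lra. }
  assert (Hs0 : 0 < s0) by (unfold s0; lra).
  (* The boxes are centred at singular points. At level [S j] every point of the box has an axis
     difference quotient larger than [j] with a step below [1 / 2 ^ j]. *)
  set (P := fun k B => (exists c s, B = sq c s /\ 0 < s /\ ~ holomorphic_at f c) /\
    match k with O => True | S j => forall x, inbox B x -> exists (w : C) (t : R), axis w /\
      0 < t < 1 / 2 ^ j /\ INR j * t < Cmod (f (x + t * w)%C - f x) end).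
  destruct (nested_boxes P (sq z s0)) as [x Hx].
  - apply wf_sq; lra.
  - split; [|easy]. exists z, s0. auto.
  - intros k B [(c & s & -> & Hs & Ec) _] _ Sub.
    set (rho := Rmin (s / 2) (1 / 2 ^ k)).
    assert (Hrho : 0 < rho).
    { apply Rmin_glb_lt; [lra|]. apply Rdiv_lt_0_compat; [lra|apply pow_lt; lra]. }
    assert (Hrs : rho <= s / 2) by apply Rmin_l.
    assert (Hrk : rho <= 1 / 2 ^ k) by apply Rmin_r.
    assert (HcD : forall w, inbox (sq c (2 * rho)) w -> D w).
    { intros w Iw. apply HsD. unfold subbox, inbox in *; simpl in *; lra. }
    assert (exists (x w : C) (t : R), ~ holomorphic_at f x /\ inbox (sq c rho) x /\ axis w /\ 0 < t < rho /\
              INR k * t < Cmod (f (x + t * w)%C - f x)) as (x & w & t & Ex & Ix & Aw & Ht & Hlt).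
    { apply NNPP. intros Hn. apply Hno. exists c, (INR k), rho.
      repeat split; try easy; [apply pos_INR|]. intros x w t Ex Ix Aw Ht.
      apply Rnot_lt_le. intros Hlt. apply Hn. exists x, w, t. auto. }
    assert (Ht0 : 0 < t) by apply Ht.
    assert (E : Cmod (x + t * w - x) = t).
    { replace (x + t * w - x)%C with (RtoC t * w)%C by ring.
      rewrite Cmod_mult, Cmod_R, (axis_Cmod w Aw), Rabs_right; lra. }
    (* For fixed [w] and [t] the violated bound is an open condition on the base point, so it
       persists on a small square about [x]. *)
    destruct (ccont_dist f (x + t * w)%C x (INR k * t)) as (d & Hd & Hdd).
    { apply Hc, HcD. apply (inbox_sq_trans c x _ rho rho); [easy| |lra].
      apply dist_inbox_sq. lra. }
    { apply Hc, HcD. unfold inbox in *; simpl in *; lra. }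
    { exact Hlt. }
    set (s' := Rmin (s / 2) (d / 3)).
    assert (Hs' : 0 < s') by (apply Rmin_glb_lt; lra).
    assert (Hs'1 : s' <= s / 2) by apply Rmin_l.
    assert (Hs'2 : s' <= d / 3) by apply Rmin_r.
    exists (sq x s'). split; [split|split; [|split]].
    + exists x, s'. auto.
    + intros y Iy. exists w, t. split; [easy|]. split; [lra|].
      pose proof (inbox_sq_dist _ _ _ Iy). apply Hdd; [|lra].
      replace (y + t * w - (x + t * w))%C with (y - x)%C by ring. lra.
    + apply wf_sq; lra.
    + unfold subbox, inbox in *; simpl in *; lra.
    + rewrite !bsize_sq. lra.
  - destruct (Hx O) as (B0 & _ & I0 & _ & S0 & _).
    assert (Dx : D x) by (apply HsD; now apply inbox_sub with B0).
    (* The common point is a limit of singular centres, hence singular. Its own ray derivatives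
       along the axes then contradict the large quotients at deep levels. *)
    assert (Ex : ~ holomorphic_at f x).
    { intros Hn. destruct (holomorphic_at_open f x Hn) as (d & Hd & Hd').
      destruct (pow2_small (bsize (sq z s0)) d Hd) as [k Hk].
      destruct (Hx k) as (B & [(c & s & -> & Hs & Ec) _] & Ix & _ & _ & Hsz).
      apply Ec, Hd'. pose proof (inbox_dist _ x c Ix (inbox_sq_center c s ltac:(lra))). lra. }
    destruct (Hg x Dx) as [d Gd].
    assert (G1 : forall w, axis w -> exists del, 0 < del /\ forall t : R, 0 < t < del ->
              Cmod (f (x + t * w)%C - f x) <= (Cmod d + 1) * t).
    { intros w Aw. destruct (Gd w 1 Rlt_0_1) as (del & Hdel & H). exists del. split; [easy|].
      intros t Ht. specialize (H t Ht).
      pose proof (Cmod_le_split (f (x + t * w)%C - f x) (t * w * d)) as H1.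
      rewrite !Cmod_mult, Cmod_R, (axis_Cmod w Aw), Rabs_right in H1 by lra. lra. }
    destruct (G1 (RtoC 1)) as (d1 & D1 & B1); [now left|].
    destruct (G1 Ci) as (d2 & D2 & B2); [now right; left|].
    destruct (G1 (- (1))%C) as (d3 & D3 & B3); [now right; right; left|].
    destruct (G1 (- Ci)%C) as (d4 & D4 & B4); [now right; right; right|].
    set (del := Rmin (Rmin d1 d2) (Rmin d3 d4)).
    assert (Hdel : 0 < del) by (repeat apply Rmin_glb_lt; easy).
    assert (L1 : del <= d1) by (eapply Rle_trans; [apply Rmin_l|apply Rmin_l]).
    assert (L2 : del <= d2) by (eapply Rle_trans; [apply Rmin_l|apply Rmin_r]).
    assert (L3 : del <= d3) by (eapply Rle_trans; [apply Rmin_r|apply Rmin_l]).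
    assert (L4 : del <= d4) by (eapply Rle_trans; [apply Rmin_r|apply Rmin_r]).
    destruct (pow2_small 1 del Hdel) as [k1 Hk1].
    destruct (INR_unbounded (Cmod d + 1)) as [k2 Hk2].
    set (k := Nat.max k1 k2).
    assert (Hk : 1 / 2 ^ k < del).
    { apply Rle_lt_trans with (2 := Hk1). unfold Rdiv. rewrite !Rmult_1_l.
      apply Rinv_le_contravar; [apply pow_lt; lra|]. apply Rle_pow; [lra|unfold k; lia]. }
    assert (Hk' : Cmod d + 1 < INR k).
    { apply Rlt_le_trans with (1 := Hk2). apply le_INR. unfold k; lia. }
    destruct (Hx (S k)) as (B & [_ HB] & Ix & _).
    destruct (HB x Ix) as (w & t & Aw & Ht & Hlt).
    assert (Hle : Cmod (f (x + t * w)%C - f x) <= (Cmod d + 1) * t).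
    { destruct Aw as [->|[->|[->| ->]]]; [apply B1|apply B2|apply B3|apply B4]; lra. }
    assert ((Cmod d + 1) * t < INR k * t) by (apply Rmult_lt_compat_r; lra). lra.
Qed.

(** The factor [delta * k] keeps the denominator away from [0], so that the quotient is
    continuous up to the corner [x], where it vanishes. *)
Lemma corner_estimate (f : C -> C) (B : box) (x k : C) (K : R) :
  wf B -> 0 <= K -> k <> 0 -> (forall z, inbox B z -> ccont f z) ->
  (forall (z : C) (delta : R), inbox B z -> 0 < delta ->
     Cmod (z - x) <= Cmod (z - x + delta * k) /\ (z - x + delta * k)%C <> 0) ->
  (forall z, inbox B z -> Cmod (f z - f x) <= K * Cmod (z - x) \/
     (xl B < fst z < xr B /\ yl B < snd z < yr B /\ holomorphic_at f z)) ->
  forall z, inbox B z -> Cmod (f z - f x) <= K * Cmod (z - x).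
Proof.
  intros W HK Hk Hc Hden Hf z Iz. apply le_epsilon. intros eps He.
  assert (Pk := proj1 (Cmod_gt_0 k) Hk).
  set (delta := eps / (K * Cmod k + 1)).
  assert (HKk : 0 <= K * Cmod k) by (apply Rmult_le_pos; lra).
  assert (Hdel : 0 < delta) by (apply Rdiv_lt_0_compat; lra).
  assert (Hlin : forall w, cdiffable (fun w => w - x + delta * k)%C w).
  { intros w. apply cdiffable_plus; [apply cdiffable_minus_const|apply cdiffable_const]. }
  set (g := fun w => ((f w - f x) * / (w - x + delta * k))%C).
  assert (Hg : Cmod (g z) <= K).
  { apply (max_principle g B K); try easy.
    - intros w Iw. destruct (Hden w delta Iw Hdel) as [_ Hn]. apply ccont_mult.
      + apply ccont_plus; [now apply Hc|apply cdiffable_ccont, cdiffable_const].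
      + apply cdiffable_ccont. apply (cdiffable_inv (fun w => w - x + delta * k)%C); [apply Hlin|easy].
    - intros w Iw. destruct (Hden w delta Iw Hdel) as [Hge Hn].
      destruct (Hf w Iw) as [Hle|(H1 & H2 & H3)].
      + left. unfold g. rewrite Cmod_mult, Cmod_inv by easy.
        assert (Pn := proj1 (Cmod_gt_0 _) Hn).
        apply Rmult_le_reg_r with (Cmod (w - x + delta * k)); [easy|].
        rewrite Rmult_assoc, Rinv_l, Rmult_1_r by lra.
        apply Rle_trans with (1 := Hle). apply Rmult_le_compat_l; lra.
      + right. split; [easy|]. split; [easy|]. apply holomorphic_at_mult.
        * destruct H3 as (r & Hr & H3). exists r. split; [easy|].
          intros y Hy. apply cdiffable_plus; [now apply H3|apply cdiffable_const].
        * destruct (cdiffable_ccont _ w (Hlin w) (Cmod (w - x + delta * k))) as (d & Hd & Hw);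
            [now apply Cmod_gt_0|].
          exists d. split; [easy|]. intros y Hy.
          apply (cdiffable_inv (fun w => w - x + delta * k)%C); [apply Hlin|].
          intros E. specialize (Hw y Hy). cbv beta in Hw. rewrite E in Hw.
          replace (0 - (w - x + delta * k))%C with (- (w - x + delta * k))%C in Hw by ring.
          rewrite Cmod_opp in Hw. lra. }
  destruct (Hden z delta Iz Hdel) as [_ Hn]. unfold g in Hg.
  rewrite Cmod_mult, Cmod_inv in Hg by easy.
  assert (Pn := proj1 (Cmod_gt_0 _) Hn).
  apply Rmult_le_compat_r with (r := Cmod (z - x + delta * k)) in Hg; [|lra].
  rewrite Rmult_assoc, Rinv_l, Rmult_1_r in Hg by lra.
  apply Rle_trans with (1 := Hg).
  apply Rle_trans with (K * (Cmod (z - x) + Cmod (delta * k))).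
  - apply Rmult_le_compat_l; [easy|apply Cmod_triangle].
  - rewrite Cmod_mult, Cmod_R, Rabs_right by lra.
    assert (delta * (K * Cmod k + 1) = eps) by (unfold delta; field; lra). lra.
Qed.

Lemma axis_bound_signed (f : C -> C) (x : C) (N rho : R) :
  (forall (w : C) (t : R), axis w -> 0 < t < rho -> Cmod (f (x + t * w)%C - f x) <= N * t) ->
  0 <= N -> forall a b : R, (a = 0 \/ b = 0) -> Rabs a < rho -> Rabs b < rho ->
    Cmod (f (x + (a, b))%C - f x) <= N * (Rabs a + Rabs b).
Proof.
  intros H HN.
  assert (Hp : forall (w : C) (t : R), (w = RtoC 1 \/ w = Ci) -> Rabs t < rho ->
            Cmod (f (x + t * w)%C - f x) <= N * Rabs t).
  { intros w t Hw Ht. destruct (Rtotal_order t 0) as [Hlt|[->|Hgt]].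
    - rewrite Rabs_left in * by easy. 
      replace (t * w)%C with (RtoC (- t) * (- w))%C by (rewrite RtoC_opp; ring).
      apply H; [|lra]. destruct Hw as [->| ->]; unfold axis; tauto.
    - replace (x + 0 * w)%C with x by ring. rewrite Cmod_self, Rabs_R0. lra.
    - rewrite Rabs_right in * by lra. apply H; [|lra].
      destruct Hw as [->| ->]; unfold axis; tauto. }
  intros a b [->| ->] Ha Hb.
  - replace (0%R, b) with (b * Ci)%C by (unfold RtoC, Ci, Cmult; simpl; f_equal; ring).
    rewrite Rabs_R0, Rplus_0_l. apply Hp; auto.
  - replace (a, 0%R) with (a * 1)%C by (unfold RtoC, Cmult; simpl; f_equal; ring).
    rewrite Rabs_R0, Rplus_0_r. apply Hp; auto.
Qed.

Lemma Cmod_le_nsq (u v : C) : nsq u <= nsq v -> Cmod u <= Cmod v.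
Proof.
  rewrite <- !Cmod_sqr. intros H. apply Rsqr_incr_0; [exact H| |]; apply Cmod_ge_0.
Qed.

(** The pole [x - delta * (a, b)] lies in the quadrant opposite to that of [z]. This verifies the
    denominator condition of [corner_estimate] with [k = (a, b)]. *)
Lemma quadrant_away (z x : C) (a b delta : R) : 0 < delta -> Rabs a = 1 -> Rabs b = 1 ->
  0 <= a * (fst z - fst x) -> 0 <= b * (snd z - snd x) ->
  Cmod (z - x) <= Cmod (z - x + delta * (a, b)) /\ (z - x + delta * (a, b))%C <> 0.
Proof.
  intros Hd Ha Hb H1 H2.
  assert (Ha2 : a * a = 1) by (rewrite <- (Rabs_right (a * a)), Rabs_mult, Ha by nra; ring).
  assert (Hb2 : b * b = 1) by (rewrite <- (Rabs_right (b * b)), Rabs_mult, Hb by nra; ring).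
  assert (H1' := Rmult_le_pos _ _ (Rlt_le _ _ Hd) H1).
  assert (H2' := Rmult_le_pos _ _ (Rlt_le _ _ Hd) H2).
  assert (E : nsq (z - x + delta * (a, b))%C = nsq (z - x)%C + 2 * (delta * (a * (fst z - fst x)))
     + 2 * (delta * (b * (snd z - snd x))) + delta * delta * (a * a) + delta * delta * (b * b)).
  { unfold nsq; simpl. ring. }
  rewrite Ha2, Hb2 in E.
  assert (Hdd : 0 < delta * delta) by nra.
  assert (0 <= nsq (z - x)%C) by (unfold nsq; nra).
  split.
  - apply Cmod_le_nsq. lra.
  - intros E0. rewrite E0 in E. unfold nsq at 1 in E. simpl in E. lra.
Qed.

(** The constant collects the possible boundary points of a quadrant box at [x]: [2 * N] for
    singular points and the edges through [x], [2 / s] for the outer edges. *)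
Lemma singular_center_estimate (f : C -> C) (c : C) (N rho s : R) :
  0 < s -> 2 * s <= rho -> 0 <= N ->
  (forall w, inbox (sq c (2 * s)) w -> ccont f w /\ Cmod (f w - f c) <= 1) ->
  (forall (x w : C) (t : R), ~ holomorphic_at f x -> inbox (sq c rho) x -> axis w -> 0 < t < rho ->
      Cmod (f (x + t * w)%C - f x) <= N * t) ->
  forall x z, ~ holomorphic_at f x -> inbox (sq c s) x -> inbox (sq x s) z ->
    Cmod (f z - f x) <= (2 * N + 2 / s) * Cmod (z - x).
Proof.
  intros Hs Hsr HN Hc Hax x z Ex Ix Iz. set (K := 2 * N + 2 / s).
  assert (H2s : 0 < 2 / s) by (apply Rdiv_lt_0_compat; lra).
  assert (Sub : forall w, inbox (sq x s) w -> inbox (sq c (2 * s)) w).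
  { intros w Iw. apply (inbox_sq_trans c x w s s); [easy|easy|lra]. }
  assert (Hax' : forall y, ~ holomorphic_at f y -> inbox (sq c rho) y -> forall a b : R, (a = 0 \/ b = 0) ->
     Rabs a < rho -> Rabs b < rho -> Cmod (f (y + (a, b))%C - f y) <= N * (Rabs a + Rabs b)).
  { intros y Ey Iy. apply axis_bound_signed; [|easy]. intros w t. now apply Hax. }
  assert (Ixr : inbox (sq c rho) x) by (unfold inbox in *; simpl in *; lra).
  (* One argument for all four quadrants: the last condition on [B] places each point in the
     interior, on an axis line through [x], or at distance at least [s] in one coordinate. *)
  assert (Main : forall (B : box) (k : C), wf B -> k <> RtoC 0 -> (forall w, inbox B w -> inbox (sq x s) w) ->
    (forall (w : C) (delta : R), inbox B w -> 0 < delta ->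
       Cmod (w - x) <= Cmod (w - x + delta * k) /\ (w - x + delta * k)%C <> 0) ->
    (forall w, inbox B w -> (xl B < fst w < xr B /\ yl B < snd w < yr B) \/
       fst w = fst x \/ snd w = snd x \/ s <= Rabs (fst w - fst x) \/ s <= Rabs (snd w - snd x)) ->
    inbox B z -> Cmod (f z - f x) <= K * Cmod (z - x)).
  { intros B k W Hk HB Hden Hedge.
    assert (HK : 0 <= K) by (unfold K; lra).
    apply (corner_estimate f B x k K W HK Hk); [|exact Hden|].
    - intros w Iw. apply Hc, Sub, HB, Iw.
    - intros w Iw.
      assert (Iw' := HB w Iw).
      assert (D1 : Rabs (fst w - fst x) <= s) by (apply Rabs_le; unfold inbox in Iw'; simpl in Iw'; lra).
      assert (D2 : Rabs (snd w - snd x) <= s) by (apply Rabs_le; unfold inbox in Iw'; simpl in Iw'; lra).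
      pose proof (abs_fst_le_Cmod (w - x)) as Q1. pose proof (abs_snd_le_Cmod (w - x)) as Q2.
      simpl in Q1, Q2. fold (fst w - fst x) in Q1. fold (snd w - snd x) in Q2.
      pose proof (Cmod_ge_0 (w - x)) as Q0.
      assert (KN : forall v, v <= 2 * N * Cmod (w - x) -> v <= K * Cmod (w - x)).
      { intros v Hv. apply Rle_trans with (1 := Hv). apply Rmult_le_compat_r; unfold K; lra. }
      assert (N1 : N * Rabs (fst w - fst x) <= N * Cmod (w - x)) by (apply Rmult_le_compat_l; lra).
      assert (N2 : N * Rabs (snd w - snd x) <= N * Cmod (w - x)) by (apply Rmult_le_compat_l; lra).
      destruct (classic (holomorphic_at f w)) as [Hw|Ew].
      + destruct (Hedge w Iw) as [Hin|He]; [right; tauto|left].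
        (* Both values are within 1 of [f c], so they differ by at most 2, while the points are at
           least [s] apart. *)
        assert (Far : s <= Cmod (w - x) -> Cmod (f w - f x) <= K * Cmod (w - x)).
        { intros Hfar. destruct (Hc w (Sub w Iw')) as [_ B1].
          destruct (Hc x) as [_ B2]; [unfold inbox in *; simpl in *; lra|].
          rewrite Cmod_minus_sym in B2. pose proof (Cmod_le_plus (f w) (f c) (f x)).
          apply Rle_trans with (2 / s * s); [field_simplify; lra|].
          apply Rmult_le_compat; unfold K; lra. }
        destruct He as [He|[He|[He|He]]]; [| |apply Far; lra|apply Far; lra].
        * replace w with (x + (0%R, (snd w - snd x)%R))%C at 1.
          -- apply KN. eapply Rle_trans; [apply Hax'; auto; rewrite ?Rabs_R0; lra|].
             rewrite Rabs_R0. nra.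
          -- destruct w, x; unfold Cplus; simpl in *; f_equal; lra.
        * replace w with (x + ((fst w - fst x)%R, 0%R))%C at 1.
          -- apply KN. eapply Rle_trans; [apply Hax'; auto; rewrite ?Rabs_R0; lra|].
             rewrite Rabs_R0. nra.
          -- destruct w, x; unfold Cplus; simpl in *; f_equal; lra.
      + left. apply KN.
        assert (Iwr : inbox (sq c rho) w).
        { apply Sub in Iw'. unfold inbox in *; simpl in *; lra. }
        (* The corner [p] is reached horizontally from [x] and vertically from [w]. Both base points
           are singular, so the axis bound applies twice. *)
        set (p := (fst w, snd x)).
        assert (P1 : Cmod (f p - f x) <= N * Rabs (fst w - fst x)).
        { replace p with (x + ((fst w - fst x)%R, 0%R))%C.
          - eapply Rle_trans; [apply Hax'; auto; rewrite ?Rabs_R0; lra|]. rewrite Rabs_R0. nra.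
          - unfold p. destruct w, x; unfold Cplus; simpl in *; f_equal; lra. }
        assert (P2 : Cmod (f p - f w) <= N * Rabs (snd w - snd x)).
        { rewrite Rabs_minus_sym in D2 |- *. replace p with (w + (0%R, (snd x - snd w)%R))%C.
          - eapply Rle_trans; [apply Hax'; auto; rewrite ?Rabs_R0; lra|]. rewrite Rabs_R0. nra.
          - unfold p. destruct w, x; unfold Cplus; simpl in *; f_equal; lra. }
        rewrite Cmod_minus_sym in P2. pose proof (Cmod_le_plus (f w) (f p) (f x)). lra. }
  assert (A1 : Rabs 1 = 1) by apply Rabs_R1.
  assert (A2 : Rabs (-1) = 1) by (rewrite Rabs_left; lra).
  assert (Hk : forall a b : R, Rabs a = 1 -> (a, b) <> RtoC 0).
  { intros a b Ha E. inversion E; subst. rewrite Rabs_R0 in Ha. lra. }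
  assert (Far : forall u, u = s \/ u = - s -> s <= Rabs u).
  { intros u [->| ->]; rewrite ?Rabs_Ropp, Rabs_right; lra. }
  destruct Iz as [I1 I2]. simpl in I1, I2.
  destruct (Rle_dec (fst x) (fst z)), (Rle_dec (snd x) (snd z)).
  - apply (Main (Box (fst x) (fst x + s) (snd x) (snd x + s)) (1, 1)%R); [split; simpl; lra|auto| | | |];
      [| | |unfold inbox; simpl; lra].
    + unfold inbox; simpl; intros; lra.
    + intros w delta [J1 J2] Hd. simpl in J1, J2. apply quadrant_away; auto; lra.
    + intros w [J1 J2]. simpl in *.
      destruct (Req_dec (fst w) (fst x)), (Req_dec (snd w) (snd x)),
        (Req_dec (fst w - fst x) s), (Req_dec (snd w - snd x) s); auto 10. left; lra.
  - apply (Main (Box (fst x) (fst x + s) (snd x - s) (snd x)) (1, -1)%R); [split; simpl; lra|auto| | | |];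
      [| | |unfold inbox; simpl; lra].
    + unfold inbox; simpl; intros; lra.
    + intros w delta [J1 J2] Hd. simpl in J1, J2. apply quadrant_away; auto; lra.
    + intros w [J1 J2]. simpl in *.
      destruct (Req_dec (fst w) (fst x)), (Req_dec (snd w) (snd x)),
        (Req_dec (fst w - fst x) s), (Req_dec (snd w - snd x) (- s)); auto 10. left; lra.
  - apply (Main (Box (fst x - s) (fst x) (snd x) (snd x + s)) (-1, 1)%R); [split; simpl; lra|auto| | | |];
      [| | |unfold inbox; simpl; lra].
    + unfold inbox; simpl; intros; lra.
    + intros w delta [J1 J2] Hd. simpl in J1, J2. apply quadrant_away; auto; lra.
    + intros w [J1 J2]. simpl in *.
      destruct (Req_dec (fst w) (fst x)), (Req_dec (snd w) (snd x)),
        (Req_dec (fst w - fst x) (- s)), (Req_dec (snd w - snd x) s); auto 10. left; lra.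
  - apply (Main (Box (fst x - s) (fst x) (snd x - s) (snd x)) (-1, -1)%R); [split; simpl; lra|auto| | | |];
      [| | |unfold inbox; simpl; lra].
    + unfold inbox; simpl; intros; lra.
    + intros w delta [J1 J2] Hd. simpl in J1, J2. apply quadrant_away; auto; lra.
    + intros w [J1 J2]. simpl in *.
      destruct (Req_dec (fst w) (fst x)), (Req_dec (snd w) (snd x)),
        (Req_dec (fst w - fst x) (- s)), (Req_dec (snd w - snd x) (- s)); auto 10. left; lra.
Qed.

(** The square is doubled as long as it stays regular, which must end before it swallows [c]. The
    factor 2 is the price for not taking an exact supremum. *)
Lemma largest_regular_square (f : C -> C) (c z : C) (r : R) : 0 < r ->
  ~ holomorphic_at f c -> (forall w, inbox (sq z r) w -> holomorphic_at f w) ->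
  exists r' x, 0 < r' /\ (forall w, inbox (sq z r') w -> holomorphic_at f w) /\
    ~ holomorphic_at f x /\ inbox (sq z (2 * r')) x.
Proof.
  intros Hr Ec Hfree.
  destruct (pow2_small (Cmod (c - z)) r Hr) as [k Hk].
  assert (H2 : 0 < 2 ^ k) by (apply pow_lt; lra).
  assert (Hck : inbox (sq z (2 ^ k * r)) c).
  { apply dist_inbox_sq. apply Rlt_le. apply Rmult_lt_compat_l with (r := 2 ^ k) in Hk; [|easy].
    replace (2 ^ k * (Cmod (c - z) / 2 ^ k)) with (Cmod (c - z)) in Hk by (field; lra). easy. }
  clear Hk H2. revert r Hr Hfree Hck. induction k as [|k IH]; intros r Hr Hfree Hck.
  - exfalso. apply Ec, Hfree. simpl in Hck. now rewrite Rmult_1_l in Hck.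
  - destruct (classic (forall w, inbox (sq z (2 * r)) w -> holomorphic_at f w)) as [H|H].
    + apply (IH (2 * r)); [lra|easy|].
      replace (2 ^ k * (2 * r)) with (2 ^ S k * r) by (simpl; ring). easy.
    + apply not_all_ex_not in H. destruct H as [x Hx]. apply imply_to_and in Hx.
      exists r, x. tauto.
Qed.

Theorem continuous_gateaux_holomorphic (D : C -> Prop) (f : C -> C) :
  copen D -> (forall w, D w -> ccont f w) -> (forall w, D w -> exists d, gateaux f w d) ->
  forall z, D z -> holomorphic_at f z.
Proof.
  intros HD Hc Hg z Dz. apply NNPP. intros Ez.
  destruct (uniform_axis_bound D f z HD Hc Hg Dz Ez) as (c & N & rho & Hrho & HN & Ec & HcD & Hax).
  assert (Dc : D c) by (apply HcD, inbox_sq_center; lra).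
  destruct (Hc c Dc 1 Rlt_0_1) as (d & Hd & Hd1).
  (* Points of [sq c (2 * s)] are within [4 * s], hence within [d], of [c]; there [f] differs from
     [f c] by less than 1. *)
  set (s := Rmin (rho / 2) (d / 8)).
  assert (Hs : 0 < s) by (apply Rmin_glb_lt; lra).
  assert (Hs1 : s <= rho / 2) by apply Rmin_l.
  assert (Hs2 : s <= d / 8) by apply Rmin_r.
  set (K := 2 * N + 2 / s).
  assert (HK : 0 <= K) by (unfold K; pose proof (Rdiv_lt_0_compat 2 s); lra).
  assert (Star : forall x w, ~ holomorphic_at f x -> inbox (sq c s) x -> inbox (sq x s) w ->
    Cmod (f w - f x) <= K * Cmod (w - x)).
  { apply (singular_center_estimate f c N rho s); try easy; [lra|].
    intros w Iw. split.
    - apply Hc, HcD. unfold inbox in *; simpl in *; lra.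
    - apply Rlt_le, Hd1. pose proof (inbox_sq_dist _ _ _ Iw). lra. }
  (* 12 = 2 * 6: a regular square of radius [r] about [w] has a singular [x] in its double, so its
     points are within [6 * r] of [x]. Cauchy's estimate for [f - f x] bounds the derivative by
     [2 * (K * 6 * r) / r]. *)
  assert (Slope : forall w, inbox (sq c (s / 8)) w -> slope_le f w (12 * K)).
  { intros w Iw. destruct (classic (holomorphic_at f w)) as [Hw|Ew].
    - destruct (holomorphic_at_open f w Hw) as (r0 & Hr0 & Hr).
      destruct (largest_regular_square f c w (r0 / 3)) as (r & x & Hrp & Hfree & Ex & Ix);
        [lra|easy| |].
      { intros y Iy. apply Hr. pose proof (inbox_sq_dist _ _ _ Iy). lra. }
      (* A larger square would contain the singular point [c]. So [x] and the whole square stay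
         where [Star] applies. *)
      assert (Hrs : r < s / 8).
      { apply Rnot_le_lt. intros Hle. apply Ec, Hfree. unfold inbox in *; simpl in *; lra. }
      assert (Ixc : inbox (sq c s) x) by (unfold inbox in *; simpl in *; lra).
      destruct (cauchy_square (fun y => f y + - f x)%C w r Hrp) as (g1 & g2 & H1 & H2).
      { intros y Iy. apply cdiffable_plus; [apply holomorphic_at_hol, Hfree, Iy|apply cdiffable_const]. }
      destruct (H1 w) as [Hdw _]; [now rewrite Cmod_self|].
      apply cdiff_slope with (g1 w).
      + eapply cdiff_eq.
        * apply (cdiff_local (fun y => (f y + - f x) + f x)%C f w _ 1); [lra|intros; ring|].
          apply cdiff_plus; [exact Hdw|apply cdiff_const].
        * ring.
      + specialize (H2 (K * (6 * r))).
        replace (2 * (K * (6 * r)) / r) with (12 * K) in H2 by (field; lra). apply H2.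
        intros y Iy. change (Cmod (f y - f x) <= K * (6 * r)).
        assert (Iyx : inbox (sq x (3 * r)) y) by (unfold inbox in *; simpl in *; lra).
        eapply Rle_trans; [apply Star; [easy|easy|unfold inbox in *; simpl in *; lra]|].
        apply Rmult_le_compat_l; [easy|]. pose proof (inbox_sq_dist _ _ _ Iyx). lra.
    - intros eps He. exists s. split; [easy|]. intros y Hy.
      pose proof (Cmod_ge_0 (y - w)).
      eapply Rle_trans; [apply Star; [easy| |]|].
      + unfold inbox in *; simpl in *; lra.
      + apply dist_inbox_sq. lra.
      + apply Rmult_le_compat_r; lra. }
  assert (Lip : forall w1 w2, Cmod (w1 - c) < s / 8 -> Cmod (w2 - c) < s / 8 ->
    Cmod (f w1 - f w2) <= 12 * K * Cmod (w1 - w2)).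
  { intros w1 w2 H1 H2. apply slope_le_segment; [lra|]. intros t Ht. apply Slope.
    apply dist_inbox_sq, Rlt_le, segment_disc; easy. }
  (* The contradiction is reached at [c]: discs of radius [s / 16] about points this close to [c]
     remain where [Lip] holds. *)
  apply Ec. exists (s / 16). split; [lra|]. intros w Hw.
  destruct (Hg w) as [dw Gw].
  { apply HcD, dist_inbox_sq. lra. }
  exists dw. apply (lip_gateaux_cdiff f w dw (12 * K) (s / 16)); try easy; try lra.
  intros w1 w2 H1 H2. pose proof (Cmod_le_plus w1 w c). pose proof (Cmod_le_plus w2 w c).
  apply Lip; lra.
Qed.

(** * Higher derivatives of holomorphic functions *)

Lemma cdiff_unique (f : C -> C) (z a b : C) : cdiff f z a -> cdiff f z b -> a = b.
Proof.
  intros Ha Hb. assert (H : Cmod (a - b) = 0).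
  { apply Rle_antisym; [|apply Cmod_ge_0]. apply le_epsilon. intros eps He. rewrite Rplus_0_l.
    destruct (Ha (eps / 2)) as (d1 & H1 & A1); [lra|].
    destruct (Hb (eps / 2)) as (d2 & H2 & A2); [lra|].
    set (t := Rmin d1 d2 / 2).
    assert (0 < Rmin d1 d2) by (apply Rmin_glb_lt; easy).
    assert (E : Cmod (z + RtoC t - z) = t).
    { replace (z + RtoC t - z)%C with (RtoC t) by ring. rewrite Cmod_R, Rabs_right; unfold t; lra. }
    pose proof (Rmin_l d1 d2). pose proof (Rmin_r d1 d2).
    specialize (A1 (z + RtoC t)%C). specialize (A2 (z + RtoC t)%C). rewrite E in A1, A2.
    specialize (A1 ltac:(unfold t; lra)). specialize (A2 ltac:(unfold t; lra)).
    replace (z + RtoC t - z)%C with (RtoC t) in A1, A2 by ring.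
    apply Rmult_le_reg_r with t; [unfold t; lra|].
    rewrite <- (Rabs_right t) at 1 by (unfold t; lra). rewrite <- Cmod_R, <- Cmod_mult.
    replace ((a - b) * RtoC t)%C with ((f (z + RtoC t)%C - f z - b * RtoC t)
      + - (f (z + RtoC t)%C - f z - a * RtoC t))%C by ring.
    eapply Rle_trans; [apply Cmod_triangle|]. rewrite Cmod_opp. lra. }
  apply Cmod_eq_0 in H. replace a with ((a - b) + b)%C by ring. rewrite H. ring.
Qed.

Definition cderiv (f : C -> C) (z : C) : C := epsilon (inhabits (RtoC 0)) (fun d => cdiff f z d).

Lemma cderiv_spec (f : C -> C) (z : C) : cdiffable f z -> cdiff f z (cderiv f z).
Proof. intros H. exact (epsilon_spec (inhabits (RtoC 0)) _ H). Qed.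

(** By uniqueness the chosen derivative agrees near each point with the explicit one given by
    Cauchy's integral, which is differentiable. *)
Lemma holomorphic_at_cderiv (f : C -> C) (z : C) : holomorphic_at f z -> holomorphic_at (cderiv f) z.
Proof.
  intros H. destruct (holomorphic_at_sq f z H) as (r & Hr & Hw).
  destruct (cauchy_square f z r Hr Hw) as (f1 & f2 & Hd & _).
  exists r. split; [easy|]. intros w Hwz. exists (f2 w).
  apply (cdiff_local f1 (cderiv f) w (f2 w) (r - Cmod (w - z))); [lra| |apply Hd, Hwz].
  intros y Hy. pose proof (Cmod_le_plus y w z) as Ht. destruct (Hd y) as [Hdy _]; [lra|].
  apply (cdiff_unique f y); [easy|]. apply cderiv_spec. eexists. exact Hdy.
Qed.

(** [tcoef f k z] is [f^(k)(z) / k!]. *)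
Fixpoint tcoef (f : C -> C) (k : nat) : C -> C :=
  match k with
  | O => f
  | S j => fun z => (/ RtoC (INR (S j)) * cderiv (tcoef f j) z)%C
  end.

Lemma holomorphic_at_tcoef (f : C -> C) (k : nat) (z : C) : holomorphic_at f z -> holomorphic_at (tcoef f k) z.
Proof.
  intros H. induction k as [|k IH]; [exact H|].
  apply (holomorphic_at_mult (fun _ => / RtoC (INR (S k)))%C); [|now apply holomorphic_at_cderiv].
  exists 1. split; [lra|]. intros; apply cdiffable_const.
Qed.

Lemma cdiff_tcoef (f : C -> C) (k : nat) (z : C) : holomorphic_at f z ->
  cdiff (tcoef f k) z (RtoC (INR (S k)) * tcoef f (S k) z)%C.
Proof.
  intros H. eapply cdiff_eq; [apply cderiv_spec, holomorphic_at_hol, holomorphic_at_tcoef, H|].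
  change (tcoef f (S k) z) with (/ RtoC (INR (S k)) * cderiv (tcoef f k) z)%C.
  field. intros E. apply RtoC_inj in E. revert E. apply not_0_INR. easy.
Qed.

(** * The algebra *)

(** The complex operations of the statement are convertible to those of [C], but [ring] recognises
    only the latter. *)
Ltac to_C :=
  change C0 with (RtoC 0) in *; change C1 with (RtoC 1) in *;
  change Cadd with Cplus in *; change Cmul with Cmult in *;
  change Defs.Copp with Complex.Copp in *; change Cpx with C in *.

(** The detour through [a + 0] restates the equation in the type [C], on which [ring] is
    declared. *)
Ltac cring := to_C; match goal with |- @eq _ ?a ?b => refine (eq_trans (eq_sym (Cplus_0_r a)) _) end; ring.

Lemma RCmul_C (t : R) (z : C) : RCmul t z = (RtoC t * z)%C.
Proof. unfold RCmul, RtoC, Cmult; simpl. f_equal; ring. Qed.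

Lemma Csum_from_ext (lo len : nat) (f g : nat -> C) :
  (forall r, (lo <= r < lo + len)%nat -> f r = g r) ->
  Csum_from lo len f = Csum_from lo len g.
Proof.
  revert lo. induction len as [|len IH]; intros lo H; simpl; [easy|].
  rewrite (H lo) by lia. f_equal. apply IH. intros r Hr. apply H. lia.
Qed.

Lemma Csum_from_plus (lo len : nat) (f g : nat -> C) :
  Csum_from lo len (fun r => f r + g r)%C = (Csum_from lo len f + Csum_from lo len g)%C.
Proof.
  revert lo. induction len as [|len IH]; intros lo; simpl; to_C; [ring|].
  rewrite IH. ring.
Qed.

Lemma Csum_from_scal (c : C) (lo len : nat) (f : nat -> C) :
  Csum_from lo len (fun r => c * f r)%C = (c * Csum_from lo len f)%C.
Proof.
  revert lo. induction len as [|len IH]; intros lo; simpl; to_C; [ring|].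
  rewrite IH. ring.
Qed.

Lemma Csum_from_zero (lo len : nat) (f : nat -> C) :
  (forall r, (lo <= r < lo + len)%nat -> f r = RtoC 0) -> Csum_from lo len f = RtoC 0.
Proof.
  revert lo. induction len as [|len IH]; intros lo H; simpl; to_C; [easy|].
  rewrite (H lo) by lia. rewrite IH; [ring|]. intros r Hr. apply H. lia.
Qed.

Lemma Csum_from_single (lo len r0 : nat) (f : nat -> C) : (lo <= r0 < lo + len)%nat ->
  (forall r, (lo <= r < lo + len)%nat -> r <> r0 -> f r = RtoC 0) -> Csum_from lo len f = f r0.
Proof.
  revert lo. induction len as [|len IH]; intros lo Hr0 H; simpl; to_C; [lia|].
  destruct (Nat.eq_dec lo r0) as [->|Hne].
  - rewrite Csum_from_zero; [ring|]. intros r Hr. apply H; lia.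
  - rewrite (H lo) by lia. rewrite IH; [ring|lia|]. intros r Hr. apply H. lia.
Qed.

Lemma Csum_from_last (lo len : nat) (f : nat -> C) :
  Csum_from lo (S len) f = (Csum_from lo len f + f (lo + len)%nat)%C.
Proof.
  revert lo. induction len as [|len IH]; intros lo.
  - simpl. to_C. rewrite Nat.add_0_r. ring.
  - change (Csum_from lo (S (S len)) f) with (f lo + Csum_from (S lo) (S len) f)%C.
    rewrite IH. simpl. to_C. replace (lo + S len)%nat with (S (lo + len)) by lia. ring.
Qed.

Lemma Csum_from_first (lo len : nat) (f : nat -> C) :
  Csum_from lo (S len) f = (f lo + Csum_from (S lo) len f)%C.
Proof. reflexivity. Qed.

Lemma Csum_from_shift (lo len : nat) (f : nat -> C) :
  Csum_from (S lo) len f = Csum_from lo len (fun r => f (S r)).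
Proof.
  revert lo. induction len as [|len IH]; intros lo; simpl; [easy|]. now rewrite IH.
Qed.

Lemma vec_ext (a b : vec) : (forall r, a r = b r) -> a = b.
Proof. apply functional_extensionality. Qed.

Definition cscal (c : C) (a : vec) : vec := fun r => (c * a r)%C.

Lemma vmul_ext (n m : nat) u Ups (a a' b b' : vec) : veq n a a' -> veq n b b' ->
  vmul n m u Ups a b = vmul n m u Ups a' b'.
Proof.
  intros Ha Hb. apply vec_ext. intros p. unfold vmul, Csum.
  apply Csum_from_ext. intros r Hr. apply Csum_from_ext. intros s Hs.
  rewrite (Ha r), (Hb s) by lia. easy.
Qed.

Lemma vmul_addl (n m : nat) u Ups (a b c : vec) (p : nat) :
  vmul n m u Ups (vadd a b) c p = (vmul n m u Ups a c p + vmul n m u Ups b c p)%C.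
Proof.
  unfold vmul, Csum, vadd. rewrite <- Csum_from_plus. apply Csum_from_ext. intros r _.
  rewrite <- Csum_from_plus. apply Csum_from_ext. intros s _. to_C. ring.
Qed.

Lemma vmul_addr (n m : nat) u Ups (a b c : vec) (p : nat) :
  vmul n m u Ups a (vadd b c) p = (vmul n m u Ups a b p + vmul n m u Ups a c p)%C.
Proof.
  unfold vmul, Csum, vadd. rewrite <- Csum_from_plus. apply Csum_from_ext. intros r _.
  rewrite <- Csum_from_plus. apply Csum_from_ext. intros s _. to_C. ring.
Qed.

Lemma vmul_scall (n m : nat) u Ups (k : C) (a c : vec) (p : nat) :
  vmul n m u Ups (cscal k a) c p = (k * vmul n m u Ups a c p)%C.
Proof.
  unfold vmul, Csum, cscal. rewrite <- Csum_from_scal. apply Csum_from_ext. intros r _.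
  rewrite <- Csum_from_scal. apply Csum_from_ext. intros s _. to_C. ring.
Qed.

Lemma vmul_scalr (n m : nat) u Ups (k : C) (a c : vec) (p : nat) :
  vmul n m u Ups a (cscal k c) p = (k * vmul n m u Ups a c p)%C.
Proof.
  unfold vmul, Csum, cscal. rewrite <- Csum_from_scal. apply Csum_from_ext. intros r _.
  rewrite <- Csum_from_scal. apply Csum_from_ext. intros s _. to_C. ring.
Qed.

Lemma vmul_sumr (n m : nat) u Ups (a : vec) (d : nat -> C) (v : nat -> vec) (lo len p : nat) :
  vmul n m u Ups a (fun j => Csum_from lo len (fun k => d k * v k j)%C) p
  = Csum_from lo len (fun k => d k * vmul n m u Ups a (v k) p)%C.
Proof.
  revert lo. induction len as [|len IH]; intros lo; simpl.
  - unfold vmul, Csum. apply Csum_from_zero. intros r _. apply Csum_from_zero. intros s _.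
    to_C. ring.
  - rewrite <- IH, <- vmul_scalr. apply (vmul_addr n m u Ups a (cscal (d lo) (v lo))).
Qed.

(** The index [q <= m] with [I_q I_p = I_p]. *)
Definition component (m : nat) (u : nat -> nat) (p : nat) : nat := if Nat.leb p m then p else u p.

Ltac struct_cases :=
  unfold struct_const, component in *;
  repeat match goal with
  | |- context [Nat.leb ?a ?b] => destruct (Nat.leb_spec a b)
  | |- context [Nat.ltb ?a ?b] => destruct (Nat.ltb_spec a b)
  | |- context [Nat.eqb ?a ?b] => destruct (Nat.eqb_spec a b)
  | H : context [Nat.leb ?a ?b] |- _ => destruct (Nat.leb_spec a b)
  end; simpl; try easy; try (exfalso; subst; lia).

(** The triangularity behind the peeling: among the products with [s >= p], only [I_q I_p] reaches
    [I_p]. *)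
Lemma struct_const_lead (m : nat) u Ups (r s p : nat) : (p <= s)%nat ->
  (s <> p \/ r <> component m u p) -> struct_const m u Ups r s p = RtoC 0.
Proof. intros H1 H2. struct_cases. Qed.

Lemma struct_const_top (m : nat) u Ups (p : nat) : (component m u p <= m)%nat ->
  struct_const m u Ups (component m u p) p p = RtoC 1.
Proof. intros H. struct_cases. Qed.

Lemma struct_const_idem (m : nat) u Ups (r s p : nat) : (r <= m)%nat ->
  (s <> p \/ r <> component m u p) -> struct_const m u Ups r s p = RtoC 0.
Proof. intros H1 H2. struct_cases. Qed.

(** Multiplication by a nilpotent basis element strictly raises the index; hence its powers die
    out. *)
Lemma struct_const_raise (m : nat) u Ups (r s p : nat) : (m < r)%nat -> (p <= s)%nat ->
  struct_const m u Ups r s p = RtoC 0.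
Proof. intros H1 H2. struct_cases. Qed.

Lemma struct_const_right_idem (m : nat) u Ups (r q p : nat) : (q <= m)%nat ->
  struct_const m u Ups r q p =
  if (Nat.eqb r p && Nat.eqb (component m u p) q)%bool then RtoC 1 else RtoC 0.
Proof. intros H. struct_cases. Qed.

Lemma vmul_single (n m : nat) u Ups (a b : vec) (r s p : nat) :
  (1 <= r <= n)%nat -> (1 <= s <= n)%nat ->
  (forall r' s', (1 <= r' <= n)%nat -> (1 <= s' <= n)%nat -> (s' <> s \/ r' <> r) ->
     (a r' * b s' * struct_const m u Ups r' s' p)%C = RtoC 0) ->
  vmul n m u Ups a b p = (a r * b s * struct_const m u Ups r s p)%C.
Proof.
  intros Hr Hs H. unfold vmul, Csum. rewrite (Csum_from_single 1 n r); [|lia|].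
  - apply (Csum_from_single 1 n s); [lia|]. intros s' Hs' Hne. apply H; lia.
  - intros r' Hr' Hne. apply Csum_from_zero. intros s' Hs'. apply H; lia.
Qed.

(** * Leading coordinates and powers of the nilpotent part *)

Section Algebra.

Variables (n m : nat) (u : nat -> nat) (Ups : nat -> nat -> nat -> Cpx).
Hypothesis alg : is_algebra_Anm n m u Ups.

Notation "a ** b" := (vmul n m u Ups a b) (at level 40, left associativity).

Lemma component_range (p : nat) : (1 <= p <= n)%nat -> (1 <= component m u p <= m)%nat.
Proof.
  destruct alg as (_ & H & _). intros Hp. unfold component.
  destruct (Nat.leb_spec p m); [lia|]. apply H. lia.
Qed.

Lemma vmul_comm (a b : vec) : veq n (a ** b) (b ** a).
Proof. apply alg. Qed.

Lemma vmul_assoc (a b c : vec) : veq n (a ** b ** c) (a ** (b ** c)).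
Proof. apply alg. Qed.

Lemma vmul_lead (a b : vec) (p : nat) : (1 <= p <= n)%nat ->
  (forall s, (1 <= s < p)%nat -> b s = RtoC 0) -> (a ** b) p = (a (component m u p) * b p)%C.
Proof.
  intros Hp Hb. pose proof (component_range p Hp) as Hc. destruct alg as ((_ & Hmn) & _).
  rewrite (vmul_single n m u Ups a b (component m u p) p); [|lia|easy|].
  - rewrite struct_const_top by lia. cring.
  - intros r s Hr Hs Hne. destruct (Nat.lt_ge_cases s p).
    + rewrite (Hb s) by lia. cring.
    + rewrite struct_const_lead by easy. cring.
Qed.

Lemma vmul_unit (a : vec) : veq n (unitA m ** a) a.
Proof.
  intros p Hp. pose proof (component_range p Hp) as Hc. destruct alg as ((_ & Hmn) & _).
  rewrite (vmul_single n m u Ups _ a (component m u p) p); [|lia|easy|].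
  - rewrite struct_const_top by lia. unfold unitA.
    destruct (Nat.leb_spec (component m u p) m); [to_C; ring|lia].
  - intros r s Hr Hs Hne. unfold unitA. destruct (Nat.leb_spec r m).
    + rewrite struct_const_idem by easy. cring.
    + cring.
Qed.

Lemma vmul_raise (a b : vec) (j0 j : nat) : (1 <= j <= n)%nat -> (j <= j0)%nat ->
  (forall r, (1 <= r <= m)%nat -> a r = RtoC 0) ->
  (forall s, (1 <= s <= n)%nat -> (s < j0)%nat -> b s = RtoC 0) -> (a ** b) j = RtoC 0.
Proof.
  intros Hj Hj0 Ha Hb. unfold vmul, Csum.
  apply Csum_from_zero. intros r Hr. apply Csum_from_zero. intros s Hs. to_C.
  destruct (Nat.le_gt_cases r m); [rewrite Ha by lia; cring|].
  destruct (Nat.lt_ge_cases s j0); [rewrite Hb by lia; cring|].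
  rewrite struct_const_raise by lia. cring.
Qed.

Lemma basisI_neq (p q : nat) : p <> q -> basisI q p = RtoC 0.
Proof. intros H. unfold basisI. destruct (Nat.eqb_spec p q); easy. Qed.

Lemma basisI_eq (p : nat) : basisI p p = RtoC 1.
Proof. unfold basisI. now rewrite Nat.eqb_refl. Qed.

Lemma vmul_basisI_r (a : vec) (q j : nat) : (1 <= q <= m)%nat -> (1 <= j <= n)%nat ->
  (a ** basisI q) j = if Nat.eqb (component m u j) q then a j else RtoC 0.
Proof.
  intros Hq Hj. destruct alg as ((_ & Hmn) & _).
  rewrite (vmul_single n m u Ups a _ j q); [|easy|lia|].
  - rewrite struct_const_right_idem, basisI_eq, Nat.eqb_refl by lia. simpl.
    destruct (Nat.eqb _ q); cring.
  - intros r s Hr Hs Hne. destruct (Nat.eq_dec s q) as [->|].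
    + rewrite struct_const_right_idem by lia. destruct (Nat.eqb_spec r j); [lia|]. simpl. cring.
    + rewrite basisI_neq by easy. cring.
Qed.

(** [nilpart q z] is [(z - z_q 1) I_q]. *)
Definition nilpart (q : nat) (z : vec) : vec :=
  fun r => if (Nat.ltb m r && Nat.eqb (u r) q)%bool then z r else RtoC 0.

Lemma nilpart_low (q : nat) (z : vec) (r : nat) : (1 <= r <= m)%nat -> nilpart q z r = RtoC 0.
Proof. intros H. unfold nilpart. destruct (Nat.ltb_spec m r); [lia|easy]. Qed.

Lemma vmul_basisI_split (h : vec) (q : nat) : (1 <= q <= m)%nat ->
  veq n (h ** basisI q) (vadd (cscal (h q) (basisI q)) (nilpart q h)).
Proof.
  intros Hq j Hj. rewrite vmul_basisI_r by easy.
  unfold component, nilpart, vadd, cscal. to_C.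
  destruct (Nat.leb_spec j m), (Nat.ltb_spec m j); try lia; simpl.
  - destruct (Nat.eqb_spec j q) as [->|]; [rewrite basisI_eq|rewrite basisI_neq by easy]; cring.
  - rewrite basisI_neq by lia. destruct (Nat.eqb (u j) q); cring.
Qed.

(** [nilpow p k z] is [(z - z_q 1)^k I_p] with [q = component m u p]. *)
Fixpoint nilpow (p k : nat) (z : vec) : vec :=
  match k with
  | O => basisI p
  | S i => nilpart (component m u p) z ** nilpow p i z
  end.

Lemma nilpow_low (p k : nat) (z : vec) (j : nat) :
  (1 <= j <= n)%nat -> (j < p + k)%nat -> nilpow p k z j = RtoC 0.
Proof.
  revert j. induction k as [|k IH]; intros j Hj Hlt; simpl.
  - apply basisI_neq. lia.
  - apply (vmul_raise _ _ (p + k)); [easy|lia|intros; now apply nilpart_low|].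
    intros s Hs Hsp. now apply IH.
Qed.

Lemma vmul_comm_assoc (a b c : vec) : veq n (a ** (b ** c)) (b ** (a ** c)).
Proof.
  intros j Hj. rewrite <- vmul_assoc by easy.
  rewrite (vmul_ext n m u Ups (a ** b) (b ** a) c c) by (try apply vmul_comm; easy).
  now apply vmul_assoc.
Qed.

Lemma basisI_nilpow (p k : nat) (z : vec) : (1 <= p <= n)%nat ->
  veq n (basisI (component m u p) ** nilpow p k z) (nilpow p k z).
Proof.
  intros Hp. pose proof (component_range p Hp) as Hc.
  induction k as [|k IH]; intros j Hj; simpl.
  - rewrite vmul_comm, vmul_basisI_r by easy. destruct (Nat.eq_dec j p) as [->|].
    + now rewrite Nat.eqb_refl.
    + rewrite basisI_neq by easy. now destruct (Nat.eqb _ _).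
  - rewrite vmul_comm_assoc by easy. now rewrite (vmul_ext n m u Ups _ _ _ _ (fun r _ => eq_refl) IH).
Qed.

(** [I_q] fixes the powers, so [h] acts on them as [h I_q], which is [h_q I_q] plus the nilpotent
    part of [h]. *)
Lemma vmul_nilpow (p k : nat) (z h : vec) (j : nat) : (1 <= p <= n)%nat -> (1 <= j <= n)%nat ->
  (h ** nilpow p k z) j = (h (component m u p) * nilpow p k z j
                           + (nilpart (component m u p) h ** nilpow p k z) j)%C.
Proof.
  intros Hp Hj. pose proof (component_range p Hp) as Hc. set (q := component m u p) in *.
  assert (E := basisI_nilpow p k z Hp).
  assert (E' : veq n (nilpow p k z) (basisI q ** nilpow p k z)) by (intros i Hi; symmetry; now apply E).
  rewrite (vmul_ext n m u Ups h h _ _ (fun r _ => eq_refl) E').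
  rewrite <- vmul_assoc by easy.
  rewrite (vmul_ext n m u Ups _ _ _ _ (vmul_basisI_split h q Hc) (fun r _ => eq_refl)).
  rewrite vmul_addl, vmul_scall. now rewrite E.
Qed.

End Algebra.

(** * Monogenic functions in coordinates *)

(** The right derivative at 0: what monogenicity says about one coordinate along one ray. *)
Definition rder (phi : R -> C) (d : C) : Prop :=
  forall eps, 0 < eps -> exists del, 0 < del /\
    forall t, 0 < t < del -> Cmod (phi t - phi 0 - RtoC t * d) <= eps * t.

Lemma cdiff_rder (F : C -> C) (phi : R -> C) (d : C) :
  cdiff F 0 d -> (forall t, 0 <= t -> F (RtoC t) = phi t) -> rder phi d.
Proof.
  intros H E eps He. destruct (H eps He) as (del & Hdel & Hw). exists del. split; [easy|].
  intros t Ht. specialize (Hw (RtoC t)).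
  replace (RtoC t - 0)%C with (RtoC t) in Hw by ring.
  rewrite Cmod_R, Rabs_right, !E in Hw by lra.
  replace (RtoC t * d)%C with (d * RtoC t)%C by ring. apply Hw. lra.
Qed.

(** A one-sided derivative along the positive reals is a complex derivative of a suitable
    extension, so the rules for [rder] follow from those for [cdiff]. *)
Lemma rder_cdiff (phi : R -> C) (d : C) : rder phi d ->
  exists F, cdiff F 0 d /\ forall t, 0 <= t -> F (RtoC t) = phi t.
Proof.
  intros H.
  set (F := fun w : C => if excluded_middle_informative (snd w = 0 /\ 0 <= fst w)
                     then phi (fst w) else (phi 0 + d * w)%C).
  assert (E : forall t, 0 <= t -> F (RtoC t) = phi t).
  { intros t Ht. unfold F. destruct (excluded_middle_informative _) as [_|N]; [easy|].
    exfalso. apply N. simpl. lra. }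
  exists F. split; [|exact E]. intros eps He. destruct (H eps He) as (del & Hdel & Ht).
  exists del. split; [easy|]. intros w Hw. rewrite (E 0) by lra.
  replace (w - 0)%C with w in * by ring. pose proof (Cmod_ge_0 w) as Pw.
  unfold F. destruct (excluded_middle_informative _) as [[N1 N2]|_].
  - destruct w as [t y]. simpl in N1, N2 |- *. subst y. change (t, 0) with (RtoC t) in *.
    rewrite Cmod_R, Rabs_right in * by lra.
    destruct (Req_dec t 0) as [->|Hne].
    + replace (phi 0 - phi 0 - d * RtoC 0)%C with (RtoC 0) by ring. rewrite Cmod_0. lra.
    + replace (d * RtoC t)%C with (RtoC t * d)%C by ring. apply Ht. lra.
  - replace (phi 0 + d * w - phi 0 - d * w)%C with (RtoC 0) by ring. rewrite Cmod_0.
    apply Rmult_le_pos; lra.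
Qed.

Lemma rder_eq (phi psi : R -> C) (d e : C) :
  rder phi d -> (forall t, phi t = psi t) -> d = e -> rder psi e.
Proof. intros H E <-. replace psi with phi; [easy|]. now apply functional_extensionality. Qed.

Lemma rder_const (c : C) : rder (fun _ => c) 0.
Proof. apply (cdiff_rder (fun _ => c)); [apply cdiff_const|easy]. Qed.

Lemma rder_line (a b : C) : rder (fun t => a + RtoC t * b)%C b.
Proof.
  apply (cdiff_rder (fun w => a + w * b)%C); [|easy].
  eapply cdiff_eq.
  - apply cdiff_plus; [apply cdiff_const|apply cdiff_mult; [apply cdiff_id|apply cdiff_const]].
  - cbv beta. ring.
Qed.

Lemma rder_plus (phi psi : R -> C) (d e : C) :
  rder phi d -> rder psi e -> rder (fun t => phi t + psi t)%C (d + e).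
Proof.
  intros H1 H2. destruct (rder_cdiff _ _ H1) as (F & HF & EF), (rder_cdiff _ _ H2) as (G & HG & EG).
  apply (cdiff_rder (fun w => F w + G w)%C); [now apply cdiff_plus|].
  intros t Ht. now rewrite EF, EG.
Qed.

Lemma rder_mult (phi psi : R -> C) (d e : C) :
  rder phi d -> rder psi e -> rder (fun t => phi t * psi t)%C (d * psi 0 + phi 0 * e).
Proof.
  intros H1 H2. destruct (rder_cdiff _ _ H1) as (F & HF & EF), (rder_cdiff _ _ H2) as (G & HG & EG).
  rewrite <- EF, <- EG by lra.
  apply (cdiff_rder (fun w => F w * G w)%C); [now apply cdiff_mult|].
  intros t Ht. now rewrite EF, EG.
Qed.

Lemma rder_comp (g : C -> C) (phi : R -> C) (d e : C) :
  rder phi d -> cdiff g (phi 0) e -> rder (fun t => g (phi t)) (e * d).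
Proof.
  intros H1 H2. destruct (rder_cdiff _ _ H1) as (F & HF & EF). rewrite <- EF in H2 by lra.
  apply (cdiff_rder (fun w => g (F w))); [now apply cdiff_comp|].
  intros t Ht. now rewrite EF.
Qed.

Lemma rder_Csum_from (phi : nat -> R -> C) (d : nat -> C) (lo len : nat) :
  (forall r, (lo <= r < lo + len)%nat -> rder (phi r) (d r)) ->
  rder (fun t => Csum_from lo len (fun r => phi r t)) (Csum_from lo len d).
Proof.
  revert lo. induction len as [|len IH]; intros lo H; simpl.
  - apply rder_const.
  - apply rder_plus; [apply H; lia|]. apply IH. intros r Hr. apply H. lia.
Qed.

Lemma rder_zero_unique (phi : R -> C) (d : C) (r : R) : 0 < r ->
  (forall t, 0 <= t < r -> phi t = 0) -> rder phi d -> d = 0.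
Proof.
  intros Hr E H. apply Cmod_eq_0. apply Rle_antisym; [|apply Cmod_ge_0].
  apply le_epsilon. intros eps He. rewrite Rplus_0_l.
  destruct (H eps He) as (del & Hdel & Ht). set (t := Rmin del r / 2).
  assert (0 < Rmin del r) by (apply Rmin_glb_lt; easy).
  pose proof (Rmin_l del r). pose proof (Rmin_r del r).
  specialize (Ht t ltac:(unfold t; lra)). rewrite !E in Ht by (unfold t; lra).
  replace (0 - 0 - RtoC t * d)%C with (- (RtoC t * d))%C in Ht by ring.
  rewrite Cmod_opp, Cmod_mult, Cmod_R, Rabs_right in Ht by (unfold t; lra).
  apply Rmult_le_reg_l with t; [unfold t; lra|]. lra.
Qed.

(** * Continuity and monogenicity coordinate by coordinate *)

Lemma Cmod_le_Cnorm (z : C) : Cmod z <= Cnorm z.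
Proof. apply Cmod_le_abs. Qed.

Lemma Cnorm_le_Cmod (z : C) : Cnorm z <= 2 * Cmod z.
Proof.
  unfold Cnorm. pose proof (abs_fst_le_Cmod z). pose proof (abs_snd_le_Cmod z). lra.
Qed.

Lemma Cnorm_ge_0 (z : C) : 0 <= Cnorm z.
Proof. unfold Cnorm. pose proof (Rabs_pos (fst z)). pose proof (Rabs_pos (snd z)). lra. Qed.

Lemma Rsum_norm_ge_0 (lo len : nat) (a : vec) : 0 <= Rsum_norm lo len a.
Proof.
  revert lo. induction len as [|len IH]; intros lo; simpl; [lra|].
  pose proof (Cnorm_ge_0 (a lo)). specialize (IH (S lo)). lra.
Qed.

Lemma vnorm_ge_0 (n : nat) (a : vec) : 0 <= vnorm n a.
Proof. apply Rsum_norm_ge_0. Qed.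

Lemma Cmod_le_vnorm (n : nat) (a : vec) (j : nat) : (1 <= j <= n)%nat -> Cmod (a j) <= vnorm n a.
Proof.
  intros Hj. apply Rle_trans with (1 := Cmod_le_Cnorm _). unfold vnorm.
  assert (H : forall len lo, (lo <= j < lo + len)%nat -> Cnorm (a j) <= Rsum_norm lo len a).
  { induction len as [|len IH]; intros lo Hlo; simpl; [lia|].
    pose proof (Rsum_norm_ge_0 (S lo) len a). pose proof (Cnorm_ge_0 (a lo)).
    destruct (Nat.eq_dec lo j) as [->|]; [lra|]. specialize (IH (S lo) ltac:(lia)). lra. }
  apply H. lia.
Qed.

Lemma vnorm_le (n : nat) (a : vec) (e : R) :
  (forall j, (1 <= j <= n)%nat -> Cmod (a j) <= e) -> vnorm n a <= 2 * INR n * e.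
Proof.
  intros H. unfold vnorm.
  assert (G : forall len lo, (forall j, (lo <= j < lo + len)%nat -> Cmod (a j) <= e) ->
            Rsum_norm lo len a <= 2 * INR len * e).
  { induction len as [|len IH]; intros lo Hlo; [simpl; lra|].
    rewrite S_INR. simpl. specialize (IH (S lo)).
    pose proof (Cnorm_le_Cmod (a lo)). pose proof (Hlo lo ltac:(lia)).
    specialize (IH ltac:(intros; apply Hlo; lia)). lra. }
  apply G. intros j Hj. apply H. lia.
Qed.

Lemma common_delta (n : nat) (P : nat -> R -> Prop) :
  (forall j d d', 0 < d' <= d -> P j d -> P j d') ->
  (forall j, (1 <= j <= n)%nat -> exists d, 0 < d /\ P j d) ->
  exists d, 0 < d /\ forall j, (1 <= j <= n)%nat -> P j d.
Proof.
  intros Hmono H. induction n as [|n IH].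
  - exists 1. split; [lra|]. intros; lia.
  - destruct IH as (d1 & H1 & A1); [intros; apply H; lia|].
    destruct (H (S n) ltac:(lia)) as (d2 & H2 & A2).
    assert (0 < Rmin d1 d2) by (apply Rmin_glb_lt; easy).
    exists (Rmin d1 d2). split; [easy|]. intros j Hj.
    destruct (Nat.eq_dec j (S n)) as [->|].
    + apply (Hmono _ d2); [split; [easy|apply Rmin_r]|easy].
    + apply (Hmono _ d1); [split; [easy|apply Rmin_l]|apply A1; lia].
Qed.

Definition vcont (n : nat) (Om : vec -> Prop) (phi : vec -> C) (z : vec) : Prop :=
  forall eps, 0 < eps -> exists d, 0 < d /\
    forall w, Om w -> vnorm n (vsub w z) < d -> Cmod (phi w - phi z) < eps.

Lemma vcont_const (n : nat) Om (c : C) (z : vec) : vcont n Om (fun _ => c) z.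
Proof. intros eps He. exists 1. split; [lra|]. intros. rewrite Cmod_self. lra. Qed.

Lemma vcont_coord (n : nat) Om (j : nat) (z : vec) : (1 <= j <= n)%nat ->
  vcont n Om (fun w => w j) z.
Proof.
  intros Hj eps He. exists eps. split; [easy|]. intros w _ Hw.
  eapply Rle_lt_trans; [apply (Cmod_le_vnorm n (vsub w z) j Hj)|easy].
Qed.

Lemma vcont_plus (n : nat) Om (phi psi : vec -> C) (z : vec) :
  vcont n Om phi z -> vcont n Om psi z -> vcont n Om (fun w => phi w + psi w)%C z.
Proof.
  intros H1 H2 eps He.
  destruct (H1 (eps / 2)) as (d1 & Hd1 & A1); [lra|].
  destruct (H2 (eps / 2)) as (d2 & Hd2 & A2); [lra|].
  exists (Rmin d1 d2). split; [apply Rmin_glb_lt; easy|]. intros w Ow Hw.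
  specialize (A1 w Ow (Rlt_le_trans _ _ _ Hw (Rmin_l _ _))).
  specialize (A2 w Ow (Rlt_le_trans _ _ _ Hw (Rmin_r _ _))).
  replace (phi w + psi w - (phi z + psi z))%C
    with ((phi w - phi z) + (psi w - psi z))%C by ring.
  eapply Rle_lt_trans; [apply Cmod_triangle|]. lra.
Qed.

Lemma vcont_mult (n : nat) Om (phi psi : vec -> C) (z : vec) :
  vcont n Om phi z -> vcont n Om psi z -> vcont n Om (fun w => phi w * psi w)%C z.
Proof.
  intros H1 H2 eps He. destruct (Cmult_continuous (phi z) (psi z) eps He) as (e & Hpos & Hm).
  destruct (H1 e Hpos) as (d1 & Hd1 & A1). destruct (H2 e Hpos) as (d2 & Hd2 & A2).
  exists (Rmin d1 d2). split; [apply Rmin_glb_lt; easy|]. intros w Ow Hw.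
  apply Hm.
  - apply A1; [easy|]. apply Rlt_le_trans with (1 := Hw), Rmin_l.
  - apply A2; [easy|]. apply Rlt_le_trans with (1 := Hw), Rmin_r.
Qed.

Lemma vcont_comp (n : nat) Om (g : C -> C) (phi : vec -> C) (z : vec) :
  vcont n Om phi z -> ccont g (phi z) -> vcont n Om (fun w => g (phi w)) z.
Proof.
  intros H1 H2 eps He. destruct (H2 eps He) as (e & Hpos & Hm).
  destruct (H1 e Hpos) as (d & Hd & A). exists d. split; [easy|]. intros w Ow Hw.
  now apply Hm, A.
Qed.

Lemma vcont_Csum_from (n : nat) Om (phi : nat -> vec -> C) (lo len : nat) (z : vec) :
  (forall r, (lo <= r < lo + len)%nat -> vcont n Om (phi r) z) ->
  vcont n Om (fun w => Csum_from lo len (fun r => phi r w)) z.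
Proof.
  revert lo. induction len as [|len IH]; intros lo H; simpl.
  - apply vcont_const.
  - apply vcont_plus; [apply H; lia|]. apply IH. intros r Hr. apply H. lia.
Qed.

Lemma continuous_on_vcont (n : nat) (Om : vec -> Prop) (Phi : vec -> vec) :
  continuous_on n Om Phi <->
  (forall z, Om z -> forall j, (1 <= j <= n)%nat -> vcont n Om (fun w => Phi w j) z).
Proof.
  split.
  - intros H z Oz j Hj eps He. destruct (H z Oz eps He) as (d & Hd & Hw).
    exists d. split; [easy|]. intros w Ow Hwz.
    eapply Rle_lt_trans; [apply (Cmod_le_vnorm n (vsub (Phi w) (Phi z)) j Hj)|].
    now apply Hw.
  - intros H z Oz eps He.
    assert (Hn := pos_INR n).
    set (e := eps / (2 * INR n + 1)).
    assert (He' : 0 < e) by (apply Rdiv_lt_0_compat; lra).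
    destruct (common_delta n (fun j d => forall w, Om w -> vnorm n (vsub w z) < d ->
                Cmod (Phi w j - Phi z j) < e)) as (d & Hd & Hw).
    + intros j d d' Hdd HP w Ow Hw. apply HP; [easy|lra].
    + intros j Hj. apply (H z Oz j Hj e He').
    + exists d. split; [easy|]. intros w Ow Hwz.
      apply Rle_lt_trans with (2 * INR n * e).
      * apply vnorm_le. intros j Hj. apply Rlt_le. now apply Hw.
      * assert (e * (2 * INR n + 1) = eps) by (unfold e; field; lra). lra.
Qed.

Lemma vadd_scal0 (z h : vec) : vadd z (vscal 0 h) = z.
Proof.
  apply vec_ext. intros r. unfold vadd, vscal. rewrite RCmul_C. cring.
Qed.

Lemma derivative_components (n : nat) (Phi : vec -> vec) (z h d : vec) :
  (forall eta, eta > 0 -> exists del, del > 0 /\ forall eps, 0 < eps < del ->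
     vnorm n (vsub (vscal (/ eps) (vsub (Phi (vadd z (vscal eps h))) (Phi z))) d) < eta) <->
  (forall j, (1 <= j <= n)%nat -> rder (fun t => Phi (vadd z (vscal t h)) j) (d j)).
Proof.
  assert (E : forall t j, 0 < t ->
    Cmod (vsub (vscal (/ t) (vsub (Phi (vadd z (vscal t h))) (Phi z))) d j) * t
    = Cmod (Phi (vadd z (vscal t h)) j - Phi z j - RtoC t * d j)).
  { intros t j Ht. unfold vsub, vscal. rewrite RCmul_C. to_C.
    assert (Et : t = Cmod (RtoC t)) by (rewrite Cmod_R, Rabs_right; lra).
    match goal with |- ?x * t = _ => replace (x * t) with (x * Cmod (RtoC t)) by now rewrite <- Et end.
    rewrite <- Cmod_mult.
    f_equal. rewrite RtoC_inv by lra. field. intros E. apply RtoC_inj in E. lra. }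
  split.
  - intros H j Hj eps He. destruct (H eps He) as (del & Hdel & Ht). exists del. split; [easy|].
    intros t Htd. rewrite vadd_scal0, <- E by lra. apply Rmult_le_compat_r; [lra|].
    apply Rle_trans with (1 := Cmod_le_vnorm n _ j Hj), Rlt_le, Ht, Htd.
  - intros H eta Heta. assert (Hn := pos_INR n).
    set (e := eta / (2 * INR n + 1)).
    assert (He' : 0 < e) by (apply Rdiv_lt_0_compat; lra).
    destruct (common_delta n (fun j del => forall t, 0 < t < del ->
       Cmod (Phi (vadd z (vscal t h)) j - Phi z j - RtoC t * d j) <= e * t)) as (del & Hd & Ht).
    + intros j d1 d2 Hdd HP t Ht. apply HP. lra.
    + intros j Hj. destruct (H j Hj e He') as (del & Hdel & Ht). exists del. split; [easy|].
      intros t Htd. specialize (Ht t Htd). now rewrite vadd_scal0 in Ht.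
    + exists del. split; [easy|]. intros t Htd.
      apply Rle_lt_trans with (2 * INR n * e).
      * apply vnorm_le. intros j Hj. apply Rmult_le_reg_r with t; [lra|].
        rewrite E by lra. now apply Ht.
      * assert (e * (2 * INR n + 1) = eta) by (unfold e; field; lra). lra.
Qed.

Lemma monogenic_components (n m : nat) u Ups (k : nat) a (Om : vec -> Prop) (Phi : vec -> vec) :
  monogenic n m u Ups k a Om Phi <->
  (forall z, Om z -> forall j, (1 <= j <= n)%nat -> vcont n Om (fun w => Phi w j) z) /\
  (forall z, Om z -> exists Phi' : vec, forall h, inE n m k a h ->
     forall j, (1 <= j <= n)%nat ->
       rder (fun t => Phi (vadd z (vscal t h)) j) (vmul n m u Ups h Phi' j)).
Proof.
  unfold monogenic. rewrite continuous_on_vcont. split; intros [H1 H2]; (split; [exact H1|]);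
    intros z Oz; destruct (H2 z Oz) as [Phi' H]; exists Phi'; intros h Hh;
    apply derivative_components, H, Hh.
Qed.

Lemma rder_vmul (n m : nat) u Ups (A B : R -> vec) (A' B' : vec) (p : nat) :
  (forall j, (1 <= j <= n)%nat -> rder (fun t => A t j) (A' j)) ->
  (forall j, (1 <= j <= n)%nat -> rder (fun t => B t j) (B' j)) ->
  rder (fun t => vmul n m u Ups (A t) (B t) p)
    (vmul n m u Ups A' (B 0) p + vmul n m u Ups (A 0) B' p)%C.
Proof.
  intros HA HB. unfold vmul, Csum. rewrite <- Csum_from_plus.
  apply (rder_Csum_from (fun r t => Csum_from 1 n (fun s => Cmul (Cmul (A t r) (B t s)) _))).
  intros r Hr. rewrite <- Csum_from_plus.
  apply (rder_Csum_from (fun s t => Cmul (Cmul (A t r) (B t s)) _)).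
  intros s Hs. eapply rder_eq.
  - apply rder_mult; [apply rder_mult; [apply (HA r); lia|apply (HB s); lia]|apply rder_const].
  - intros t. reflexivity.
  - cring.
Qed.

Lemma vcont_vmul (n m : nat) u Ups Om (A B : vec -> vec) (z : vec) (p : nat) :
  (forall j, (1 <= j <= n)%nat -> vcont n Om (fun w => A w j) z) ->
  (forall j, (1 <= j <= n)%nat -> vcont n Om (fun w => B w j) z) ->
  vcont n Om (fun w => vmul n m u Ups (A w) (B w) p) z.
Proof.
  intros HA HB.
  apply (vcont_Csum_from n Om (fun r w => Csum_from 1 n (fun s => Cmul (Cmul (A w r) (B w s)) _))).
  intros r Hr. apply (vcont_Csum_from n Om (fun s w => Cmul (Cmul (A w r) (B w s)) _)).
  intros s Hs. apply vcont_mult; [apply vcont_mult; [apply HA; lia|apply HB; lia]|apply vcont_const].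
Qed.

Lemma rder_coord (z h : vec) (j : nat) : rder (fun t => vadd z (vscal t h) j) (h j).
Proof.
  eapply rder_eq; [apply (rder_line (z j) (h j))| |reflexivity].
  intros t. unfold vadd, vscal. now rewrite RCmul_C.
Qed.

(** Cauchy's integral of [G(t) (t - z)^-1 I_p], that is
    [sum_k G^(k)(z_q)/k! (z - z_q)^k I_p] with [q = component m u p]. *)
Definition principal_ext (n m : nat) u Ups (p : nat) (G : C -> C) : vec -> vec :=
  fun z j => Csum_from 0 n (fun k => tcoef G k (z (component m u p)) * nilpow n m u Ups p k z j)%C.

(** * Monogenicity of the extension of one leading coordinate *)

Section PrincipalExtension.

Variables (n m : nat) (u : nat -> nat) (Ups : nat -> nat -> nat -> Cpx).
Hypothesis alg : is_algebra_Anm n m u Ups.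

Lemma vcont_nilpow (Om : vec -> Prop) (p k : nat) (z : vec) (j : nat) :
  vcont n Om (fun w => nilpow n m u Ups p k w j) z.
Proof.
  revert j. induction k as [|k IH]; intros j; simpl; [apply vcont_const|].
  apply (vcont_vmul n m u Ups Om (nilpart m u (component m u p)) (nilpow n m u Ups p k)); [|easy].
  intros i Hi. unfold nilpart. destruct (_ && _)%bool; [now apply vcont_coord|apply vcont_const].
Qed.

(** The power rule, by the Leibniz rule and induction; commutativity gathers the two Leibniz terms
    into one. *)
Lemma rder_nilpow (p k : nat) (z h : vec) (j : nat) : (1 <= j <= n)%nat ->
  rder (fun t => nilpow n m u Ups p k (vadd z (vscal t h)) j)
    match k with
    | O => RtoC 0
    | S i => RtoC (INR (S i)) * vmul n m u Ups (nilpart m u (component m u p) h) (nilpow n m u Ups p i z) j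
    end%C.
Proof.
  set (q := component m u p). revert j. induction k as [|k IH]; intros j Hj; [apply (rder_const (basisI p j))|].
  set (D := fun j => match k with
    | O => RtoC 0
    | S i => RtoC (INR (S i)) * vmul n m u Ups (nilpart m u q h) (nilpow n m u Ups p i z) j
    end%C).
  eapply rder_eq.
  - apply (rder_vmul n m u Ups (fun t => nilpart m u q (vadd z (vscal t h)))
             (fun t => nilpow n m u Ups p k (vadd z (vscal t h))) (nilpart m u q h) D j); [|exact IH].
    intros i Hi. unfold nilpart. destruct (_ && _)%bool; [apply rder_coord|apply rder_const].
  - intros t. reflexivity.
  - cbv beta. rewrite vadd_scal0. unfold D. destruct k as [|i].
    + rewrite (vmul_ext n m u Ups _ _ (fun _ => RtoC 0) (cscal 0 (nilpart m u q z)) (fun r _ => eq_refl)).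
      * rewrite vmul_scalr. simpl INR. cring.
      * intros r _. unfold cscal. cring.
    + set (v := nilpow n m u Ups p i z).
      change (fun j => RtoC (INR (S i)) * vmul n m u Ups (nilpart m u q h) v j)%C
        with (cscal (RtoC (INR (S i))) (vmul n m u Ups (nilpart m u q h) v)).
      rewrite vmul_scalr, (vmul_comm_assoc n m u Ups alg) by easy.
      change (nilpow n m u Ups p (S i) z) with (vmul n m u Ups (nilpart m u q z) v).
      rewrite (S_INR (S i)), RtoC_plus. cring.
Qed.

Lemma principal_ext_low (p : nat) (G : C -> C) (z : vec) (j : nat) : (1 <= j <= n)%nat ->
  (j < p)%nat -> principal_ext n m u Ups p G z j = RtoC 0.
Proof.
  intros Hj Hlt. apply Csum_from_zero. intros k _.
  rewrite (nilpow_low n m u Ups) by lia. cring.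
Qed.

Lemma principal_ext_lead (p : nat) (G : C -> C) (z : vec) : (1 <= p <= n)%nat ->
  principal_ext n m u Ups p G z p = G (z (component m u p)).
Proof.
  intros Hp. unfold principal_ext. rewrite (Csum_from_single 0 n 0); [|lia|].
  - simpl. rewrite basisI_eq. cring.
  - intros k _ Hk. rewrite (nilpow_low n m u Ups) by lia. cring.
Qed.

(** The derivative is the same sum formed with [G']. Comparing it with the termwise derivative
    amounts to a shift of the summation index in the nilpotent contributions. *)
Lemma principal_ext_monogenic (k : nat) a (Om : vec -> Prop) (p : nat) (G : C -> C) :
  (1 <= p <= n)%nat -> (forall z, Om z -> holomorphic_at G (z (component m u p))) ->
  monogenic n m u Ups k a Om (principal_ext n m u Ups p G).
Proof.
  intros Hp HG. pose proof (component_range n m u Ups alg p Hp) as Hc.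
  assert (Hmn : (m <= n)%nat) by (destruct alg as ((_ & H) & _); exact H).
  set (q := component m u p) in *.
  apply monogenic_components. split.
  - intros z Oz j Hj. unfold principal_ext.
    apply (vcont_Csum_from n Om (fun i w => tcoef G i (w q) * nilpow n m u Ups p i w j)%C).
    intros i _. apply vcont_mult; [|apply vcont_nilpow].
    apply (vcont_comp n Om (tcoef G i) (fun w => w q)); [apply vcont_coord; lia|].
    apply cdiffable_ccont, holomorphic_at_hol, holomorphic_at_tcoef, HG, Oz.
  - intros z Oz.
    set (d := fun i => (RtoC (INR (S i)) * tcoef G (S i) (z q))%C).
    set (v := fun i => nilpow n m u Ups p i z).
    exists (fun j => Csum_from 0 n (fun i => d i * v i j)%C).
    intros h _ j Hj. rewrite (vmul_sumr n m u Ups h d v).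
    set (N := fun i => vmul n m u Ups (nilpart m u q h) (v i) j).
    eapply rder_eq.
    + apply (rder_Csum_from (fun i t => tcoef G i (vadd z (vscal t h) q)
               * nilpow n m u Ups p i (vadd z (vscal t h)) j)%C).
      intros i _. apply rder_mult.
      * apply (rder_comp (tcoef G i) (fun t => vadd z (vscal t h) q)); [apply rder_coord|].
        rewrite vadd_scal0. apply cdiff_tcoef, HG, Oz.
      * now apply rder_nilpow.
    + intros t. reflexivity.
    + cbv beta. rewrite vadd_scal0, Csum_from_plus. fold q.
      transitivity (Csum_from 0 n (fun i => d i * h q * v i j)%C + Csum_from 0 n (fun i => d i * N i)%C)%C.
      2:{ rewrite <- Csum_from_plus. apply Csum_from_ext. intros i _. unfold N, v.
          rewrite (vmul_nilpow n m u Ups alg p i z h j) by easy. fold q. cring. }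
      f_equal. destruct n as [|n']; [easy|].
      (* The shifted sum is one term shorter. The surplus term is zero, because [nilpow] of exponent
         [n'] starts at index [p + n' >= n] and one more nilpotent factor raises it beyond [n]. *)
      rewrite (Csum_from_last 0 n' (fun i => d i * N i)%C).
      replace (N (0 + n')%nat) with (RtoC 0).
      * rewrite Csum_from_first, Csum_from_shift.
        rewrite (Csum_from_ext 0 n' _ (fun i => d i * N i)%C).
        -- cring.
        -- intros i _. unfold d, N, v. cring.
      * symmetry. unfold N, v. apply (vmul_raise (S n') m u Ups _ _ (p + n')); [easy|lia| |].
        -- intros r Hr. now apply nilpart_low.
        -- intros s Hs Hlt. apply (nilpow_low (S n') m u Ups); easy.
Qed.

End PrincipalExtension.

(** * Peeling off the coordinates *)

Lemma Rsum_norm_scal (t : R) (a : vec) (lo len : nat) :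
  Rsum_norm lo len (vscal t a) = Rabs t * Rsum_norm lo len a.
Proof.
  revert lo. induction len as [|len IH]; intros lo; simpl; [ring|].
  rewrite IH. unfold vscal, Cnorm, RCmul; simpl. rewrite !Rabs_mult. ring.
Qed.

Lemma vnorm_scal (n : nat) (t : R) (a : vec) : vnorm n (vscal t a) = Rabs t * vnorm n a.
Proof. apply Rsum_norm_scal. Qed.

Lemma vnorm_add (n : nat) (a b : vec) : vnorm n (vadd a b) <= vnorm n a + vnorm n b.
Proof.
  unfold vnorm. generalize 1%nat. induction n as [|n IH]; intros lo; simpl; [lra|].
  specialize (IH (S lo)). unfold vadd at 1, Cnorm, Cadd; simpl.
  pose proof (Rabs_triang (fst (a lo)) (fst (b lo))).
  pose proof (Rabs_triang (snd (a lo)) (snd (b lo))). lra.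
Qed.

Lemma vsub_add_l (z h : vec) : vsub (vadd z h) z = h.
Proof. apply vec_ext. intros r. unfold vsub, vadd. cring. Qed.

Lemma vadd_scal_step (z h : vec) (t s : R) :
  vadd (vadd z (vscal t h)) (vscal s h) = vadd z (vscal (t + s) h).
Proof.
  apply vec_ext. intros r. unfold vadd, vscal. rewrite !RCmul_C, RtoC_plus. cring.
Qed.

Lemma vsub_line (z h : vec) (t s : R) :
  vsub (vadd z (vscal s h)) (vadd z (vscal t h)) = vscal (s - t) h.
Proof.
  apply vec_ext. intros r. unfold vsub, vadd, vscal. rewrite !RCmul_C, RtoC_minus. cring.
Qed.

Lemma vadd_scal1_sub (z w : vec) : vadd z (vscal 1 (vsub w z)) = w.
Proof.
  apply vec_ext. intros r. unfold vsub, vadd, vscal. rewrite !RCmul_C. cring.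
Qed.

Lemma inE_comb (n m k : nat) a (s t : R) (z w : vec) :
  inE n m k a z -> inE n m k a w -> inE n m k a (vadd (vscal s z) (vscal t w)).
Proof.
  intros [x Hx] [y Hy]. exists (fun j => s * x j + t * y j). intros r Hr.
  unfold vadd, vscal. rewrite (Hx r Hr), (Hy r Hr). unfold lincomb, Csum.
  rewrite !RCmul_C, <- !Csum_from_scal. to_C. rewrite <- Csum_from_plus.
  apply Csum_from_ext. intros j _. rewrite !RCmul_C, RtoC_plus, !RtoC_mult. cring.
Qed.

Lemma inE_line (n m k : nat) a (t : R) (z h : vec) :
  inE n m k a z -> inE n m k a h -> inE n m k a (vadd z (vscal t h)).
Proof.
  intros Hz Hh. replace z with (vscal 1 z); [now apply inE_comb|].
  apply vec_ext. intros r. unfold vscal. rewrite RCmul_C. cring.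
Qed.

Lemma inE_sub (n m k : nat) a (z w : vec) :
  inE n m k a z -> inE n m k a w -> inE n m k a (vsub z w).
Proof.
  intros Hz Hw. replace (vsub z w) with (vadd z (vscal (-1) w)); [now apply inE_line|].
  apply vec_ext. intros r. unfold vadd, vsub, vscal. rewrite RCmul_C.
  change (-1) with (- (1)). rewrite RtoC_opp. cring.
Qed.

Lemma inE_unit (n m k : nat) a : (1 <= k)%nat -> inE n m k a (unitA m).
Proof.
  intros Hk. exists (fun j => if Nat.eqb j 1 then 1 else 0). intros r _. unfold lincomb, Csum.
  rewrite (Csum_from_single 1 k 1); [|lia|].
  - simpl. unfold e_. simpl. rewrite RCmul_C. cring.
  - intros j _ Hj. destruct (Nat.eqb_spec j 1); [easy|]. rewrite RCmul_C. cring.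
Qed.

Lemma open_line (n m k : nat) a (Om : vec -> Prop) (z h : vec) :
  is_open_in_E n m k a Om -> Om z -> inE n m k a h ->
  exists d, 0 < d /\ forall t, Rabs t < d -> Om (vadd z (vscal t h)).
Proof.
  intros [HE HO] Oz Hh. destruct (HO z Oz) as (d & Hd & Hw).
  pose proof (vnorm_ge_0 n h) as Hp.
  exists (d / (vnorm n h + 1)). split; [apply Rdiv_lt_0_compat; lra|].
  intros t Ht. apply Hw; [apply inE_line; [now apply HE|easy]|].
  rewrite vsub_add_l, vnorm_scal.
  apply Rmult_lt_compat_r with (r := vnorm n h + 1) in Ht; [|lra].
  unfold Rdiv in Ht. rewrite Rmult_assoc, Rinv_l, Rmult_1_r in Ht by lra.
  pose proof (Rabs_pos t). lra.
Qed.

Lemma monogenic_subset (n m : nat) u Ups (k : nat) a (Om Om' : vec -> Prop) (Phi : vec -> vec) :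
  (forall z, Om z -> Om' z) -> monogenic n m u Ups k a Om' Phi -> monogenic n m u Ups k a Om Phi.
Proof.
  intros Hsub [H1 H2]. split; [|intros z Oz; now apply H2, Hsub].
  intros z Oz eta He. destruct (H1 z (Hsub z Oz) eta He) as (d & Hd & Hw).
  exists d. split; [easy|]. intros w Ow. apply Hw. now apply Hsub.
Qed.

Lemma monogenic_comb (n m : nat) u Ups (k : nat) a (Om : vec -> Prop) (Phi Psi : vec -> vec) (c : C) :
  monogenic n m u Ups k a Om Phi -> monogenic n m u Ups k a Om Psi ->
  monogenic n m u Ups k a Om (fun z => vadd (Phi z) (cscal c (Psi z))).
Proof.
  rewrite !monogenic_components. intros [H1 H2] [K1 K2]. split.
  - intros z Oz j Hj. apply vcont_plus; [now apply H1|].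
    apply vcont_mult; [apply vcont_const|now apply K1].
  - intros z Oz. destruct (H2 z Oz) as [Phi' HP], (K2 z Oz) as [Psi' HQ].
    exists (vadd Phi' (cscal c Psi')). intros h Hh j Hj.
    rewrite vmul_addr, vmul_scalr. apply rder_plus; [now apply HP|].
    eapply rder_eq; [apply rder_mult; [apply (rder_const c)|apply (HQ h Hh j Hj)]| |].
    + intros t. reflexivity.
    + cring.
Qed.

Lemma leading_component_holomorphic (n m : nat) u Ups (k : nat) a (Om : vec -> Prop)
    (Phi : vec -> vec) (p : nat) :
  is_algebra_Anm n m u Ups -> (1 <= k)%nat -> is_open_in_E n m k a Om ->
  (forall v, (1 <= v <= m)%nat -> convex_wrt_M n m k a v Om /\
     (forall w : Cpx, exists z, inE n m k a z /\ f_ v z = w)) ->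
  monogenic n m u Ups k a Om Phi -> (1 <= p <= n)%nat ->
  (forall z j, Om z -> (1 <= j < p)%nat -> Phi z j = RtoC 0) ->
  exists G : C -> C, (forall z, Om z -> Phi z p = G (z (component m u p))) /\
    forall w, D_ (component m u p) Om w -> holomorphic_at G w.
Proof.
  intros alg Hk HO Hconv HPhi Hp Hlow.
  apply monogenic_components in HPhi. destruct HPhi as [Hcont Hder].
  pose proof (component_range n m u Ups alg p Hp) as Hq. set (q := component m u p) in *.
  assert (Hmn : (m <= n)%nat) by (destruct alg as ((_ & H) & _); exact H).
  destruct (Hconv q Hq) as [Hcv Hsurj]. destruct HO as [HE HOd].
  assert (HO : is_open_in_E n m k a Om) by (split; easy).
  assert (Hdir : forall z, Om z -> exists c : C, forall h, inE n m k a h ->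
            rder (fun t => Phi (vadd z (vscal t h)) p) (h q * c)%C).
  { intros z Oz. destruct (Hder z Oz) as [Phi' HP]. exists (Phi' p). intros h Hh.
    eapply rder_eq; [apply (HP h Hh p Hp)|reflexivity|].
    apply (vmul_lead n m u Ups alg); [easy|]. intros s Hs.
    assert (Hu := inE_unit n m k a Hk).
    (* The lower coordinates of [Phi'] are the derivatives of those of [Phi] in the direction of the
       unit, and the latter vanish on [Om]. *)
    rewrite <- (vmul_unit n m u Ups alg Phi' s) by lia.
    destruct (open_line n m k a Om z (unitA m) HO Oz Hu) as (d & Hd & Ht).
    apply (rder_zero_unique _ _ d Hd) with (2 := HP (unitA m) Hu s ltac:(lia)).
    intros t Htd. apply Hlow; [|lia]. apply Ht. rewrite Rabs_right; lra. }
  assert (Hfib : forall z w, Om z -> Om w -> z q = w q -> Phi z p = Phi w p).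
  { intros z w Oz Ow E. set (h := vsub w z).
    assert (Hh : inM n m k a q h).
    { split; [apply inE_sub; now apply HE|]. unfold f_, h, vsub. rewrite E. cring. }
    assert (Seg : forall t, 0 <= t <= 1 -> Om (vadd z (vscal t h))) by (apply Hcv; easy).
    (* Here [h q] is 0, so the ray derivative [h q * c] vanishes all along the segment; the slope
       bound is used with [L = 0]. *)
    assert (H0 : Cmod (Phi (vadd z (vscal 1 h)) p - Phi (vadd z (vscal 0 h)) p) <= 0).
    { pose proof (vnorm_ge_0 n h) as Pn.
      apply (right_slope_bound (fun t => Phi (vadd z (vscal t h)) p) 0); [lra| |].
      - intros t Ht eps He. destruct (Hcont _ (Seg t Ht) p Hp eps He) as (d & Hd & Hw).
        exists (d / (vnorm n h + 1)). split; [apply Rdiv_lt_0_compat; lra|].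
        intros s Hs Hst. apply Hw; [now apply Seg|]. rewrite vsub_line, vnorm_scal.
        apply Rmult_lt_compat_r with (r := vnorm n h + 1) in Hst; [|lra].
        unfold Rdiv in Hst. rewrite Rmult_assoc, Rinv_l, Rmult_1_r in Hst by lra.
        pose proof (Rabs_pos (s - t)). lra.
      - intros t Ht eps He. destruct (Hdir _ (Seg t ltac:(lra))) as [c Hc].
        destruct (Hc h (proj1 Hh) eps He) as (d & Hd & Hr).
        exists d. split; [easy|]. intros s Hs _. specialize (Hr s Hs).
        rewrite vadd_scal0, vadd_scal_step in Hr.
        assert (E0 : h q = RtoC 0) by apply Hh. rewrite E0 in Hr.
        replace (Phi (vadd z (vscal (t + s) h)) p - Phi (vadd z (vscal t h)) p
                 - RtoC s * (RtoC 0 * c))%C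
          with (Phi (vadd z (vscal (t + s) h)) p - Phi (vadd z (vscal t h)) p)%C in Hr by ring.
        lra. }
    rewrite vadd_scal0 in H0. unfold h in H0. rewrite vadd_scal1_sub in H0.
    pose proof (Cmod_ge_0 (Phi w p - Phi z p)).
    assert (E1 : (Phi w p - Phi z p)%C = RtoC 0) by (apply Cmod_eq_0; lra).
    replace (Phi w p) with ((Phi w p - Phi z p) + Phi z p)%C by cring.
    rewrite E1. cring. }
  (* By [Hfib] any point of the fibre gives the same value. *)
  set (pre := fun x : C => epsilon (inhabits (fun _ : nat => C0)) (fun w => Om w /\ w q = x)).
  set (G := fun x : C => Phi (pre x) p).
  assert (HG : forall z, Om z -> Phi z p = G (z q)).
  { intros z Oz.
    destruct (epsilon_spec (inhabits (fun _ : nat => C0)) (fun w => Om w /\ w q = z q)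
                (ex_intro _ z (conj Oz eq_refl))) as [O1 E1].
    apply Hfib; [easy|exact O1|]. symmetry. exact E1. }
  destruct (Hsurj (1, 0)) as (s1 & Hs1 & E1), (Hsurj (0, 1)) as (s2 & Hs2 & E2).
  unfold f_ in E1, E2.
  (* A bounded real-linear section of the functional at [q], spanned by preimages of 1 and of the
     imaginary unit. *)
  set (L := fun x : C => vadd (vscal (fst x) s1) (vscal (snd x) s2)).
  assert (HL : forall x, inE n m k a (L x)) by (intros x; now apply inE_comb).
  assert (HLq : forall x, L x q = x).
  { intros [x y]. unfold L, vadd, vscal. rewrite E1, E2. unfold RCmul, Cadd; simpl.
    f_equal; ring. }
  set (K := vnorm n s1 + vnorm n s2 + 1).
  pose proof (vnorm_ge_0 n s1) as P1. pose proof (vnorm_ge_0 n s2) as P2.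
  assert (HLn : forall x, vnorm n (L x) <= K * Cmod x).
  { intros x. unfold L. eapply Rle_trans; [apply vnorm_add|]. rewrite !vnorm_scal.
    pose proof (abs_fst_le_Cmod x) as Q1. pose proof (abs_snd_le_Cmod x) as Q2.
    pose proof (Cmod_ge_0 x).
    assert (Rabs (fst x) * vnorm n s1 <= Cmod x * vnorm n s1) by (apply Rmult_le_compat_r; lra).
    assert (Rabs (snd x) * vnorm n s2 <= Cmod x * vnorm n s2) by (apply Rmult_le_compat_r; lra).
    unfold K. lra. }
  (* Complex numbers near [z q] are lifted to points near [z]. Openness of [D_ q Om] and continuity
     of [G] both follow from this. *)
  assert (Lift : forall z, Om z -> forall d, 0 < d -> exists r, 0 < r /\
    forall x, Cmod (x - z q) < r -> vnorm n (vsub (vadd z (L (x - z q)%C)) z) < d /\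
      vadd z (L (x - z q)%C) q = x /\ inE n m k a (vadd z (L (x - z q)%C))).
  { intros z Oz d Hd. exists (d / K). assert (HK : 0 < K) by (unfold K; lra).
    split; [apply Rdiv_lt_0_compat; lra|]. intros x Hx. split; [|split].
    - rewrite vsub_add_l. apply Rle_lt_trans with (1 := HLn _).
      apply Rmult_lt_compat_l with (r := K) in Hx; [|easy].
      replace (K * (d / K)) with d in Hx by (field; lra). exact Hx.
    - unfold vadd. rewrite HLq. cring.
    - replace (L (x - z q)%C) with (vscal 1 (L (x - z q)%C)).
      + apply inE_line; [now apply HE|apply HL].
      + apply vec_ext. intros r. unfold vscal. rewrite RCmul_C. cring. }
  exists G. split; [exact HG|].
  apply (continuous_gateaux_holomorphic (D_ q Om)).
  - intros x (z & Oz & <-). unfold f_. destruct (HOd z Oz) as (d & Hd & Hw).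
    destruct (Lift z Oz d Hd) as (r & Hr & HLr). exists r. split; [easy|].
    intros y Hy. destruct (HLr y Hy) as (A1 & A2 & A3).
    exists (vadd z (L (y - z q)%C)). split; [now apply Hw|exact A2].
  - intros x (z & Oz & <-) eps He. unfold f_.
    destruct (Hcont z Oz p Hp eps He) as (d1 & Hd1 & Hc).
    destruct (HOd z Oz) as (d2 & Hd2 & Hw).
    assert (Hd : 0 < Rmin d1 d2) by (apply Rmin_glb_lt; easy).
    destruct (Lift z Oz _ Hd) as (r & Hr & HLr). exists r. split; [easy|].
    intros y Hy. destruct (HLr y Hy) as (A1 & A2 & A3).
    assert (Ow : Om (vadd z (L (y - z q)%C))).
    { apply Hw; [easy|]. apply Rlt_le_trans with (1 := A1), Rmin_r. }
    rewrite <- (HG z Oz). rewrite <- A2 at 1. rewrite <- (HG _ Ow).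
    apply Hc; [easy|]. apply Rlt_le_trans with (1 := A1), Rmin_l.
  - intros x (z & Oz & <-). unfold f_. destruct (Hdir z Oz) as [c Hc]. exists c.
    intros w eps He. destruct (Hc (L w) (HL w) eps He) as (d1 & Hd1 & Hr).
    destruct (open_line n m k a Om z (L w) HO Oz (HL w)) as (d2 & Hd2 & Ht).
    exists (Rmin d1 d2). split; [apply Rmin_glb_lt; easy|]. intros t [Ht0 Htd].
    assert (Ow : Om (vadd z (vscal t (L w)))).
    { apply Ht. rewrite Rabs_right by lra. apply Rlt_le_trans with (1 := Htd), Rmin_r. }
    specialize (Hr t (conj Ht0 (Rlt_le_trans _ _ _ Htd (Rmin_l _ _)))).
    rewrite vadd_scal0, HLq, (HG z Oz), (HG _ Ow) in Hr.
    assert (Eq : vadd z (vscal t (L w)) q = (z q + RtoC t * w)%C).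
    { unfold vadd, vscal. rewrite HLq, RCmul_C. cring. }
    rewrite Eq in Hr.
    replace (RtoC t * w * c)%C with (RtoC t * (w * c))%C by ring. exact Hr.
Qed.

(** Induction on the number [d] of coordinates still to be treated; [p] is the first of them. *)
Lemma monogenic_extension (n m : nat) u Ups (k : nat) a (Om : vec -> Prop) (d : nat) :
  is_algebra_Anm n m u Ups -> (1 <= k)%nat -> is_open_in_E n m k a Om ->
  (forall v, (1 <= v <= m)%nat -> convex_wrt_M n m k a v Om /\
     (forall w : Cpx, exists z, inE n m k a z /\ f_ v z = w)) ->
  forall (p : nat) (Phi : vec -> vec), (1 <= p)%nat -> (p + d = S n)%nat ->
  monogenic n m u Ups k a Om Phi ->
  (forall z j, Om z -> (1 <= j < p)%nat -> Phi z j = RtoC 0) ->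
  exists Psi : vec -> vec, (forall z, Om z -> veq n (Psi z) (Phi z)) /\
    monogenic n m u Ups k a (Pi_ n m k a Om) Psi.
Proof.
  intros alg Hk HO Hconv. induction d as [|d IH]; intros p Phi Hp Hd HPhi Hlow.
  (* Here [p = n + 1], so every coordinate of [Phi] vanishes on [Om]. *)
  - exists (fun _ _ => RtoC 0). split.
    + intros z Oz j Hj. rewrite Hlow by (easy || lia). easy.
    + apply monogenic_components. split.
      * intros; apply vcont_const.
      * intros z _. exists (fun _ => RtoC 0). intros h _ j _.
        eapply rder_eq; [apply (rder_const 0)|reflexivity|].
        symmetry. unfold vmul, Csum. apply Csum_from_zero. intros r _.
        apply Csum_from_zero. intros s _. cring.
  - assert (Hpn : (1 <= p <= n)%nat) by lia.
    pose proof (component_range n m u Ups alg p Hpn) as Hq.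
    destruct (leading_component_holomorphic n m u Ups k a Om Phi p) as (G & HG & HGh); try easy.
    set (Psi1 := principal_ext n m u Ups p G).
    assert (HPi : forall z, Om z -> Pi_ n m k a Om z).
    { intros z Oz. split; [now apply HO|]. intros v _. exists z. easy. }
    assert (H1 : monogenic n m u Ups k a (Pi_ n m k a Om) Psi1).
    { apply principal_ext_monogenic; [easy|easy|]. intros z [_ Hz]. apply HGh, Hz, Hq. }
    (* The extension of the leading coordinate is monogenic on all of [Pi_], so the difference is
       still monogenic on [Om] and now vanishes up to index [p]. *)
    destruct (IH (S p) (fun z => vadd (Phi z) (cscal (-(1))%C (Psi1 z)))) as (Psi2 & E2 & H2);
      [lia|lia| | |].
    + apply monogenic_comb; [easy|]. now apply (monogenic_subset n m u Ups k a Om (Pi_ n m k a Om)).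
    + intros z j Oz Hj. unfold vadd, cscal. destruct (Nat.eq_dec j p) as [->|].
      * unfold Psi1. rewrite principal_ext_lead, <- HG by easy. cring.
      * unfold Psi1. rewrite principal_ext_low, Hlow by (easy || lia). cring.
    + exists (fun z => vadd (Psi1 z) (cscal 1 (Psi2 z))). split.
      * intros z Oz j Hj. unfold vadd at 1, cscal. rewrite (E2 z Oz j Hj).
        unfold vadd, cscal. cring.
      * now apply monogenic_comb.
Qed.

Theorem theorem2 (n m : nat) (u : nat -> nat) (Ups : nat -> nat -> nat -> Cpx)
  (k : nat) (a : nat -> nat -> Cpx) (Om : vec -> Prop) (Phi : vec -> vec) :
  is_algebra_Anm n m u Ups ->
  (2 <= k <= 2 * n)%nat ->
  lin_indep n m k a ->
  is_domain n m k a Om ->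
  (forall v, (1 <= v <= m)%nat ->
     convex_wrt_M n m k a v Om /\
     (forall w : Cpx, exists z, inE n m k a z /\ f_ v z = w)) ->
  monogenic n m u Ups k a Om Phi ->
  exists Psi : vec -> vec,
    (forall z, Om z -> veq n (Psi z) (Phi z)) /\
    monogenic n m u Ups k a (Pi_ n m k a Om) Psi.
Proof.
  intros alg Hk _ [HO _] Hconv HPhi.
  (* For [p = 1] the condition on lower coordinates is empty, and all [n] coordinates remain. *)
  apply (monogenic_extension n m u Ups k a Om n alg ltac:(lia) HO Hconv 1%nat Phi); try easy.
  intros; lia.
Qed.
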